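(* Let $n\in\{1,2\}$ and $\gamma>1$. Suppose $\lambda=1$ and $0\le\mu\le 3-n$. Let $A>0$, $\overline\rho>0$, $R>0$ be constants and $\varepsilon>0$, and consider the Cauchy problem for the compressible isentropic Euler equations with time dependent damping $$\begin{cases}\rho_t+\nabla\cdot(\rho u)=0, & (t,x)\in(0,T)\times\mathbb{R}^n,\\ (\rho u)_t+\nabla\cdot(\rho u\otimes u)+\nabla p+\dfrac{\mu\,\rho u}{1+t}=0, & (t,x)\in(0,T)\times\mathbb{R}^n,\\ u(0,x)=\varepsilon u_0(x),\qquad \rho(0,x)=\overline\rho+\varepsilon\rho_0(x),\end{cases}$$ with pressure $p=p(\rho)=A\rho^\gamma$. Assume that $\rho_0\in C_0^\infty(\mathbb{R}^n;\mathbb{R})$ and $u_0\in C_0^\infty(\mathbb{R}^n;\mathbb{R}^n)$ satisfy $$\operatorname{supp}\rho_0,\ \operatorname{supp}u_0\subseteq\{x\in\mathbb{R}^n:|x|\le R\}$$ and $$\int_{\mathbb{R}^n}\rho_0\,\phi\,dx>0,\qquad \int_{\mathbb{R}^n}u_0\cdot\nabla\phi\,dx>0,$$ where $\phi$ is the function defined in the context. Then there exist a constant $\varepsilon_0>0$, depending only on $n,\mu,\gamma,u_0,\rho_0$ (and on the fixed constants $A,\overline\rho,R$), and a constant $C>0$ independent of $\varepsilon$, such that, provided $0<\varepsilon\le\varepsilon_0$, the system has no global solutions and the lifespan $T_\varepsilon$ satisfies $$T_\varepsilon\le\begin{cases}C\,\varepsilon^{-\frac{2}{3-n-\mu}} &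 \text{if } \mu<3-n,\\ \exp\left(C\varepsilon^{-1}\right) & \text{if } \mu=3-n.\end{cases}$$
   Context: Here $\rho:[0,T)\times\mathbb{R}^n\to\mathbb{R}$ is the density, $u:[0,T)\times\mathbb{R}^n\to\mathbb{R}^n$ the velocity and $p$ the pressure of the fluid. Solutions are $C^1$ solutions $(\rho,u)$. The lifespan $T_\varepsilon$ is the largest time such that the solution exists and is $C^1$ on $[0,T_\varepsilon)\times\mathbb{R}^n$; a global solution is one with $T_\varepsilon=+\infty$. The positive function $\phi:\mathbb{R}^n\to\mathbb{R}$ is defined by $$\phi(x)=\frac{1}{n\omega_n}\int_{\mathbb{S}^{n-1}}e^{x\cdot\sigma}\,d\sigma\ \text{ if } n\ge2,\qquad \phi(x)=\frac{e^x+e^{-x}}{2}\ \text{ if } n=1,$$ where $\omega_n=\pi^{n/2}/\Gamma(\frac n2+1)$ is the volume of the $n$-dimensional unit ball, so that $n\omega_n$ is the surface measure of the unit sphere $\mathbb{S}^{n-1}$. *)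

(* Defs.v *)
(* MathComp-Analysis, over an arbitrary [R : realType].  Vectors of R^n are row
   vectors ['rV[R]_n]; they carry the library's max-norm topology, so the
   Euclidean norm is written [enorm]. *)
From HB Require Import structures.
From mathcomp Require Import all_boot all_order all_algebra.
From mathcomp Require Import all_classical all_reals all_analysis.

Set Implicit Arguments.
Unset Strict Implicit.
Unset Printing Implicit Defensive.

Import Order.TTheory GRing.Theory Num.Theory.
Import numFieldNormedType.Exports.

Local Open Scope classical_set_scope.
Local Open Scope ring_scope.

Section Euclidean.
Context {R : realType}.

Definition dotv n (x y : 'rV[R]_n) : R := \sum_(i < n) x 0 i * y 0 i.

Definition enorm n (x : 'rV[R]_n) : R := Num.sqrt (dotv x x).

Definition partial n (i : 'I_n) (f : 'rV[R]_n -> R) (x : 'rV[R]_n) : R :=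
  'D_(delta_mx 0 i) f x.

Definition gradv n (f : 'rV[R]_n -> R) (x : 'rV[R]_n) : 'rV[R]_n :=
  \row_i partial i f x.

Definition divv n (v : 'rV[R]_n -> 'rV[R]_n) (x : 'rV[R]_n) : R :=
  \sum_(i < n) partial i (fun y => v y 0 i) x.

(* Lebesgue integral over R^n as an iterated integral over the coordinates.  It
   is only applied to continuous compactly supported integrands, for which it
   agrees with the integral against n-dimensional Lebesgue measure (Fubini). *)
Fixpoint integralRn n : ('rV[R]_n -> R) -> R :=
  match n with
  | 0 => fun f => f 0
  | m.+1 => fun f : 'rV[R]_(1 + m) -> R =>
      \int[@lebesgue_measure R]_(t in setT)
        integralRn (fun y : 'rV[R]_m => f (row_mx t%:M y))
  end.

(* Integral over the unit sphere S^n of R^(n+1) against surface measure, in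
   spherical coordinates sigma = (cos theta, sin theta * s) with s in S^(n-1)
   and d sigma = (sin theta)^(n-1) d theta ds; on S^0 = {1, -1} it is the
   counting measure. *)
Fixpoint integralS n : ('rV[R]_n.+1 -> R) -> R :=
  match n with
  | 0 => fun g => g (const_mx 1) + g (const_mx (-1))
  | m.+1 => fun g : 'rV[R]_(1 + m.+1) -> R =>
      \int[@lebesgue_measure R]_(theta in `[0, pi])
        (sin theta ^+ m *
         integralS (fun s : 'rV[R]_m.+1 =>
           g (row_mx (cos theta)%:M (sin theta *: s))))
  end.

Definition Gamma (a : R) : R :=
  \int[@lebesgue_measure R]_(t in `]0, +oo[) (t `^ (a - 1) * expR (- t)).

Definition omega (n : nat) : R :=
  pi `^ (n%:R / 2) / Gamma (n%:R / 2 + 1).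

(* The value in dimension 0 is irrelevant. *)
Definition phi n : 'rV[R]_n -> R :=
  match n with
  | 0 => fun=> 1
  | 1 => fun x : 'rV[R]_1 => (expR (x 0 0) + expR (- x 0 0)) / 2
  | m.+2 => fun x : 'rV[R]_m.+2 =>
      (m.+2%:R * omega m.+2)^-1 * integralS (fun s => expR (dotv x s))
  end.

Definition smooth n (f : 'rV[R]_n -> R) : Prop :=
  forall s : seq 'I_n,
    let g := foldr (@partial n) f s in
    continuous g /\ forall i x, derivable g x (delta_mx 0 i).

Definition supp n (V : zmodType) (f : 'rV[R]_n -> V) : set 'rV[R]_n :=
  closure [set x | f x != 0].

Definition test_fun n (f : 'rV[R]_n -> R) : Prop :=
  smooth f /\ compact (supp f).

Definition test_field n (v : 'rV[R]_n -> 'rV[R]_n) : Prop :=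
  (forall i, smooth (fun x => v x 0 i)) /\ compact (supp v).

(* The following two are about functions on [0, T) x R^n with 0 < T <= +oo;
   the values of [f] at other times are ignored. *)
Definition strip_continuous n (T : \bar R) (f : R -> 'rV[R]_n -> R) : Prop :=
  {within [set z : R * 'rV[R]_n | 0 <= z.1 /\ (z.1%:E < T)%E],
    continuous (fun z => f z.1 z.2)}.

(* C^1 up to the initial time: the time derivative at t = 0 is one-sided. *)
Definition strip_C1 n (T : \bar R) (f : R -> 'rV[R]_n -> R) : Prop :=
  exists (ft : R -> 'rV[R]_n -> R) (fx : 'I_n -> R -> 'rV[R]_n -> R),
    [/\ strip_continuous T f,
        strip_continuous T ft,
        forall i, strip_continuous T (fx i) &
        forall t x, 0 <= t -> (t%:E < T)%E ->
          (h^-1 * (f (t + h) x - f t x))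
             @[h --> within [set h : R | 0 <= t + h] 0^'] --> ft t x /\
          forall i, is_derive x (delta_mx 0 i) (f t) (fx i t x)].

(* The sign condition 0 <= rho is what makes the pressure A * rho^gamma
   meaningful for a real exponent (vacuum is allowed). *)
Definition euler_solution n (A gamma mu rhobar eps : R)
    (rho0 : 'rV[R]_n -> R) (u0 : 'rV[R]_n -> 'rV[R]_n) (T : \bar R)
    (rho : R -> 'rV[R]_n -> R) (u : R -> 'rV[R]_n -> 'rV[R]_n) : Prop :=
  [/\ strip_C1 T rho /\ (forall i, strip_C1 T (fun t x => u t x 0 i)),
      forall t x, 0 <= t -> (t%:E < T)%E -> 0 <= rho t x,
      forall t x, 0 < t -> (t%:E < T)%E ->
        derive1 (fun s => rho s x) t + divv (fun y => rho t y *: u t y) x = 0,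
      forall t x (j : 'I_n), 0 < t -> (t%:E < T)%E ->
        derive1 (fun s => rho s x * u s x 0 j) t
        + divv (fun y => (rho t y * u t y 0 j) *: u t y) x
        + partial j (fun y => A * rho t y `^ gamma) x
        + mu * (rho t x * u t x 0 j) / (1 + t) = 0 &
      forall x, u 0 x = eps *: u0 x /\ rho 0 x = rhobar + eps * rho0 x].

Definition lifespan n (A gamma mu rhobar eps : R)
    (rho0 : 'rV[R]_n -> R) (u0 : 'rV[R]_n -> 'rV[R]_n) : \bar R :=
  ereal_sup [set T : \bar R | (0 < T)%E /\ exists rho u,
    euler_solution A gamma mu rhobar eps rho0 u0 T rho u].

End Euclidean.

(* Main.v *)
(* Test the equations against phi, which satisfies Delta phi = phi.  The moments
   X = int (rho - rhobar) phi and Y = int rho u.grad phi satisfy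
     X' = Y,   Y' = c^2 X - mu Y / (1 + t) + G,
   where c is the speed of sound of the rest state and G collects the nonlinear
   terms.  By convexity G >= Phi h(Y / Phi, X / Phi) with h coercive, Phi being
   any bound of the phi-mass of the support of the perturbation; since signals
   travel at speed at most c, Phi = C1 e^(ct) (1 + t)^((n-1)/2) will do.  Put
   kap = c + (mu/2) / (1 + t + k) and f = (Y + kap X) E, where 1 / E solves the
   linearised equation and is comparable to e^(ct) (1 + t)^(-mu/2).  Then
     f' >= d N min((f / N)^2, (f / N)^p),   N = C1 (1 + t)^((n-1+mu)/2),
   with 1 < p <= 2 and f(0) of order eps.  If f reaches N at a large time it blows
   up before twice that time; until then (1/f)' <= - (d / C1) (1 + t)^(-(n-1+mu)/2),
   so 1 / eps bounds the integral of the right-hand side, a power of t or ln t. *)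

(* The mass of [phi] in the ball of radius r + c t is of order e^(ct) (1 + t)^((n-1)/2), because
   [phi] behaves like |x|^(-(n-1)/2) e^|x|. The speed has to be exactly c: a larger speed b would
   leave a factor e^((b-c)t) in N, and the integral of 1 / N would converge. The linearised equation
   X'' + mu X' / (1 + t) = c^2 X factors exactly only through a Riccati equation; kap is an explicit
   approximate solution of it, whose error has the favourable sign. The minimum of two powers
   reflects the two regimes of the density: near rest the form h is quadratic, but for large density
   Y^2 / (rhobar + X) loses a factor, and only a power p survives. The assumption mu <= 3 - n says
   that the exponent a = (n-1+mu)/2 is at most 1. Hence N at most doubles when 1 + t doubles, which
   allows the blow-up within that time, and the integral of (1 + t)^(-a) diverges. All estimates are
   made on [0, sig] with sig < tau < T and constants independent of sig, so that they bound T. *)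
Require Import Defs.
From mathcomp Require Import all_boot all_order all_algebra.
From mathcomp Require Import all_classical all_reals all_analysis.
From mathcomp Require Import ring lra.
Import Order.TTheory GRing.Theory Num.Theory.
Import numFieldNormedType.Exports.
Local Open Scope classical_set_scope.
Local Open Scope ring_scope.
Set Implicit Arguments.
Unset Strict Implicit.
Unset Printing Implicit Defensive.

(** * Calculus on row vectors *)

Section Basics.
Context {R : realType}.

Lemma near0_normr_lt (e : R) : 0 < e -> \forall h \near (0 : R), `|h| < e.
Proof. by move=> e0; exists e => // h; rewrite /ball_ /= sub0r normrN. Qed.

(** Division-free form: h = 0 is not excluded, so increments can be estimated under an integral
    sign. *)
Lemma is_derive_epsP (V : normedModType R) (f : V -> R) (x v : V) (d : R) :
  is_derive x v f d <->
  forall e : R, 0 < e ->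
    \forall h \near (0 : R), `|f (h *: v + x) - f x - h * d| <= e * `|h|.
Proof.
split.
  case=> df <- e e0.
  have /cvgrPdist_le/(_ e e0) := df.
  rewrite /= near_withinE near_simpl.
  apply: filter_app; near=> h => H.
  have [->|h0] := eqVneq h 0.
    by rewrite scale0r add0r subrr mul0r subr0 !normr0 mulr0.
  move: (H h0); rewrite /shift /= distrC.
  rewrite -[X in X - 'D_v f x]/(h^-1 * (f (h *: v + x) - f x)).
  have -> : h^-1 * (f (h *: v + x) - f x) - 'D_v f x =
    h^-1 * (f (h *: v + x) - f x - h * 'D_v f x).
    by rewrite [in RHS]mulrBr mulKf.
  by rewrite normrM normfV ler_pdivrMl ?normr_gt0 // [`|h| * _]mulrC.
move=> Hd.
suff C : (fun h => h^-1 *: ((f \o shift x) (h *: v) - f x)) @ 0^' --> d.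
  split; first by apply/cvg_ex; exists d.
  exact/cvg_lim.
apply/cvgrPdist_le => e e0.
rewrite /= near_withinE near_simpl.
apply: filter_app (Hd e e0); near=> h => Hh h0.
rewrite distrC /shift /=.
rewrite -[X in X - d]/(h^-1 * (f (h *: v + x) - f x)).
have -> : h^-1 * (f (h *: v + x) - f x) - d =
  h^-1 * (f (h *: v + x) - f x - h * d).
  by rewrite [in RHS]mulrBr mulKf.
by rewrite normrM normfV ler_pdivrMl ?normr_gt0 // [`|h| * _]mulrC.
Unshelve. all: by end_near. Qed.

(** Reduces directional derivatives on R^n to one real variable, where the chain rule and the
    fundamental theorem of calculus apply. *)
Lemma is_derive_line (V : normedModType R) (f : V -> R) (x v : V) (s d : R) :
  is_derive (x + s *: v) v f d <-> is_derive s 1 (fun h : R => f (x + h *: v)) d.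
Proof.
split => /is_derive_epsP Hd; apply/is_derive_epsP => e e0; move: (Hd e e0);
  apply: filter_app; near=> h => /=;
  by rewrite -[h *: (1:R)]/(h * 1) mulr1 scalerDl [h *: v + (x + _)]addrCA.
Unshelve. all: by end_near. Qed.

Lemma is_derive_line0 (V : normedModType R) (f : V -> R) (x v : V) (d : R) :
  is_derive x v f d <-> is_derive (0 : R) 1 (fun h : R => f (x + h *: v)) d.
Proof. by rewrite -is_derive_line scale0r addr0. Qed.

Section PointwiseDerive.
Variables (V : normedModType R) (x v : V).
Implicit Types (f g : V -> R) (df dg k : R).

(** These rules keep functions and derivatives in pointwise form, so that the derivative of a long
    expression is built as one proof term and then adjusted by [is_derive_eq]. *)
Lemma derC k : is_derive x v (fun=> k) 0.
Proof. exact: (is_derive_cst k x v). Qed.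

Lemma derD f g df dg : is_derive x v f df -> is_derive x v g dg ->
  is_derive x v (fun y => f y + g y) (df + dg).
Proof. by move=> ? ?; exact: is_deriveD. Qed.

Lemma derN f df : is_derive x v f df -> is_derive x v (fun y => - f y) (- df).
Proof. by move=> ?; exact: is_deriveN. Qed.

Lemma derB f g df dg : is_derive x v f df -> is_derive x v g dg ->
  is_derive x v (fun y => f y - g y) (df - dg).
Proof. by move=> ? ?; exact: is_deriveB. Qed.

Lemma derM f g df dg : is_derive x v f df -> is_derive x v g dg ->
  is_derive x v (fun y => f y * g y) (df * g x + f x * dg).
Proof.
move=> dff dgg; have dm : is_derive x v (f * g) (f x *: dg + g x *: df).
  exact: is_deriveM.
apply: (is_derive_eq dm); rewrite addrC; congr (_ + _); exact: mulrC.
Qed.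

Lemma derZ k f df : is_derive x v f df -> is_derive x v (fun y => k * f y) (k * df).
Proof.
by move=> dff; have := derM (derC k) dff; rewrite mul0r add0r.
Qed.

Lemma der_sum (I : Type) (r : seq I) (F : I -> V -> R) (dF : I -> R) :
  (forall i, is_derive x v (F i) (dF i)) ->
  is_derive x v (fun y => \sum_(i <- r) F i y) (\sum_(i <- r) dF i).
Proof.
move=> H; elim: r => [|i r IH].
  by under eq_fun do rewrite big_nil; rewrite big_nil; exact: derC.
by under eq_fun do rewrite big_cons; rewrite big_cons; exact: derD.
Qed.

Lemma der_comp (h : R -> R) f dh df : is_derive (f x) 1 h dh ->
  is_derive x v f df -> is_derive x v (fun y => h (f y)) (dh * df).
Proof.
move=> hd /is_derive_line0 fd; apply/is_derive_line0.
apply: (@is_derive1_comp _ h (fun s : R => f (x + s *: v))).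
by rewrite scale0r addr0.
Qed.

End PointwiseDerive.

Lemma continuous_rV (T : topologicalType) m n (f : T -> 'M[R]_(m, n)) :
  (forall i j, continuous (fun t => f t i j)) -> continuous f.
Proof.
move=> Hf t; apply/cvgrPdist_le => e e0.
near=> s.
rewrite [leLHS]/Num.Def.normr/= mx_normrE (bigmax_le _ (ltW e0))//= => i _.
rewrite !mxE/=.
move: i; near: s; apply: filter_forall => /= i.
exact: ((cvgrPdist_le _ _).1 (Hf i.1 i.2 t)).
Unshelve. all: by end_near. Qed.

Lemma continuous_pair (T U V : topologicalType) (f : T -> U) (g : T -> V) :
  continuous f -> continuous g -> continuous (fun t => (f t, g t)).
Proof. by move=> cf cg t; apply: cvg_pair; [exact: cf|exact: cg]. Qed.

Section Pointwise.
Variable T : topologicalType.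
Implicit Types f g : T -> R.

Lemma contC (k : R) : continuous (fun _ : T => k).
Proof. exact: cst_continuous. Qed.

Lemma contD f g : continuous f -> continuous g ->
  continuous (fun x => f x + g x).
Proof. by move=> cf cg x; exact: (continuousD (cf x) (cg x)). Qed.

Lemma contM f g : continuous f -> continuous g ->
  continuous (fun x => f x * g x).
Proof. by move=> cf cg x; exact: (continuousM (cf x) (cg x)). Qed.

Lemma contN f : continuous f -> continuous (fun x => - f x).
Proof. by move=> cf x; exact: (continuousN (cf x)). Qed.

Lemma contB f g : continuous f -> continuous g ->
  continuous (fun x => f x - g x).
Proof. by move=> cf cg; apply: contD => //; exact: contN. Qed.

Lemma contZ k f : continuous f -> continuous (fun x => k * f x).
Proof. by move=> cf; apply: contM => //; exact: contC. Qed.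

Lemma contX k f : continuous f -> continuous (fun x => f x ^+ k).
Proof.
move=> cf; elim: k => [|k IH]; first exact: contC.
by under eq_fun do rewrite exprS; exact: contM.
Qed.

Lemma cont_sum (I : Type) (r : seq I) (P : pred I) (F : I -> T -> R) :
  (forall i, continuous (F i)) -> continuous (fun x => \sum_(i <- r | P i) F i x).
Proof.
move=> cF; elim: r => [|i r IH].
  by under eq_fun do rewrite big_nil; exact: contC.
under eq_fun do rewrite big_cons; case: (P i) => //; exact: contD.
Qed.

Lemma cont_comp (h : R -> R) f : continuous h -> continuous f ->
  continuous (fun x => h (f x)).
Proof. by move=> ch cf x; apply: (@continuous_comp _ _ _ f h); [exact: cf|exact: ch]. Qed.

End Pointwise.

Lemma normrV_le n (x : 'rV[R]_n) L : 0 <= L ->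
  (`|x| <= L) <-> (forall i, `|x 0 i| <= L).
Proof.
move=> L0; rewrite [`|x|]/Num.Def.normr/= mx_normrE; split.
  move=> /bigmax_leP[_ H] i; exact: (H (0, i)).
by move=> H; apply/bigmax_leP; split => // -[i j] _; rewrite ord1.
Qed.

Lemma compact_rVball n (L : R) : compact [set x : 'rV[R]_n | `|x| <= L].
Proof.
apply: bounded_closed_compact.
  exists L; split; first exact: num_real.
  by move=> M LM x /= xL; rewrite (le_trans xL)// ltW.
have -> : [set x : 'rV[R]_n | `|x| <= L] = (fun x : 'rV[R]_n => `|x|) @^-1` [set y : R | y <= L].
  by apply/seteqP; split.
apply: closed_comp; last exact: closed_le.
by move=> x _; exact: norm_continuous.
Qed.

Definition jc (T : topologicalType) n (g : T -> 'rV[R]_n -> R) :=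
  continuous (fun z : T * 'rV[R]_n => g z.1 z.2).

Definition csupp n (L : R) (f : 'rV[R]_n -> R) :=
  forall x, L < `|x| -> f x = 0.

Lemma jc_fst (T : topologicalType) n (h : T -> R) :
  continuous h -> jc (fun t (_ : 'rV[R]_n) => h t).
Proof.
move=> ch z; apply: (@continuous_comp _ _ _ fst h); [exact: cvg_fst|exact: ch].
Qed.

Lemma jc_snd (T : topologicalType) n (h : 'rV[R]_n -> R) :
  continuous h -> jc (fun (_ : T) x => h x).
Proof.
move=> ch z; apply: (@continuous_comp _ _ _ snd h); [exact: cvg_snd|exact: ch].
Qed.

Lemma jc_slice (T : topologicalType) n (g : T -> 'rV[R]_n -> R) t :
  jc g -> continuous (g t).
Proof.
move=> cg x.
have c : continuous (fun x : 'rV[R]_n => (t, x)).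
  by apply: (@continuous_pair _ _ _ (fun=> t) id); [exact: cst_continuous|move=> y].
by apply: (@continuous_comp _ _ _ (fun x => (t, x)) (fun z => g z.1 z.2));
  [exact: c|exact: cg].
Qed.

Lemma jc_slice1 (T : topologicalType) n (g : T -> 'rV[R]_n -> R) x :
  jc g -> continuous (g ^~ x).
Proof.
move=> cg t.
have c : continuous (fun t : T => (t, x)).
  by apply: (@continuous_pair _ _ _ id (fun=> x)); [move=> y|exact: cst_continuous].
by apply: (@continuous_comp _ _ _ (fun t => (t, x)) (fun z => g z.1 z.2));
  [exact: c|exact: cg].
Qed.

(** Tube-lemma argument: compactness of the ball makes the joint continuity at time t uniform in
    x. *)
Lemma jc_unif (T : topologicalType) n (g : T -> 'rV[R]_n -> R) L t e :
  jc g -> 0 < e ->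
  \forall s \near t, forall x, `|x| <= L -> `|g s x - g t x| <= e.
Proof.
move=> cg e0.
have /compact_near_coveringP cov := @compact_rVball n L.
have := cov T (nbhs t) (fun s x => `|g s x - g t x| <= e) _; apply.
move=> x _.
have e20 : 0 < e / 2 by rewrite divr_gt0.
have /cvgrPdist_le/(_ _ e20) H1 := cg (t, x).
have /cvgrPdist_le/(_ _ e20) H2 := @jc_slice T n g t cg x.
case: H1 => -[/= A B] [tA xB] AB.
exists ([set y | B y /\ `|g t x - g t y| <= e / 2], A) => /=.
  by split => //; apply: filterI.
move=> [y s] [/= [By gy] As].
have /= := AB (s, y) (conj As By).
have -> : g s y - g t y = - (g t x - g s y) + (g t x - g t y) by ring.
move=> H; rewrite (le_trans (ler_normD _ _))// normrN [leRHS]splitr lerD//.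
Qed.

End Basics.

(** * Iterated integrals of continuous compactly supported functions *)

Section Integral1.
Context {R : realType}.
Local Notation mu := (@lebesgue_measure R).

Lemma Rintegral_supp (h : R -> R) (L : R) :
  (forall t, L < `|t| -> h t = 0) ->
  \int[mu]_(t in setT) h t = \int[mu]_(t in `[- L, L]) h t.
Proof.
move=> hs; rewrite [RHS]Rintegral_mkcond; congr Rintegral; apply/funext => t.
rewrite patchE; case: ifPn => //; rewrite notin_setE /= in_itv /= => /negP.
rewrite -ler_norml -ltNge => Lt; exact: hs.
Qed.

Lemma integrable_segment (h : R -> R) (a b : R) :
  continuous h -> mu.-integrable `[a, b] (EFin \o h).
Proof.
move=> ch; apply: continuous_compact_integrable; first exact: segment_compact.
exact: continuous_subspaceT.
Qed.

Lemma Rintegral_segment_cst (a b M : R) : a <= b ->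
  \int[mu]_(t in `[a, b]) M = M * (b - a).
Proof.
move=> ab; rewrite Rintegral_cst//; congr (_ * _).
rewrite /= lebesgue_measure_itv /= lte_fin.
move: ab; rewrite le_eqVlt => /predU1P[->|->//].
by rewrite ltxx /= subrr.
Qed.

Lemma Rintegral_segment_FTC (F f : R -> R) (a b : R) : a <= b ->
  continuous f -> (forall t : R, is_derive t 1 F (f t)) ->
  \int[mu]_(t in `[a, b]) f t = F b - F a.
Proof.
move=> + cf dF; rewrite le_eqVlt => /predU1P[->|ab].
  by rewrite set_itv1 Rintegral_set1 subrr.
have cF : continuous F.
  move=> t; apply: differentiable_continuous; apply/derivable1_diffP.
  by have := dF t; case.
rewrite /Rintegral (@continuous_FTC2 _ f F) //.
- exact: continuous_subspaceT.
- split => [x _||]; first by have := dF x; case.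
  + exact: cvg_at_right_filter (cF a).
  + exact: cvg_at_left_filter (cF b).
- by move=> x _; rewrite derive1E; have [_ ->] := dF x.
Qed.

Lemma Rintegral_supp_deriv (F f : R -> R) (L : R) : 0 <= L ->
  continuous f -> (forall t : R, is_derive t 1 F (f t)) ->
  (forall t, L < `|t| -> F t = 0) -> (forall t, L < `|t| -> f t = 0) ->
  \int[mu]_(t in setT) f t = 0.
Proof.
move=> L0 cf dF F0 f0.
(* [F] is known to vanish only where |t| > L, so the endpoints are moved out to L + 1. *)
have L1 : L < L + 1 by rewrite ltrDl.
rewrite (@Rintegral_supp _ (L + 1)); last first.
  by move=> t Lt; apply: f0; rewrite (lt_trans L1).
have L10 : 0 <= L + 1 by rewrite addr_ge0.
rewrite (@Rintegral_segment_FTC F) //; last lra.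
by rewrite !F0 ?subr0// ?normrN ger0_norm.
Qed.

End Integral1.

Section IntegralRn.
Context {R : realType}.
Local Notation mu := (@lebesgue_measure R).

Definition cs n (L : R) (f : 'rV[R]_n -> R) := continuous f /\ csupp L f.

Lemma normr_row_mx m (t : R) (y : 'rV[R]_m) :
  `|row_mx (t%:M : 'rV_1) y| = Num.max `|t| `|y|.
Proof.
have tx : `|t| <= Num.max `|t| `|y| by rewrite le_max lexx.
have M0 := le_trans (normr_ge0 t) tx.
apply/eqP; rewrite eq_le; apply/andP; split.
  apply/normrV_le => // i; rewrite -(splitK i); case: (fintype.split i) => j /=.
    by rewrite row_mxEl mxE ord1 eqxx mulr1n.
  rewrite row_mxEr le_max; apply/orP; right.
  exact: (iffLR (normrV_le y (normr_ge0 y)) (lexx _)).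
have H := iffLR (normrV_le (row_mx (t%:M : 'rV_1) y) (normr_ge0 _)) (lexx _).
rewrite ge_max; apply/andP; split.
  by have := H (lshift m 0); rewrite row_mxEl mxE eqxx mulr1n.
by apply/normrV_le => // i; have := H (rshift 1 i); rewrite row_mxEr.
Qed.

Lemma continuous_row_mx m :
  continuous (fun z : R * 'rV[R]_m => row_mx (z.1%:M : 'rV_1) z.2).
Proof.
apply: continuous_rV => i j; rewrite -(splitK j); case: (fintype.split j) => k /=.
  have -> : (fun z : R * 'rV[R]_m => row_mx (z.1%:M : 'rV_1) z.2 i (lshift m k))
    = fst by apply/funext => z; rewrite row_mxEl mxE !ord1 eqxx mulr1n.
  by move=> z; exact: cvg_fst.
have -> : (fun z : R * 'rV[R]_m => row_mx (z.1%:M : 'rV_1) z.2 i (rshift 1 k))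
  = (fun M : 'rV[R]_m => M i k) \o snd by apply/funext => z; rewrite row_mxEr.
move=> z; apply: continuous_comp; [exact: cvg_snd|exact: coord_continuous].
Qed.

Lemma jc_row_mx m (f : 'rV[R]_(1 + m) -> R) : continuous f ->
  jc (fun (t : R) (y : 'rV[R]_m) => f (row_mx t%:M y)).
Proof.
move=> cf z.
apply: (@continuous_comp _ _ _
  (fun z : R * 'rV[R]_m => row_mx (z.1%:M : 'rV_1) z.2) f); last exact: cf.
exact: continuous_row_mx.
Qed.

Lemma csD n L (f g : 'rV[R]_n -> R) :
  cs L f -> cs L g -> cs L (fun x => f x + g x).
Proof.
move=> [cf f0] [cg g0]; split; first exact: contD.
by move=> x Lx; rewrite f0// g0// addr0.
Qed.

Lemma csZ n L (k : R) (f : 'rV[R]_n -> R) : cs L f -> cs L (fun x => k * f x).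
Proof.
move=> [cf f0]; split; first exact: contZ.
by move=> x Lx; rewrite f0// mulr0.
Qed.

Lemma csM n L (f g : 'rV[R]_n -> R) : cs L f -> continuous g ->
  cs L (fun x => f x * g x).
Proof.
move=> [cf f0] cg; split; first exact: contM.
by move=> x Lx; rewrite f0// mul0r.
Qed.

Lemma csW n L L' (f : 'rV[R]_n -> R) : L <= L' -> cs L f -> cs L' f.
Proof. by move=> LL [cf f0]; split => // x Lx; apply: f0; exact: le_lt_trans Lx. Qed.

(* Established together by induction on the dimension: continuity of the inner
   integral, which each step needs, follows from these four properties. *)
Definition integral_spec n := [/\
  forall L (f g : 'rV[R]_n -> R), cs L f -> cs L g ->
    integralRn (fun x => f x + g x) = integralRn f + integralRn g,
  forall L k (f : 'rV[R]_n -> R), cs L f ->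
    integralRn (fun x => k * f x) = k * integralRn f,
  forall L (f : 'rV[R]_n -> R), cs L f -> (forall x, 0 <= f x) ->
    0 <= integralRn f &
  forall L M (f : 'rV[R]_n -> R), 0 <= L -> cs L f -> (forall x, `|f x| <= M) ->
    `|integralRn f| <= M * (2 * L) ^+ n].

(** A difference of integrals is the integral of the difference, which [jc_unif] makes uniformly
    small on the common support. *)
Lemma integral_spec_continuous n (T : topologicalType) L
    (g : T -> 'rV[R]_n -> R) : integral_spec n -> 0 <= L ->
  jc g -> (forall t, csupp L (g t)) -> continuous (fun t => integralRn (g t)).
Proof.
move=> [ID IZ _ IB] L0 cg gs t.
have csg s : cs L (g s) by split => //; exact: jc_slice.
apply/cvgrPdist_le => e e0.
(* The + 1 keeps K positive when L = 0. *)
set K := (2 * L) ^+ n + 1.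
have K0 : 0 < K by rewrite ltr_wpDl// exprn_ge0 ?mulr_ge0.
have eK : 0 < e / K by rewrite divr_gt0.
have := @jc_unif _ _ _ g L t _ cg eK.
apply: filter_app; near=> s => H.
have -> : integralRn (g t) - integralRn (g s) =
    integralRn (fun x => g t x + (-1) * g s x).
  by rewrite (ID L)// ?(IZ L) ?mulN1r//; exact: csZ.
apply: le_trans (IB L (e / K) _ L0 _ _) _.
- by apply: csD => //; exact: csZ.
- move=> x; rewrite mulN1r distrC; have [xL|xL] := leP `|x| L; first exact: H.
  by rewrite !gs// subrr normr0 ltW.
- rewrite mulrAC ler_pdivrMr// ler_pM2l// /K lerDl//.
Unshelve. all: by end_near. Qed.

Lemma integral_spec0 : integral_spec 0.
Proof.
split => /=.
- by [].
- by [].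
- by move=> L f ? f0; exact: f0.
- by move=> L M f ? ? fM; rewrite expr0 mulr1; exact: fM.
Qed.

Lemma csupp_slice m L (f : 'rV[R]_(1 + m) -> R) t : csupp L f ->
  csupp L (fun y : 'rV[R]_m => f (row_mx t%:M y)).
Proof. by move=> fs y Ly; apply: fs; rewrite normr_row_mx lt_max Ly orbT. Qed.

Lemma cs_slice m L (f : 'rV[R]_(1 + m) -> R) t : cs L f ->
  cs L (fun y : 'rV[R]_m => f (row_mx t%:M y)).
Proof.
move=> [cf fs]; split; last exact: csupp_slice.
exact: jc_slice (jc_row_mx cf).
Qed.

Lemma csupp_slice0 m L (f : 'rV[R]_(1 + m) -> R) t : csupp L f -> L < `|t| ->
  (fun y : 'rV[R]_m => f (row_mx t%:M y)) = (fun=> 0).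
Proof.
by move=> fs Lt; apply/funext => y; apply: fs; rewrite normr_row_mx lt_max Lt.
Qed.

Lemma integral_spec_zero m : integral_spec m ->
  integralRn (fun _ : 'rV[R]_m => 0) = 0 :> R.
Proof.
move=> [_ IZ _ _]; rewrite -[RHS](mul0r (integralRn (fun _ : 'rV[R]_m => 0))).
rewrite -(IZ 0); last by split => //; exact: contC.
by congr integralRn; apply/funext => x; rewrite mul0r.
Qed.

Lemma integral_specS m : integral_spec m -> integral_spec m.+1.
Proof.
move=> S; have [ID IZ IP IB] := S.
have cI L (f : 'rV[R]_(1 + m) -> R) : 0 <= L -> cs L f ->
    continuous (fun t : R => integralRn (fun y : 'rV[R]_m => f (row_mx t%:M y))).
  move=> L0 [cf fs]; apply: (integral_spec_continuous S L0); first exact: jc_row_mx.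
  by move=> t; exact: csupp_slice.
have sI L (f : 'rV[R]_(1 + m) -> R) : cs L f -> forall t : R, L < `|t| ->
    integralRn (fun y : 'rV[R]_m => f (row_mx t%:M y)) = 0.
  by move=> [_ fs] t Lt; rewrite (csupp_slice0 fs Lt) integral_spec_zero.
(* Linearity is claimed for radii of any sign, but [cI] needs a nonnegative one. *)
pose pL (L : R) := Num.max L 0.
have pL0 L : 0 <= pL L by rewrite le_max lexx orbT.
have pLL L : L <= pL L by rewrite le_max lexx.
split.
- move=> L f g /(csW (pLL L)) csf /(csW (pLL L)) csg /=.
  under eq_Rintegral => t _ do rewrite (ID _ _ _ (cs_slice t csf) (cs_slice t csg)).
  rewrite (@Rintegral_supp _ _ (pL L)); last first.
    by move=> t Lt; rewrite (sI _ _ csf)// (sI _ _ csg)// addr0.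
  rewrite (@Rintegral_supp _ (fun t => integralRn (fun y : 'rV[R]_m => f _)) (pL L)); last exact: sI csf.
  rewrite (@Rintegral_supp _ (fun t => integralRn (fun y : 'rV[R]_m => g _)) (pL L)); last exact: sI csg.
  by rewrite RintegralD//; apply: integrable_segment; apply: (cI (pL L)).
- move=> L k f /(csW (pLL L)) csf /=.
  under eq_Rintegral => t _ do rewrite (IZ _ _ _ (cs_slice t csf)).
  rewrite (@Rintegral_supp _ _ (pL L)); last first.
    by move=> t Lt; rewrite (sI _ _ csf)// mulr0.
  rewrite (@Rintegral_supp _ (fun t => integralRn (fun y : 'rV[R]_m => f _)) (pL L)); last exact: sI csf.
  by rewrite RintegralZl//; apply: integrable_segment; apply: (cI (pL L)).
- move=> L f csf f0 /=; apply: Rintegral_ge0 => t _; apply: (IP L) => //.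
  exact: cs_slice.
- move=> L M f L0 csf fM /=.
  rewrite (@Rintegral_supp _ (fun t => integralRn (fun y : 'rV[R]_m => f _)) L); last exact: sI csf.
  have ci := cI _ _ L0 csf.
  apply: le_trans (le_normr_Rintegral _ (integrable_segment _ _ ci)) _ => //.
  apply: (@le_trans _ _ (\int[mu]_(t in `[- L, L]) (M * (2 * L) ^+ m))).
    apply: le_Rintegral => //.
    + by apply: integrable_segment => t; apply: cvg_norm; exact: ci.
    + by apply: integrable_segment; exact: contC.
    + by move=> t _; apply: (IB L) => //; exact: cs_slice.
  rewrite Rintegral_segment_cst; last lra.
  have -> : L - - L = 2 * L by ring.
  by rewrite exprSr mulrA.
Qed.

Lemma integralRnP n : integral_spec n.
Proof. by elim: n => [|n]; [exact: integral_spec0|exact: integral_specS]. Qed.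

End IntegralRn.

(** * Differentiation under the integral and integration by parts *)

Section DerivIntegral.
Context {R : realType}.
Local Notation mu := (@lebesgue_measure R).

Lemma is_derive_uniq (V : normedModType R) (f : V -> R) x v d1 d2 :
  is_derive x v f d1 -> is_derive x v f d2 -> d1 = d2.
Proof. by case=> _ <- [_ <-]. Qed.

Lemma is_derive_continuous (f : R -> R) (x d : R) :
  is_derive x 1 f d -> {for x, continuous f}.
Proof. by case=> + _ => /derivable1_diffP; exact: differentiable_continuous. Qed.

Lemma mvt_bound (f d : R -> R) (a b M : R) :
  (forall s, `|s - a| <= `|b - a| -> is_derive s 1 f (d s)) ->
  (forall s, `|s - a| <= `|b - a| -> `|d s| <= M) ->
  `|f b - f a| <= M * `|b - a|.
Proof.
move=> df dM.
have [ab|ba|->] := ltgtP a b; last by rewrite !subrr !normr0 mulr0.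
- have seg s : s \in `[a, b] -> `|s - a| <= `|b - a|.
    rewrite in_itv /= => /andP[sa sb].
    by rewrite !ger0_norm ?subr_ge0// ?lerD2r// ltW.
  have [|//|c] := @MVT _ f d a b ab.
  + by move=> s sab; apply/df/seg; exact: subset_itv_oo_cc.
  + apply/continuous_in_subspaceT => s /set_mem sab.
    exact: (is_derive_continuous (df _ (seg _ sab))).
  + move=> /subset_itv_oo_cc cab ->; rewrite normrM ler_wpM2r//; exact/dM/seg.
- have seg s : s \in `[b, a] -> `|s - a| <= `|b - a|.
    rewrite in_itv /= => /andP[sa sb].
    by rewrite ![`|_ - a|]distrC !ger0_norm ?subr_ge0// ?lerD2l ?lerN2// ltW.
  have [|//|c] := @MVT _ f d b a ba.
  + by move=> s sab; apply/df/seg; exact: subset_itv_oo_cc.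
  + apply/continuous_in_subspaceT => s /set_mem sab.
    exact: (is_derive_continuous (df _ (seg _ sab))).
  + move=> /subset_itv_oo_cc cab E; rewrite distrC E distrC normrM ler_wpM2r//; exact/dM/seg.
Qed.

(** The set where L < |y| is open, so [f] coincides with 0 near x. *)
Lemma csupp_partial n L (f : 'rV[R]_n -> R) x v d :
  csupp L f -> L < `|x| -> is_derive x v f d -> d = 0.
Proof.
move=> fs Lx dfx; apply: (is_derive_uniq dfx).
have d0 : is_derive x v (fun=> 0) 0 := is_derive_cst (0 : R) x v.
apply: (near_eq_is_derive _ d0).
have : \forall y \near x, L < `|y|.
  have /cvgrPdist_lt/(_ (`|x| - L)) := @norm_continuous _ _ x.
  rewrite subr_gt0 => /(_ Lx); apply: filter_app; near=> y.
  by move=> /ltr_normlW; rewrite ltrD2l ltrN2.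
by apply: filter_app; near=> y => Ly; rewrite fs.
Unshelve. all: by end_near. Qed.

Section Linear.
Variable n : nat.
Implicit Types (L M k : R) (f g : 'rV[R]_n -> R).

Lemma integralRnD L f g : cs L f -> cs L g ->
  integralRn (fun x => f x + g x) = integralRn f + integralRn g.
Proof. by have [H _ _ _] := @integralRnP R n; exact: H. Qed.

Lemma integralRnZ L k f : cs L f ->
  integralRn (fun x => k * f x) = k * integralRn f.
Proof. by have [_ H _ _] := @integralRnP R n; exact: H. Qed.

Lemma integralRn_ge0 L f : cs L f -> (forall x, 0 <= f x) -> 0 <= integralRn f.
Proof. by have [_ _ H _] := @integralRnP R n; exact: H. Qed.

Lemma integralRn_bound L M f : 0 <= L -> cs L f -> (forall x, `|f x| <= M) ->
  `|integralRn f| <= M * (2 * L) ^+ n.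
Proof. by have [_ _ _ H] := @integralRnP R n; exact: H. Qed.

Lemma integralRnN L f : cs L f -> integralRn (fun x => - f x) = - integralRn f.
Proof.
move=> csf; rewrite -mulN1r -(integralRnZ _ csf).
by congr integralRn; apply/funext => x; rewrite mulN1r.
Qed.

Lemma csN L f : cs L f -> cs L (fun x => - f x).
Proof. by case=> cf fs; split; [exact: contN|move=> x /fs ->; rewrite oppr0]. Qed.

Lemma csB L f g : cs L f -> cs L g -> cs L (fun x => f x - g x).
Proof. by move=> csf csg; apply: csD => //; exact: csN. Qed.

Lemma integralRnB L f g : cs L f -> cs L g ->
  integralRn (fun x => f x - g x) = integralRn f - integralRn g.
Proof.
by move=> csf csg; rewrite (integralRnD csf (csN csg)) (integralRnN csg).
Qed.

Lemma le_integralRn L f g : cs L f -> cs L g -> (forall x, f x <= g x) ->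
  integralRn f <= integralRn g.
Proof.
move=> csf csg fg; rewrite -subr_ge0 -(integralRnB csg csf).
by apply: (@integralRn_ge0 L); [exact: csB|move=> x; rewrite subr_ge0].
Qed.

Lemma cs0 L : cs L (fun _ : 'rV[R]_n => 0).
Proof. by split => //; exact: contC. Qed.

Lemma integralRn0 : integralRn (fun _ : 'rV[R]_n => 0) = 0 :> R.
Proof. exact/integral_spec_zero/integralRnP. Qed.

Lemma cs_sum (I : Type) (r : seq I) L (F : I -> 'rV[R]_n -> R) :
  (forall i, cs L (F i)) -> cs L (fun x => \sum_(i <- r) F i x).
Proof.
move=> csF; split; first by apply: cont_sum => i; case: (csF i).
by move=> x Lx; apply: big1 => i _; case: (csF i) => _ ->.
Qed.

Lemma integralRn_sum (I : Type) (r : seq I) L (F : I -> 'rV[R]_n -> R) :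
  (forall i, cs L (F i)) ->
  integralRn (fun x => \sum_(i <- r) F i x) = \sum_(i <- r) integralRn (F i).
Proof.
move=> csF; elim: r => [|i r IH].
  rewrite big_nil -[RHS]integralRn0; congr integralRn.
  by apply/funext => x; rewrite big_nil.
rewrite big_cons -IH -(integralRnD (csF i) (cs_sum r csF)).
by congr integralRn; apply/funext => x; rewrite big_cons.
Qed.

Lemma continuous_integralRn (T : topologicalType) L (g : T -> 'rV[R]_n -> R) :
  0 <= L -> jc g -> (forall t, csupp L (g t)) ->
  continuous (fun t => integralRn (g t)).
Proof. exact/integral_spec_continuous/integralRnP. Qed.

(** Takes the place of dominated convergence: [gt] is uniformly close to [gt t0] on the ball, so the
    mean value inequality bounds the remainder at all x at once. *)
Lemma is_derive_integralRn L (g gt : R -> 'rV[R]_n -> R) (t0 : R) :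
  0 <= L -> (forall t, cs L (g t)) -> jc gt ->
  (\forall t \near t0, forall x, is_derive (t : R) 1 (g ^~ x) (gt t x)) ->
  is_derive t0 1 (fun t => integralRn (g t)) (integralRn (gt t0)).
Proof.
move=> L0 csg cgt dg; apply/is_derive_epsP => e e0.
set K := (2 * L) ^+ n + 1.
have K0 : 0 < K by rewrite ltr_wpDl// exprn_ge0 ?mulr_ge0.
have eK : 0 < e / K by rewrite divr_gt0.
have csgt : cs L (gt t0).
  split=> [|x Lx]; first exact: jc_slice.
  apply: (is_derive_uniq (nbhs_singleton dg x)).
  have -> : g ^~ x = fun=> 0 by apply/funext => t; case: (csg t) => _ ->.
  exact: (is_derive_cst (0 : R) t0 1).
have := @jc_unif _ _ _ gt L t0 _ cgt eK.
move=> /(filterI dg) /nbhs_ballP[d d0 Hd].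
near=> h.
have hd : `|h| < d by near: h; exact: near0_normr_lt.
rewrite -[h *: (1:R)]/(h * 1) mulr1.
have -> : integralRn (g (h + t0)) - integralRn (g t0) - h * integralRn (gt t0)
  = integralRn (fun x => g (h + t0) x - g t0 x - h * gt t0 x).
  rewrite (@integralRnB L) ?(@integralRnB L) ?(@integralRnZ L)//.
  - exact: csB.
  - exact: csZ.
have csd : cs L (fun x => g (h + t0) x - g t0 x - h * gt t0 x).
  by apply: csB; [exact: csB|exact: csZ].
apply: le_trans (@integralRn_bound L (e / K * `|h|) _ L0 csd _) _.
- move=> x; have [xL|xL] := leP `|x| L; last first.
    have [_ ->//] := csd; rewrite normr0 mulr_ge0// ltW//.
  have bs s : `|s - t0| <= `|h| -> ball t0 d s.
    by rewrite /ball /= distrC => /le_lt_trans; apply.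
  (* After subtraction of the linear part, the remainder is an increment of a function with small
     derivative. *)
  have := @mvt_bound (fun s => g s x - s * gt t0 x) (fun s => gt s x - gt t0 x)
    t0 (h + t0) (e / K) _ _.
  rewrite addrK.
  have -> : g (h + t0) x - (h + t0) * gt t0 x - (g t0 x - t0 * gt t0 x) =
    g (h + t0) x - g t0 x - h * gt t0 x by ring.
  apply.
  + move=> s sh; have [/(_ x) dgs _] := Hd _ (bs s sh).
    apply: derB => //; have := derM (is_derive_id s 1) (derC s 1 (gt t0 x)).
    by rewrite /= mul1r mulr0 addr0.
  + by move=> s sh; have [_ /(_ x xL)] := Hd _ (bs s sh).
- rewrite mulrAC ler_wpM2r// mulrAC ler_pdivrMr// ler_pM2l// lerDl//.
Unshelve. all: by end_near. Qed.

End Linear.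

(** Induction on the dimension. A derivative in the first coordinate leaves the inner integral and
    is then integrated to zero in t; a derivative in another coordinate already integrates to zero
    in each slice. *)
Lemma integralRn_partial n L (i : 'I_n) (f fi : 'rV[R]_n -> R) :
  0 <= L -> cs L f -> continuous fi ->
  (forall x, is_derive x (delta_mx 0 i) f (fi x)) -> integralRn fi = 0.
Proof.
elim: n => [[]//|m IH] in i f fi *.
move=> L0 csf cfi df.
have fis : csupp L fi by move=> x Lx; apply: (csupp_partial csf.2 Lx (df x)).
rewrite -(splitK (i : 'I_(1 + m))) in df *.
case: (fintype.split _) df => k /= df.
  pose F (t : R) := integralRn (fun y : 'rV[R]_m => (f : 'rV_(1 + m) -> R) (row_mx t%:M y)).
  pose F' (t : R) := integralRn (fun y : 'rV[R]_m => (fi : 'rV_(1 + m) -> R) (row_mx t%:M y)).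
  have fs0 (g : 'rV[R]_(1 + m) -> R) t : csupp L g -> L < `|t| ->
      integralRn (fun y : 'rV[R]_m => g (row_mx t%:M y)) = 0.
    by move=> gs Lt; rewrite (csupp_slice0 gs Lt) integralRn0.
  apply: (@Rintegral_supp_deriv _ F F' L) => //.
  - apply: (@continuous_integralRn _ _ L) => //; first exact: jc_row_mx.
    by move=> t; exact: csupp_slice.
  - move=> t; apply: (@is_derive_integralRn _ L _ (fun t y => (fi : 'rV_(1 + m) -> R) (row_mx t%:M y))) => //.
    + by move=> s; exact: cs_slice.
    + exact: jc_row_mx.
    + near=> s => y.
      have E h : (row_mx (h%:M : 'rV_1) y : 'rV[R]_(1 + m)) =
          row_mx 0 y + h *: delta_mx 0 (lshift m k).
        apply/rowP => j; rewrite !mxE; case: (fintype.splitP j) => l jl.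
          by rewrite !mxE !ord1 !eqxx /= mulr1n add0r
            (_ : j == _) ?mulr1//; apply/eqP/val_inj; rewrite /= jl !ord1.
        by rewrite (_ : j == _ = false) ?mulr0 ?addr0//; apply/eqP => /(congr1 val)/=; rewrite jl ord1.
      have /is_derive_line := df (row_mx 0 y + s *: delta_mx 0 (lshift m k)).
      by rewrite -E; under eq_fun do rewrite -E.
  - by move=> t; apply: fs0; exact: csf.2.
  - by move=> t; exact: fs0.
rewrite /= (_ : (fun t : R => _) = fun=> 0).
  by rewrite Rintegral_cst// mul0r.
apply/funext => t.
apply: (@IH k (fun y => (f : 'rV_(1 + m) -> R) (row_mx t%:M y))) => //.
- exact: cs_slice.
- exact: jc_slice (jc_row_mx cfi).
- move=> y; apply/is_derive_line0.
  have /is_derive_line0 := df (row_mx t%:M y).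
  set F1 := fun _ => _; set F2 := fun _ => _.
  suff -> : F1 = F2 by [].
  apply/funext => h; rewrite /F1 /F2; congr f; apply/rowP => j; rewrite !mxE.
  case: (@fintype.splitP 1 m j) => l jl.
    by rewrite (_ : j == _ = false) ?mulr0 ?addr0//; apply/eqP => jE; move: jl; rewrite jE /= ord1.
  rewrite !mxE; congr (_ + _ * (_ && _)%:R); apply/eqP/eqP => [jE|<-].
    by apply/val_inj; move: jl; rewrite jE => /addnI.
  exact/val_inj.
Unshelve. all: by end_near. Qed.

End DerivIntegral.

(** * Blow-up for the differential inequality *)

Section Blowup.
Context {R : realType}.

Lemma ge0_derive_le (f d : R -> R) (a b : R) : a <= b ->
  (forall t : R, a <= t <= b -> {for t, continuous f}) ->
  (forall t : R, a < t < b -> is_derive t 1 f (d t)) ->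
  (forall t : R, a < t < b -> 0 <= d t) -> f a <= f b.
Proof.
move=> ab cf df d0.
(* The point returned may be an endpoint, where nothing is known of [d]; the extension by 0 is
   nonnegative there as well. *)
have [||t _] := @MVT_segment _ f (fun t => if a < t < b then d t else 0) a b ab.
- by move=> t; rewrite in_itv /= => tab; rewrite tab; exact: df.
- by apply/continuous_in_subspaceT => t /set_mem; rewrite /= in_itv /=; exact: cf.
- move=> E; rewrite -subr_ge0 E mulr_ge0 ?subr_ge0//.
  by case: ifP => // /d0.
Qed.

Lemma le0_derive_le (f d : R -> R) (a b : R) : a <= b ->
  (forall t : R, a <= t <= b -> {for t, continuous f}) ->
  (forall t : R, a < t < b -> is_derive t 1 f (d t)) ->
  (forall t : R, a < t < b -> d t <= 0) -> f b <= f a.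
Proof.
move=> ab cf df d0; rewrite -lerN2.
apply: (@ge0_derive_le (fun t => - f t) (fun t => - d t)) => //.
- by move=> t /cf ct; exact: (continuousN ct).
- by move=> t /df dt; exact: derN.
- by move=> t /d0; rewrite oppr_ge0.
Qed.

Lemma derV (V : normedModType R) (f : V -> R) (x v : V) (d : R) : f x != 0 ->
  is_derive x v f d -> is_derive x v (fun y => (f y)^-1) (- (d / f x ^+ 2)).
Proof.
move=> f0 df; have -> : - (d / f x ^+ 2) = (- (f x) ^- 2) * d by rewrite mulNr mulrC.
apply: der_comp df.
have := @is_deriveV R id (f x) 1 1 f0 (is_derive_id (f x) (1 : R)).
by rewrite -[_ *: 1]/(_ * 1) mulr1.
Qed.

Lemma der_powR (V : normedModType R) (f : V -> R) (x v : V) (d a : R) : 0 < f x ->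
  is_derive x v f d ->
  is_derive x v (fun y => f y `^ a) (a * f x `^ (a - 1) * d).
Proof. move=> f0; apply: (der_comp (h := fun y => y `^ a)); exact: is_derive1_powR. Qed.

Lemma half_scale_le (x y z : R) : 0 < y -> 2^-1 <= x -> x * y <= z -> 4^-1 * y <= z / 2.
Proof. by move=> y0 hx hz; have := ler_wpM2r (ltW y0) hx; lra. Qed.

Section Ode.
Variables (delta C0 a p tau m : R) (f f' A : R -> R).
Hypotheses (delta0 : 0 < delta) (C00 : 0 < C0) (a0 : 0 <= a) (a1 : a <= 1).
Hypotheses (p1 : 1 < p) (p2 : p <= 2) (m0 : 0 < m).
Let N (t : R) := C0 * (1 + t) `^ a.
Hypothesis cf : continuous f.
Hypothesis df : forall t : R, 0 < t < tau -> is_derive t 1 f (f' t).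
Hypothesis f'ge : forall t : R, 0 < t < tau ->
  delta * (N t * Num.min ((f t / N t) ^+ 2) ((f t / N t) `^ p)) <= f' t.
Hypothesis f0 : m <= f 0.
Hypothesis dA : forall t : R, 0 <= t -> is_derive t 1 A ((1 + t) `^ (- a)).

Let N_gt0 (t : R) : 0 <= t -> 0 < N t.
Proof. by move=> t0; rewrite mulr_gt0// powR_gt0// ltr_pwDl. Qed.

Let f'_ge0 (t : R) : 0 < t < tau -> 0 <= f' t.
Proof.
move=> tt; apply: le_trans (f'ge tt); move/andP: tt => [t0 _].
rewrite mulr_ge0 ?(ltW delta0)// mulr_ge0 ?(ltW (N_gt0 (ltW t0)))//.
by rewrite le_min sqr_ge0 powR_ge0.
Qed.

Let f_incr (s t : R) : 0 <= s -> s <= t -> t <= tau -> f s <= f t.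
Proof.
move=> s0 st tt; apply: (@ge0_derive_le f f') => // x /andP[sx xt].
- exact: cf.
- by apply: df; rewrite (le_lt_trans s0 sx) (lt_le_trans xt tt).
- by apply: f'_ge0; rewrite (le_lt_trans s0 sx) (lt_le_trans xt tt).
Qed.

Let f_gt0 (t : R) : 0 <= t <= tau -> 0 < f t.
Proof.
by move=> /andP[t0 tt]; rewrite (lt_le_trans m0)// (le_trans f0)// f_incr.
Qed.

(* Above the threshold N the growth is of order f^p on [t1, 2 t1 + 1], and this
   interval is long enough for f to become infinite. *)
Lemma below_threshold (t1 : R) : 0 <= t1 -> 1 + t1 > 4 / ((p - 1) * delta) ->
  2 * (1 + t1) <= 1 + tau -> f t1 < N t1.
Proof.
have [p1' p2' a0' a1'] := And4 p1 p2 a0 a1.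
move=> t10 t1l t1t; rewrite ltNge; apply/negP => Nf.
have p10 : 0 < p - 1 by rewrite subr_gt0.
have N10 := N_gt0 t10.
(* Thus 1 + t2 = 2 (1 + t1): on [t1, t2] the weight N at most doubles because a <= 1, and the
   interval has length 1 + t1. *)
have [t2 t2E] : exists t2 : R, t2 = 2 * t1 + 1 by exists (2 * t1 + 1).
have t12 : t1 <= t2 by lra.
have t2t : t2 <= tau by lra.
have N2 (t : R) : t1 <= t -> t <= t2 -> N t <= 2 * N t1.
  move=> t1t' tt2; rewrite /N mulrCA ler_pM2l//.
  apply: (@le_trans _ _ ((2 * (1 + t1)) `^ a)).
    by apply: ge0_ler_powR => //; rewrite ?nnegrE; lra.
  rewrite powRM//; last lra.
  rewrite ler_wpM2r ?powR_ge0// -[leRHS](powRr1 (a := 2))//.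
  by rewrite ler_powR//; lra.
have y1 (t : R) : t1 <= t -> t <= t2 -> N t1 <= f t.
  move=> h1 h2; apply: le_trans Nf _; apply: f_incr => //; lra.
(* A lower bound for the rate at which f^(1-p) decreases. The factor 1/4 is 1/2 from min(z^2, z^p)
   >= z^p / 2 for z >= 1/2, times 1/2 from N(t)^(1-p) >= (2 N(t1))^(1-p) >= N(t1)^(1-p) / 2. *)
pose c := (p - 1) * (delta / 4) * N t1 `^ (1 - p).
have N1p : 0 < N t1 `^ (1 - p) by rewrite powR_gt0.
have c0 : 0 < c by rewrite !mulr_gt0//; lra.
pose h (t : R) := f t `^ (1 - p) + c * t.
pose h' (t : R) := (1 - p) * f t `^ (1 - p - 1) * f' t + c * 1.
have dh (t : R) : t1 < t < t2 -> is_derive t 1 h (h' t).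
  move=> /andP[h1 h2]; apply: (derD _ (derZ c (is_derive_id t 1))).
  by apply: der_powR; [apply: f_gt0|apply: df]; lra.
have : h t2 <= h t1.
  apply: (@le0_derive_le h h') => //.
    move=> t /andP[h1 h2]; apply: continuousD; last first.
      by apply: continuousM; [exact: cst_continuous|move=> ?].
    apply: (@continuous_comp _ _ _ f (fun x => x `^ (1 - p))); first exact: cf.
    have ft : 0 < f t by apply: f_gt0; lra.
    exact: is_derive_continuous (is_derive1_powR _ ft).
  move=> t /andP[h1 h2].
  have tpos : 0 <= t by lra.
  have tt : 0 < t < tau by lra.
  have ft : 0 < f t by apply: f_gt0; lra.
  have Nt := N_gt0 tpos.
  have NtN := N2 t (ltW h1) (ltW h2).
  set z := f t / N t.
  have z0 : 0 < z by rewrite divr_gt0.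
  have zh : 2^-1 <= z.
    rewrite ler_pdivlMr// (le_trans _ (y1 t (ltW h1) (ltW h2)))//.
    by rewrite ler_pdivrMl//.
  have zm : z `^ p / 2 <= Num.min (z ^+ 2) (z `^ p).
    rewrite le_min; apply/andP; split; last first.
      by rewrite ler_pdivrMr// ler_peMr ?powR_ge0//; lra.
    have -> : z ^+ 2 = z `^ p * z `^ (2 - p).
      rewrite -powRD; last by rewrite (gt_eqF z0) implybT.
      by rewrite [p + _]addrC subrK powR_mulrn// ltW.
    rewrite ler_wpM2l ?powR_ge0//.
    apply: (@le_trans _ _ (2^-1 `^ (2 - p))); last first.
      apply: ge0_ler_powR; rewrite ?nnegrE//.
      lra.
      lra.
    by apply: ger1_powR; lra.
  rewrite /h' mulr1.
  have f'l : (delta / 4) * (f t `^ p * N t1 `^ (1 - p)) <= f' t.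
    apply: le_trans (f'ge tt).
    rewrite -mulrA ler_pM2l//.
    apply: (@le_trans _ _ (N t * (z `^ p / 2))); last by rewrite ler_pM2l.
    have -> : N t * (z `^ p / 2) = f t `^ p * (N t `^ (1 - p)) / 2.
      rewrite /z powRM ?invr_ge0 ?(ltW ft) ?(ltW Nt)// -[(N t)^-1]powR_inv1 ?(ltW Nt)//.
      rewrite -powRrM mulN1r powRD ?(gt_eqF Nt) ?implybT// powRr1 ?(ltW Nt)//.
      ring.
    rewrite -mulrA mulrCA ler_pM2l ?powR_gt0//.
    have : (2 * N t1) `^ (1 - p) <= N t `^ (1 - p).
      rewrite -[1 - p]opprB !powRN lef_pV2 ?posrE ?powR_gt0//; last by rewrite mulr_gt0.
      by apply: ge0_ler_powR; rewrite ?nnegrE; lra.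
    rewrite powRM ?(ltW N10)//.
    have : 2^-1 <= 2 `^ (1 - p).
      rewrite -powR_inv1// ler_powR//; lra.
    exact: half_scale_le N1p.
  have -> : (1 - p) * f t `^ (1 - p - 1) * f' t = - ((p - 1) * (f t `^ (- p) * f' t)).
    have -> : 1 - p - 1 = - p by ring.
    by ring.
  rewrite addrC subr_le0 /c -mulrA ler_pM2l//.
  have fp : 0 < f t `^ (- p) by rewrite powR_gt0.
  have -> : N t1 `^ (1 - p) = f t `^ (- p) * (f t `^ p * N t1 `^ (1 - p)).
    by rewrite mulrA -powRD ?(gt_eqF ft) ?implybT// addNr powRr0 mul1r.
  by rewrite mulrCA ler_pM2l.
have h1 : h t1 <= N t1 `^ (1 - p) + c * t1.
  rewrite lerD2r -[1 - p]opprB !powRN lef_pV2 ?posrE ?powR_gt0//; last first.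
    by apply: f_gt0; lra.
  apply: ge0_ler_powR; rewrite ?nnegrE; lra.
have h2 : c * t2 < h t2.
  by rewrite ltrDr powR_gt0// f_gt0//; lra.
(* As f^(1-p) is still positive at t2, the total decrease c (1 + t1) stays below N(t1)^(1-p), which
   bounds 1 + t1 by 4 / ((p - 1) delta). *)
move=> h21; have : c * (1 + t1) < N t1 `^ (1 - p).
  by have := le_lt_trans h1; nra.
rewrite /c mulrAC gtr_pMl// ltNge ltW//.
move: t1l; rewrite ltr_pdivrMr ?mulr_gt0//; nra.
Qed.

(** Below N the quadratic branch of the minimum is the active one, so 1 / f + (delta / C0) A does
    not increase. Leaving the primitive [A] abstract treats the power and the logarithm together. *)
Lemma ode_bound (th ts : R) : 0 <= ts -> ts <= th ->
  1 + ts > 4 / ((p - 1) * delta) -> 2 * (1 + th) <= 1 + tau ->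
  A th - A ts <= C0 / (delta * m).
Proof.
have [p1' p2' a0' a1'] := And4 p1 p2 a0 a1.
move=> ts0 tsh tsl thl.
have below (t : R) : ts <= t -> t <= th -> f t < N t.
  by move=> h1 h2; apply: below_threshold; lra.
pose h (t : R) := (f t)^-1 + delta / C0 * A t.
pose h' (t : R) := - (f' t / f t ^+ 2) + delta / C0 * (1 + t) `^ (- a).
have fp (t : R) : ts <= t -> t <= th -> 0 < f t by move=> h1 h2; apply: f_gt0; lra.
have : h th <= h ts.
  apply: (@le0_derive_le h h') => //.
  - move=> t /andP[h1 h2]; apply: continuousD.
      by apply: continuousV; [rewrite gt_eqF// fp|exact: cf].
    apply: continuousM; first exact: cst_continuous.
    by apply: is_derive_continuous (dA _); lra.
  - move=> t /andP[h1 h2]; have t0 : 0 <= t by lra.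
    have tt : 0 < t < tau by lra.
    have f0' : f t != 0 by rewrite gt_eqF// fp// ltW.
    exact: (derD (derV f0' (df tt)) (derZ _ (dA t0))).
  move=> t /andP[h1 h2].
  have tpos : 0 <= t by lra.
  have tt : 0 < t < tau by lra.
  have ft : 0 < f t by apply: fp; lra.
  have Nt := N_gt0 tpos.
  have fN := below t (ltW h1) (ltW h2).
  have := f'ge tt.
  set z := f t / N t.
  have z0 : 0 < z by rewrite divr_gt0.
  have z1 : z < 1 by rewrite ltr_pdivrMr// mul1r.
  have -> : Num.min (z ^+ 2) (z `^ p) = z ^+ 2.
    by apply/min_idPl; rewrite -powR_mulrn ?(ltW z0)// ger_powR// z0 ltW.
  have -> : delta * (N t * z ^+ 2) = delta / C0 * (1 + t) `^ (- a) * f t ^+ 2.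
    rewrite powRN /z exprMn exprVn /N.
    have : (1 + t) `^ a != 0 by rewrite gt_eqF// powR_gt0//; lra.
    have Cn : C0 != 0 by rewrite gt_eqF.
    by move=> Hn; field; rewrite ?Hn ?Cn.
  move=> fl; rewrite /h' addrC subr_le0.
  by rewrite ler_pdivlMr// exprn_gt0.
have fs : (f ts)^-1 <= m^-1.
  by rewrite lef_pV2 ?posrE ?fp// (le_trans f0)// f_incr//; lra.
have fh : 0 < (f th)^-1 by rewrite invr_gt0 fp.
rewrite /h => H.
have : delta / C0 * (A th - A ts) <= m^-1 by lra.
rewrite -ler_pdivlMl ?divr_gt0//; congr (_ <= _).
by field; rewrite !gt_eqF.
Qed.

End Ode.
End Blowup.

(** * Coercivity of the pressure *)

Section Pressure.
Context {R : realType}.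

(** Young's inequality for the product t * 1 with the exponent g and its conjugate, multiplied by
    g. *)
Lemma bernoulli_powR (t g : R) : 0 <= t -> 1 < g -> 1 + g * (t - 1) <= t `^ g.
Proof.
move=> t0 g1; have g0 : 0 < g by lra.
have E : g^-1 + ((1 - g^-1)^-1)^-1 = 1 by rewrite invrK; ring.
have gi : g^-1 < 1 by rewrite invf_lt1.
have := @conjugate_powR R t 1 g (1 - g^-1)^-1 t0 ler01 g0 _ E.
rewrite invr_gt0 subr_gt0 => /(_ gi).
rewrite powR1 invrK mulr1 mul1r.
rewrite -(ler_pM2l g0) mulrDr mulrCA mulfV ?gt_eqF// mulr1.
by rewrite mulrBr mulfV ?gt_eqF// => H; lra.
Qed.

(** Bernoulli's inequality at x / y, scaled by y^g. *)
Lemma powR_tangent (x y g : R) : 0 <= x -> 0 < y -> 1 < g ->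
  y `^ g + g * y `^ (g - 1) * (x - y) <= x `^ g.
Proof.
move=> x0 y0 g1.
have := @bernoulli_powR (x / y) g _ g1; rewrite divr_ge0 ?(ltW y0)// => /(_ isT).
have yg : 0 < y `^ g by rewrite powR_gt0.
rewrite -(ler_pM2l yg) -powRM ?divr_ge0 ?(ltW y0)//.
rewrite [y * (x / y)]mulrCA divff ?gt_eqF// mulr1.
suff -> : y `^ g * (1 + g * (x / y - 1)) = y `^ g + g * y `^ (g - 1) * (x - y) by [].
rewrite -(mulr_powRB1 (ltW y0) (p := g)); last lra.
by field; rewrite gt_eqF.
Qed.

(** Bernoulli's inequality for t^q with the exponent 1 / q. *)
Lemma bernoulli_powR_concave (t q : R) : 0 <= t -> 0 < q -> q < 1 ->
  t `^ q <= 1 + q * (t - 1).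
Proof.
move=> t0 q0 q1.
have q1i : 1 < q^-1 by rewrite invf_gt1.
have := @bernoulli_powR (t `^ q) q^-1 (powR_ge0 _ _) q1i.
rewrite -powRrM mulfV ?gt_eqF// powRr1//.
rewrite -(ler_pM2l q0) mulrDr mulrA mulfV ?gt_eqF// mul1r => H; lra.
Qed.

(** The left side is of order x^2 near 0 and x^(1+q) at infinity, where q <= g - 1 keeps it below
    x^g. The difference of the sides increases: the derivative of (1 + t)^(q-1) contributes with a
    good sign, and the rest is g ((1 + t)^(g-1) - 1 - q t (1 + t)^(q-1)), nonnegative by the concave
    Bernoulli inequality at 1 / (1 + t). *)
Lemma powR_convex_excess (g q x : R) : 1 < g -> 0 < q -> q < 1 -> q <= g - 1 ->
  0 <= x ->
  g * q / 2 * x ^+ 2 * (1 + x) `^ (q - 1) <= (1 + x) `^ g - 1 - g * x.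
Proof.
move=> g1 q0 q1 qg x0.
pose h (t : R) := (1 + t) `^ g - 1 - g * t - g * q / 2 * (t ^+ 2 * (1 + t) `^ (q - 1)).
pose h' (t : R) := g * (1 + t) `^ (g - 1) * 1 - 0 - g * 1 - g * q / 2 *
  ((1 * t + t * 1) * (1 + t) `^ (q - 1) + t ^+ 2 * ((q - 1) * (1 + t) `^ (q - 1 - 1) * 1)).
suff : h 0 <= h x.
  rewrite /h addr0 powR1 mulr0 expr0n /= mul0r mulr0 !subr0 subrr subr_ge0.
  by rewrite mulrA.
have d1 (t : R) : is_derive t 1 (fun t : R => 1 + t) 1.
  by have := derD (derC t 1 (1 : R)) (is_derive_id t (1 : R)); rewrite add0r.
have dh (t : R) : 0 <= t -> is_derive t 1 h (h' t).
  move=> t0; have t1 : 0 < 1 + t by lra.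
  have dt := is_derive_id t (1 : R).
  exact: (derB (derB (derB (der_powR g t1 (d1 t)) (derC _ _ 1)) (derZ g dt))
    (derZ (g * q / 2) (derM (derM dt dt) (der_powR (q - 1) t1 (d1 t))))).
apply: (@ge0_derive_le _ h h') => //.
- by move=> t /andP[t0 _]; exact: is_derive_continuous (dh t t0).
- by move=> t /andP[t0 _]; exact/dh/ltW.
move=> t /andP[t0 _].
rewrite /h' !mulr1 subr0 !mul1r.
have t1 : 1 <= 1 + t by lra.
have t10 : 0 < 1 + t by lra.
have e1 : (1 + t) `^ q <= (1 + t) `^ (g - 1) by rewrite ler_powR.
have e2 : 1 + q * (t * (1 + t) `^ (q - 1)) <= (1 + t) `^ q.
  have ti : 0 <= (1 + t)^-1 by rewrite invr_ge0 ltW.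
  have := bernoulli_powR_concave ti q0 q1.
  have tq : 0 < (1 + t) `^ q by rewrite powR_gt0.
  rewrite -(ler_pM2l tq) -powRM ?(ltW t10)// mulfV ?gt_eqF// powR1.
  have -> : (1 + t) `^ q * (1 + q * ((1 + t)^-1 - 1)) =
     (1 + t) `^ q - q * (t * (1 + t) `^ (q - 1)).
    rewrite -(mulr_powRB1 (ltW t10) q0).
    by field; rewrite gt_eqF.
  by lra.
have e3 : (q - 1) * (1 + t) `^ (q - 1 - 1) <= 0.
  by rewrite mulr_le0_ge0 ?powR_ge0//; lra.
have e4 : t ^+ 2 * ((q - 1) * (1 + t) `^ (q - 1 - 1)) <= 0.
  by rewrite mulr_ge0_le0 ?sqr_ge0.
have gq : 0 < g * q by rewrite mulr_gt0//; lra.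
have e5 : g * q / 2 * (t ^+ 2 * ((q - 1) * (1 + t) `^ (q - 1 - 1))) <= 0.
  by rewrite mulr_ge0_le0//; lra.
have e6 : g * (1 + q * (t * (1 + t) `^ (q - 1))) <= g * (1 + t) `^ (g - 1).
  rewrite ler_pM2l; first exact: le_trans e1; lra.
rewrite mulrDr.
have -> : g * q / 2 * ((t + t) * (1 + t) `^ (q - 1)) =
  g * (1 + q * (t * (1 + t) `^ (q - 1))) - g by field.
lra.
Qed.

(** With m = 1 + x / rb and z = y + k x, the right side dominates z^2 / m ([S2]), and also (x /
    rb)^2 m^(q-1), which is of order m^(1+q) for large m. For m <= 2 the first bound is quadratic in
    z; for m > 2 the better of the two is at least of order z^p, uniformly in m. *)
Lemma pressure_coercive (A g rb K : R) : 0 < A -> 1 < g -> 0 < rb -> 0 < K ->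
  exists d p : R, [/\ 0 < d, 1 < p, p <= 2 & forall k x y : R,
    0 <= k <= K -> 0 <= x -> 0 <= y ->
    d * Num.min ((y + k * x) ^+ 2) ((y + k * x) `^ p) <=
    y ^+ 2 / (rb + x) +
      (A * (rb + x) `^ g - A * rb `^ g - A * g * rb `^ (g - 1) * x)].
Proof.
move=> A0 g1 r0 K0.
have [q [q0 q1 qg]] : exists q : R, [/\ 0 < q, q < 1 & q <= g - 1].
  exists (Num.min (g - 1) (1 / 2)); split.
  - by rewrite lt_min; apply/andP; split; lra.
  - by rewrite gt_min; apply/orP; right; lra.
  - by rewrite ge_min lexx.
pose d2 := A * rb `^ g * (g * q / 2).
have d20 : 0 < d2.
  by rewrite /d2 !mulr_gt0 ?powR_gt0 ?invr_gt0//; lra.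
pose k1 := K * rb; have k10 : 0 < k1 by rewrite mulr_gt0.
pose d3 := Num.min (1 / (2 * rb)) (d2 / (2 * k1 ^+ 2)).
have d30 : 0 < d3.
  rewrite /d3 lt_min; apply/andP; split; apply: divr_gt0 => //.
    exact: mulr_gt0.
  by apply: mulr_gt0 => //; exact: exprn_gt0.
pose d := Num.min (d3 / 2) (d2 / 4).
have d0 : 0 < d by rewrite /d lt_min; apply/andP; split; apply: divr_gt0.
have q20 : 0 < 2 + q by lra.
(* The exponent that balances both bounds at m = z^al: z^2 / m equals z^(2-al) there, and so does
   m^(1+q). *)
pose al := 2 / (2 + q).
have al0 : 0 < al by rewrite /al divr_gt0.
have alE : al * (1 + q) = 2 - al by rewrite /al; field; rewrite gt_eqF.
have al1 : al < 1 by rewrite /al ltr_pdivrMr//; lra.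
exists d, (2 - al); split => //; [lra|lra|].
move=> k x y /andP[k0 kK] x0 y0.
set z := y + k * x.
have z0 : 0 <= z by rewrite addr_ge0// mulr_ge0.
pose x' := x / rb; have x'0 : 0 <= x' by rewrite divr_ge0// ltW.
have xE : x = rb * x' by rewrite /x' mulrCA divff ?mulr1// gt_eqF.
pose m := 1 + x'; have m1 : 1 <= m by rewrite /m; lra.
have m0 : 0 < m by lra.
have rxE : rb + x = rb * m by rewrite xE /m; ring.
set S := (X in _ <= X).
have S1 : y ^+ 2 / (rb * m) + d2 * (x' ^+ 2 * m `^ (q - 1)) <= S.
  rewrite /S rxE lerD2l powRM ?(ltW r0) ?(ltW m0)//.
  have -> : A * (rb `^ g * m `^ g) - A * rb `^ g - A * g * rb `^ (g - 1) * x =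
    A * rb `^ g * (m `^ g - 1 - g * x').
    rewrite -(mulr_powRB1 (ltW r0) (p := g)); last lra.
    by rewrite xE; ring.
  have Ar : 0 <= A * rb `^ g by rewrite mulr_ge0 ?powR_ge0// ltW.
  have := ler_wpM2l Ar (@powR_convex_excess g q x' g1 q0 q1 qg x'0).
  by rewrite -/m; apply: le_trans; rewrite le_eqVlt /d2; apply/orP; left; apply/eqP; ring.
have S2 : d3 * (z ^+ 2 / m) <= S.
  apply: le_trans S1.
  have zle : z ^+ 2 <= 2 * y ^+ 2 + 2 * k1 ^+ 2 * x' ^+ 2.
    have : z <= y + k1 * x'.
      rewrite /z lerD2l xE mulrA ler_wpM2r// /k1 ler_wpM2r// ltW//.
    have : 0 <= k1 * x' by rewrite mulr_ge0// ltW.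
    move: (k1 * x') (exprMn 2 k1 x') => w wE w0 zw.
    rewrite -mulrA -wE.
    have : z ^+ 2 <= (y + w) ^+ 2 by rewrite ler_sqr ?nnegrE// addr_ge0.
    have := sqr_ge0 (y - w); lra.
  have mq : m^-1 <= m `^ (q - 1).
    by rewrite -powR_inv1 ?(ltW m0)// ler_powR//; lra.
  have mi0 : 0 < m^-1 by rewrite invr_gt0.
  apply: (@le_trans _ _ (d3 * ((2 * y ^+ 2 + 2 * k1 ^+ 2 * x' ^+ 2) / m))).
    by rewrite ler_pM2l// ler_pM2r.
  rewrite mulrDl mulrDr; apply: lerD.
    have -> : y ^+ 2 / (rb * m) = 1 / (2 * rb) * (2 * y ^+ 2 / m).
      by field; rewrite !gt_eqF.
    rewrite ler_wpM2r ?ge_min ?lexx//.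
    by rewrite mulr_ge0 ?(ltW mi0)// mulr_ge0// sqr_ge0.
  apply: (@le_trans _ _ (d2 / (2 * k1 ^+ 2) * (2 * k1 ^+ 2 * x' ^+ 2 / m))).
    rewrite ler_wpM2r ?ge_min ?lexx ?orbT//.
    by rewrite mulr_ge0 ?(ltW mi0)// mulr_ge0 ?sqr_ge0// mulr_ge0// sqr_ge0.
  have -> : d2 / (2 * k1 ^+ 2) * (2 * k1 ^+ 2 * x' ^+ 2 / m) = d2 * (x' ^+ 2 / m).
    by field; rewrite !gt_eqF.
  by rewrite ler_pM2l// ler_wpM2l// sqr_ge0.
have dd3 : d <= d3 / 2 by rewrite /d ge_min lexx.
have dd2 : d <= d2 / 4 by rewrite /d ge_min lexx orbT.
have [m2|m2] := leP m 2.
  apply: le_trans S2.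
  apply: (@le_trans _ _ (d * z ^+ 2)).
    by rewrite ler_pM2l// ge_min lexx.
  have := sqr_ge0 z; move: (z ^+ 2) => w w0.
  rewrite [d3 * _]mulrA ler_pdivlMr//.
  apply: (@le_trans _ _ (d3 / 2 * w * 2)); last lra.
  have dw : 0 <= d * w by rewrite mulr_ge0// ltW.
  by apply: ler_pM => //; [lra|rewrite ler_wpM2r].
have [z00|zp] := eqVneq z 0.
  have -> : Num.min (z ^+ 2) (z `^ (2 - al)) = 0.
    by rewrite z00 expr0n powR0 ?minxx// gt_eqF//; lra.
  rewrite mulr0; apply: le_trans S2.
  by rewrite mulr_ge0 ?(ltW d30)// divr_ge0 ?sqr_ge0 ?(ltW m0).
have {}zp : 0 < z by rewrite lt_neqAle eq_sym zp.
apply: (@le_trans _ _ (d * z `^ (2 - al))).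
  by rewrite ler_pM2l// ge_min lexx orbT.
have [mz|mz] := leP m (z `^ al).
  apply: le_trans S2.
  apply: (@le_trans _ _ (d3 * z `^ (2 - al))).
    by rewrite ler_wpM2r ?powR_ge0//; lra.
  rewrite ler_pM2l// powRB ?(gt_eqF zp) ?implybT// powR_mulrn//.
  by rewrite ler_wpM2l ?sqr_ge0// lef_pV2 ?posrE// powR_gt0.
apply: le_trans S1.
apply: (@le_trans _ _ (d2 * (x' ^+ 2 * m `^ (q - 1)))); last first.
  by rewrite lerDr divr_ge0 ?sqr_ge0// mulr_ge0 ?(ltW r0) ?(ltW m0).
apply: (@le_trans _ _ (d2 / 4 * m `^ (1 + q))).
  apply: ler_pM => //; rewrite ?(ltW d0) ?powR_ge0//.
  rewrite -alE powRrM; apply: ge0_ler_powR; rewrite ?nnegrE ?powR_ge0 ?(ltW mz) ?(ltW m0)//; lra.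
rewrite -mulrA ler_pM2l//.
(* What remains is m^2 / 4 <= x'^2, which holds because m > 2 gives x' = m - 1 >= m / 2. *)
have -> : m `^ (1 + q) = m ^+ 2 * m `^ (q - 1).
  rewrite -powR_mulrn ?(ltW m0)// -powRD ?(gt_eqF m0) ?implybT//.
  by congr (_ `^ _); lra.
rewrite mulrA ler_wpM2r ?powR_ge0//.
have : 2 * x' >= m by rewrite /m in m2 *; lra.
move: (m) m0 => w w0 ?; nra.
Qed.

End Pressure.

(** * Powers of the positive part *)

Section PositivePower.
Context {R : realType}.

(* [s `^ a] is junk for [s < 0]; this extension by 0 is C^1 when [1 < a]. *)
Definition pp (a s : R) : R := Num.max s 0 `^ a.

Lemma ppE a s : 0 <= s -> pp a s = s `^ a.
Proof. by move=> s0; rewrite /pp max_l. Qed.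

Lemma pp_le0 a s : 0 < a -> s <= 0 -> pp a s = 0.
Proof. by move=> a0 s0; rewrite /pp max_r// powR0// gt_eqF. Qed.

Lemma pp_ge0 a s : 0 <= pp a s.
Proof. exact: powR_ge0. Qed.

Lemma pp_gt0 a s : 0 < s -> 0 < pp a s.
Proof. by move=> s0; rewrite ppE ?powR_gt0// ltW. Qed.

Lemma pp_near_pos a (s : R) : 0 < s -> \forall t \near s, t `^ a = pp a t.
Proof.
move=> s0; have : \forall t \near s, 0 < t by exact: lt_nbhsr.
by apply: filter_app; near=> t => t0; rewrite ppE// ltW.
Unshelve. all: by end_near. Qed.

Lemma pp_near_neg a (s : R) : 0 < a -> s < 0 -> \forall t \near s, 0 = pp a t.
Proof.
move=> a0 s0; have : \forall t \near s, t < 0 by exact: lt_nbhsl.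
by apply: filter_app; near=> t => t0; rewrite pp_le0// ltW.
Unshelve. all: by end_near. Qed.

Lemma near0_pp_le (a e : R) : 0 < a -> 0 < e ->
  \forall h \near (0 : R), pp a h <= e.
Proof.
move=> a0 e0; have d0 : 0 < e `^ a^-1 by rewrite powR_gt0.
have := near0_normr_lt d0; apply: filter_app; near=> h => hd.
have [h0|h0] := leP h 0; first by rewrite pp_le0// ltW.
rewrite ppE ?(ltW h0)//.
have -> : e = (e `^ a^-1) `^ a by rewrite -powRrM mulVf ?gt_eqF// powRr1// ltW.
apply: ge0_ler_powR; rewrite ?nnegrE ?powR_ge0 ?(ltW a0) ?(ltW h0)//.
by rewrite ltW// (le_lt_trans (ler_norm _)).
Unshelve. all: by end_near. Qed.

(** Only s = 0 is delicate: there h^a = h^(a-1) h, and h^(a-1) tends to 0. *)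
Lemma der_pp (a s : R) : 1 < a -> is_derive s 1 (pp a) (a * pp (a - 1) s).
Proof.
move=> a1; have a0 : 0 < a by lra.
have a10 : 0 < a - 1 by lra.
have [s0|s0|->] := ltgtP s 0.
- rewrite (pp_le0 a10 (ltW s0)) mulr0.
  exact: near_eq_is_derive (pp_near_neg a0 s0) (derC s 1 0).
- rewrite ppE ?(ltW s0)//.
  exact: near_eq_is_derive (pp_near_pos a s0) (is_derive1_powR _ s0).
rewrite (pp_le0 a10 (lexx 0)) mulr0; apply/is_derive_epsP => e e0.
have := near0_pp_le a10 e0; apply: filter_app; near=> h => he.
rewrite -[h *: (1 : R)]/(h * 1) mulr1 addr0 (pp_le0 a0 (lexx 0)) subr0 mulr0 subr0.
rewrite ger0_norm ?pp_ge0//.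
have [h0|h0] := leP h 0; first by rewrite pp_le0// mulr_ge0// ltW.
rewrite (ger0_norm (ltW h0)) ppE ?(ltW h0)// -(mulr_powRB1 (ltW h0) a0) mulrC.
by rewrite ler_pM2r// -ppE// ltW.
Unshelve. all: by end_near. Qed.

Lemma cont_pp (a : R) : 0 < a -> continuous (pp a).
Proof.
move=> a0 s.
have [s0|s0|->] := ltgtP s 0.
- exact: is_derive_continuous (near_eq_is_derive (pp_near_neg a0 s0) (derC s 1 0)).
- exact: is_derive_continuous (near_eq_is_derive (pp_near_pos a s0) (is_derive1_powR _ s0)).
apply/cvgrPdist_le => e e0; have := near0_pp_le a0 e0; apply: filter_app.
near=> h => he; rewrite (pp_le0 a0 (lexx 0)) sub0r normrN ger0_norm ?pp_ge0//.
Unshelve. all: by end_near. Qed.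

End PositivePower.

(** * Real induction, strict positivity of integrals, clamped time *)

Section Misc.
Context {R : realType}.

(** At the infimum of the failure times P holds by the first hypothesis, and the second keeps
    failures away from it on the right. *)
Lemma real_induction (T : R) (P : R -> Prop) :
  (forall t : R, 0 <= t -> t < T -> (forall s : R, 0 <= s -> s < t -> P s) -> P t) ->
  (forall t : R, 0 <= t -> t < T -> P t ->
    exists2 d : R, 0 < d & forall s, t < s -> s < t + d -> s < T -> P s) ->
  forall t : R, 0 <= t -> t < T -> P t.
Proof.
move=> Pc Po t0 t00 t0T; apply/not_notP => NP.
pose S := [set s : R | [/\ 0 <= s, s < T & ~ P s]].
have S0 : S !=set0 by exists t0.
have lS : lbound S 0 by move=> s [].
have hS : has_lbound S by exists 0.
pose m := inf S.
have m0 : 0 <= m by exact: lb_le_inf.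
have mt0 : m <= t0 by apply: ge_inf.
have mT : m < T by exact: le_lt_trans t0T.
have Pm s : 0 <= s -> s < m -> P s.
  move=> s0 sm; apply/not_notP => NPs.
  have : m <= s by apply: ge_inf => //; split => //; exact: lt_trans mT.
  by rewrite leNgt sm.
have {}Pmm : P m by exact: Pc.
have [d d0 Pd] := Po m m0 mT Pmm.
have : m + d <= m.
  apply: lb_le_inf => // s [s0 sT NPs].
  have ms : m <= s by apply: ge_inf.
  rewrite leNgt; apply/negP => smd; apply: NPs.
  move: ms; rewrite le_eqVlt => /predU1P[<-//|ms]; exact: Pd.
by rewrite gerDl leNgt d0.
Qed.

Local Notation mu := (@lebesgue_measure R).

Lemma Rintegral_supp_gt0 (h : R -> R) (L t0 : R) : 0 <= L -> continuous h ->
  (forall t, L < `|t| -> h t = 0) -> (forall t, 0 <= h t) -> 0 < h t0 ->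
  0 < \int[mu]_(t in setT) h t.
Proof.
move=> L0 ch hs h0 ht0.
have e0 : 0 < h t0 / 2 by rewrite divr_gt0.
have /cvgrPdist_lt/(_ _ e0)/nbhs_ballP[d /= d0 Hd] := ch t0.
have d20 : 0 < d / 2 by rewrite divr_gt0.
have hh t : t \in `[t0 - d / 2, t0 + d / 2] -> h t0 / 2 <= h t.
  rewrite in_itv /= => /andP[h1 h2].
  have /Hd /ltr_normlW : ball t0 d t.
    by rewrite /ball /= ltr_norml; apply/andP; split; lra.
  by move=> /= H; lra.
pose L' := Num.max L (`|t0| + d).
have LL' : L <= L' by rewrite le_max lexx.
rewrite (@Rintegral_supp _ h L'); last first.
  by move=> t Lt; apply: hs; exact: le_lt_trans Lt.
have ab : t0 - d / 2 <= t0 + d / 2 by lra.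
apply: (@lt_le_trans _ _ (\int[mu]_(t in `[t0 - d / 2, t0 + d / 2]) (h t0 / 2))).
  by rewrite Rintegral_segment_cst// mulr_gt0//; lra.
apply: (@le_trans _ _ (\int[mu]_(t in `[t0 - d / 2, t0 + d / 2]) h t)).
  apply: le_Rintegral => //; apply: integrable_segment => //; exact: contC.
rewrite /Rintegral fine_le//.
- exact: (integrable_fin_num _ (integrable_segment _ _ ch)).
- exact: (integrable_fin_num _ (integrable_segment _ _ ch)).
apply: ge0_subset_integral => //.
- exact: (measurable_int mu (integrable_segment _ _ ch)).
- by move=> t _; rewrite lee_fin.
- have : `|t0| + d <= L' by rewrite le_max lexx orbT.
  move: (ler_norm t0) (lerNnormlW (lexx `|t0|)) => n1 n2 n3.
  by apply: subset_itv; rewrite bnd_simp; lra.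
Qed.

Lemma integralRn_gt0 n (L : R) (f : 'rV[R]_n -> R) x : 0 <= L -> cs L f ->
  (forall y, 0 <= f y) -> 0 < f x -> 0 < integralRn f.
Proof.
elim: n => [|m IH] in f x *; first by move=> _ _ _; rewrite /= (thinmx0 x).
move=> L0 csf f0 fx /=.
have xE : x = row_mx ((lsubmx (x : 'rV_(1 + m)) 0 0)%:M) (rsubmx (x : 'rV_(1 + m))).
  by rewrite -mx11_scalar hsubmxK.
apply: (@Rintegral_supp_gt0 _ L (lsubmx (x : 'rV_(1 + m)) 0 0)) => //.
- apply: (@continuous_integralRn _ _ _ L) => //; first exact/jc_row_mx/csf.1.
  by move=> t; exact/csupp_slice/csf.2.
- by move=> t Lt; rewrite (csupp_slice0 csf.2 Lt) integralRn0.
- move=> t; apply: (@integralRn_ge0 _ _ L); first exact: cs_slice.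
  by move=> y; exact: f0.
- apply: (IH _ (rsubmx (x : 'rV_(1 + m)))) => //; first exact: cs_slice.
  by rewrite -xE.
Qed.

Definition clamp (tau t : R) : R := Num.min (Num.max t 0) tau.

Lemma clamp_id tau t : 0 <= t -> t <= tau -> clamp tau t = t.
Proof. by move=> t0 tt; rewrite /clamp max_l// min_l. Qed.

Lemma clamp_itv tau t : 0 <= tau -> 0 <= clamp tau t <= tau.
Proof.
by move=> t0; rewrite /clamp le_min t0 le_max lexx orbT ge_min lexx orbT.
Qed.

Lemma cont_clamp tau : continuous (clamp tau).
Proof.
move=> t; have c1 : {for t, continuous (fun s : R => Num.max s 0)}.
  by apply: (@continuous_max R R id (fun=> 0) t); [move=> A|exact: cst_continuous].
apply: (@continuous_min R R (fun s : R => Num.max s 0) (fun=> tau) t) => //.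
exact: cst_continuous.
Qed.

(** Clamped points always lie in the strip since tau < T, so continuity within the strip becomes
    plain joint continuity. *)
Lemma jc_clamp n (T : \bar R) (tau : R) (f : R -> 'rV[R]_n -> R) :
  0 <= tau -> (tau%:E < T)%E -> strip_continuous T f ->
  jc (fun t => f (clamp tau t)).
Proof.
move=> tau0 tauT cf z0.
set D := [set z : R * 'rV[R]_n | 0 <= z.1 /\ (z.1%:E < T)%E] in cf.
pose k (z : R * 'rV[R]_n) := (clamp tau z.1, z.2).
have kD z : D (k z).
  have /andP[h1 h2] := clamp_itv z.1 tau0; split => //=.
  by apply: le_lt_trans tauT; rewrite lee_fin.
have ck : continuous k.
  apply: (@continuous_pair _ _ _ (clamp tau \o fst) snd) => z.
    by apply: continuous_comp; [exact: cvg_fst|exact: cont_clamp].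
  exact: cvg_snd.
apply/cvgrPdist_le => e e0.
have := cf (k z0).
move=> /cvgrPdist_le/(_ e e0).
rewrite /nbhs/= /nbhs_subspace (mem_set (kD z0)) => /(ck z0).
by rewrite /nbhs /=; apply: filter_app; near=> z => /(_ (kD z)).
Unshelve. all: by end_near. Qed.

End Misc.

(** * Euler flows *)

Section Flow.
Context {R : realType}.
Variable n : nat.
Implicit Types (f : R -> 'rV[R]_n -> R) (T : \bar R).

(* Meant for solutions whose time argument has been clamped to [0, tau]: all the
   fields are then continuous on R x R^n. *)
Record flow (A gamma mu tau : R) (rho rhot : R -> 'rV[R]_n -> R)
    (rhox : 'I_n -> R -> 'rV[R]_n -> R) (u ut : 'I_n -> R -> 'rV[R]_n -> R)
    (ux : 'I_n -> 'I_n -> R -> 'rV[R]_n -> R) : Prop := Flow {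
  flow_c : jc rho; flow_ct : jc rhot; flow_cx : forall i, jc (rhox i);
  flow_cu : forall j, jc (u j); flow_cut : forall j, jc (ut j);
  flow_cux : forall j i, jc (ux j i);
  flow_ge0 : forall t x, 0 <= rho t x;
  flow_dt : forall (t : R) x, 0 < t -> t < tau ->
    is_derive t 1 (rho ^~ x) (rhot t x);
  flow_dut : forall (t : R) x j, 0 < t -> t < tau ->
    is_derive t 1 (u j ^~ x) (ut j t x);
  flow_dx : forall t x i, is_derive x (delta_mx 0 i) (rho t) (rhox i t x);
  flow_dux : forall t x j i, is_derive x (delta_mx 0 i) (u j t) (ux j i t x);
  flow_mass : forall (t : R) x, 0 < t -> t < tau ->
    rhot t x + \sum_i (rhox i t x * u i t x + rho t x * ux i i t x) = 0;
  flow_momentum : forall (t : R) x j, 0 < t -> t < tau ->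
    (rhot t x * u j t x + rho t x * ut j t x)
    + \sum_i ((rhox i t x * u j t x + rho t x * ux j i t x) * u i t x
              + rho t x * u j t x * ux i i t x)
    + A * (gamma * pp (gamma - 1) (rho t x) * rhox j t x)
    + mu * (rho t x * u j t x) / (1 + t) = 0 }.

(** At t > 0 the constraint 0 <= t + h holds for all small h, so the one-sided limit is an ordinary
    one. *)
Lemma strip_derive f ft T (t : R) x : 0 < t -> (t%:E < T)%E ->
  (h^-1 * (f (t + h) x - f t x))
     @[h --> within [set h : R | 0 <= t + h] 0^'] --> (ft : R) ->
  is_derive t 1 (f ^~ x) ft.
Proof.
move=> t0 tT H; apply/is_derive_epsP => e e0.
have /cvgrPdist_le/(_ e e0) := H.
rewrite /= !near_withinE !near_simpl.
have := near0_normr_lt t0.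
apply: filter_app2; near=> h => ht He.
rewrite -[h *: (1 : R)]/(h * 1) mulr1.
have [->|h0] := eqVneq h 0.
  by rewrite add0r subrr mul0r subr0 !normr0 mulr0.
have th : 0 <= t + h by move: ht; rewrite ltr_norml => /andP[h1 h2]; lra.
have {}He := He h0 th.
rewrite [h + t]addrC.
have -> : f (t + h) x - f t x - h * ft = - (h * (ft - h^-1 * (f (t + h) x - f t x))).
  by field.
by rewrite normrN normrM mulrC ler_wpM2r.
Unshelve. all: by end_near. Qed.

Lemma near_clamp (tau t : R) : 0 < t -> t < tau -> \forall s \near t, s = clamp tau s.
Proof.
move=> t0 tt; have [H1 H2] := (lt_nbhsr t0, lt_nbhsl tt).
move: H2; apply: filter_app; move: H1; apply: filter_app; near=> s => h1 h2.
by rewrite clamp_id// ltW.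
Unshelve. all: by end_near. Qed.

Lemma clamp_derive f (tau t d : R) x : 0 < t -> t < tau ->
  is_derive t 1 (f ^~ x) d -> is_derive t 1 (fun s => f (clamp tau s) x) d.
Proof.
move=> t0 tt; apply: near_eq_is_derive; have := near_clamp t0 tt.
by apply: filter_app; near=> s => <-.
Unshelve. all: by end_near. Qed.

(** The clamp is locally the identity on ]0, tau[, so time derivatives and equations carry over
    there; space derivatives carry over at all times. *)
Lemma flow_of_euler (A gamma mu rb eps : R) rho0 u0 T
    (rho : R -> 'rV[R]_n -> R) (u : R -> 'rV[R]_n -> 'rV[R]_n) (tau : R) :
  1 < gamma ->
  euler_solution A gamma mu rb eps rho0 u0 T rho u ->
  0 < tau -> (tau%:E < T)%E ->
  exists rhot rhox ut ux, flow A gamma mu tau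
    (fun t => rho (clamp tau t)) rhot rhox
    (fun j t x => u (clamp tau t) x 0 j) ut ux.
Proof.
move=> g1 [[[rt [rx [crho crt crx drho]]] /choice[ut Hu]] rho_ge0 mass mom init] tau0 tauT.
have {Hu}[ux Hu] := choice Hu.
have cl0 t : 0 <= clamp tau t by have /andP[] := clamp_itv t (ltW tau0).
have clT t : ((clamp tau t)%:E < T)%E.
  by have /andP[_ h] := clamp_itv t (ltW tau0); apply: le_lt_trans tauT; rewrite lee_fin.
have tT (t : R) : t < tau -> (t%:E < T)%E.
  by move=> tt; apply: lt_trans tauT; rewrite lte_fin.
have drt (t : R) x : 0 < t -> t < tau -> is_derive t 1 (rho ^~ x) (rt t x).
  move=> t0 tt; have [H _] := drho t x (ltW t0) (tT _ tt).
  exact: (strip_derive t0 (tT _ tt) H).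
have dut (t : R) x j : 0 < t -> t < tau ->
    is_derive t 1 (fun s => u s x 0 j) (ut j t x).
  move=> t0 tt; have [_ _ _ /(_ t x (ltW t0) (tT _ tt))[H _]] := Hu j.
  exact: (strip_derive (f := fun s x => u s x 0 j) t0 (tT _ tt) H).
have drx t x i : is_derive x (delta_mx 0 i) (rho (clamp tau t)) (rx i (clamp tau t) x).
  by have [_ ] := drho _ x (cl0 t) (clT t); apply.
have dux t x j i : is_derive x (delta_mx 0 i) (fun y => u (clamp tau t) y 0 j)
    (ux j i (clamp tau t) x).
  by have [_ _ _ /(_ _ x (cl0 t) (clT t))[_ ]] := Hu j; apply.
exists (fun t => rt (clamp tau t)), (fun i t => rx i (clamp tau t)),
  (fun j t => ut j (clamp tau t)), (fun j i t => ux j i (clamp tau t)).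
split => //.
- exact: jc_clamp (ltW tau0) tauT crho.
- exact: jc_clamp (ltW tau0) tauT crt.
- by move=> i; exact: jc_clamp (ltW tau0) tauT (crx i).
- move=> j; have [H _ _ _] := Hu j.
  exact: (jc_clamp (f := fun t x => u t x 0 j) (ltW tau0) tauT H).
- by move=> j; have [_ H _ _] := Hu j; exact: jc_clamp (ltW tau0) tauT H.
- by move=> j i; have [_ _ H _] := Hu j; exact: jc_clamp (ltW tau0) tauT (H i).
- by move=> t x; exact: rho_ge0.
- move=> t x t0 tt; rewrite clamp_id ?(ltW t0) ?(ltW tt)//.
  exact/clamp_derive/drt.
- move=> t x j t0 tt; rewrite [X in ut j X](@clamp_id _ tau) ?(ltW t0) ?(ltW tt)//.
  exact: (@clamp_derive (fun s x => u s x 0 j)) (dut _ _ _ t0 tt).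
- move=> t x t0 tt; have := mass t x t0 (tT _ tt).
  rewrite derive1E; have [_ ->] := drt t x t0 tt.
  rewrite clamp_id ?(ltW t0) ?(ltW tt)// => E; rewrite -[RHS]E; congr (_ + _).
  rewrite /divv; apply: eq_bigr => i _.
  rewrite /partial; under eq_fun do rewrite mxE.
  have := derM (drx t x i) (dux t x i i).
  by rewrite clamp_id ?(ltW t0) ?(ltW tt)// => -[_ ->].
- move=> t x j t0 tt; have := mom t x j t0 (tT _ tt).
  rewrite derive1E; have [_ ->] := derM (drt t x t0 tt) (dut t x j t0 tt).
  have := drx t x; have := dux t x.
  rewrite clamp_id ?(ltW t0) ?(ltW tt)// => dux' drx' E; rewrite -[RHS]E.
  congr (_ + _ + _ + _).
    rewrite /divv; apply: eq_bigr => i _.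
    rewrite /partial; under [in RHS]eq_fun do rewrite mxE.
    by have [_ ->] := derM (derM (drx' i) (dux' j i)) (dux' i i).
  rewrite /partial.
  (* Since rho >= 0 the pressure can be written with [pp], which is differentiable at vacuum too. *)
  have -> : (fun y => A * rho t y `^ gamma) = (fun y => A * pp gamma (rho t y)).
    by apply/funext => y; rewrite ppE// rho_ge0// ?(ltW t0)// tT.
  by have [_ ->] := derZ A (der_comp (der_pp _ g1) (drx' j)).
Unshelve. all: by end_near. Qed.

End Flow.

(** * Finite propagation speed *)

Section EntropyLocal.
Context {R : realType}.
Variables (A g rb : R).
Let Hb := A * g / (g - 1) * rb `^ (g - 1).

(** Internal energy A s^g / (g - 1) minus its tangent at [rb]. *)
Definition potential (s : R) :=
  A / (g - 1) * (pp g s - rb `^ g) - Hb * (s - rb).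

(** For s >= 0, the relative internal energy plus the excess pressure A s^g - A rb^g; equivalently,
    s times the excess of the enthalpy A g s^(g-1) / (g - 1) over its value at rest. *)
Definition potential_flux (s : R) := A * g / (g - 1) * pp g s - Hb * s.

(* To second order the flux is at most c times the energy, by AM-GM; the slack
   b - c absorbs the higher-order terms. *)
Lemma entropy_local (b c : R) : 0 < A -> 1 < g -> 0 < rb ->
  0 < c -> c ^+ 2 = A * g * rb `^ (g - 1) -> c < b ->
  exists2 k : R, 0 < k & forall s U : R, `|s - rb| <= k -> 0 <= U -> U <= k ->
    (1 / 2 * s * U ^+ 2 + `|potential_flux s|) * U
      <= b * (1 / 2 * s * U ^+ 2 + potential s) /\
    (0 < 1 / 2 * s * U ^+ 2 + potential s \/ s = rb /\ U = 0).
Proof.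
move=> A0 g1 r0 c0 c2 cb.
have g10 : 0 < g - 1 by lra.
have g0 : 0 < g by lra.
pose a := A * g / (g - 1); have a0 : 0 < a by rewrite /a divr_gt0// mulr_gt0.
pose K (s : R) := a * s `^ (g - 1).
pose h := A * g * rb `^ (g - 1 - 1).
have h0 : 0 < h by rewrite /h !mulr_gt0// powR_gt0.
have hc : h * rb = c ^+ 2.
  by rewrite c2 /h -mulrA [_ * rb]mulrC mulr_powRB1// ltW.
have dK : is_derive rb 1 K h.
  have -> : h = a * ((g - 1) * rb `^ (g - 1 - 1)).
    by rewrite /a /h; field; rewrite gt_eqF.
  exact: (derZ a (is_derive1_powR (g - 1) r0)).
(* Relative error allowed in linearising the enthalpy [K]. The slack b - c is spent in halves: 6 c
   th absorbs this error, and U <= k <= (b - c) / 2 the cubic term. *)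
pose th := Num.min (1 / 4) ((b - c) / (12 * c)).
have th0 : 0 < th.
  by rewrite lt_min; apply/andP; split; apply: divr_gt0; rewrite ?subr_gt0// mulr_gt0.
have th4 : th <= 1 / 4 by rewrite ge_min lexx.
have thb : 12 * c * th <= b - c.
  rewrite mulrC -ler_pdivlMr ?ge_min ?lexx ?orbT// mulr_gt0//.
have /is_derive_epsP/(_ (th * h)) := dK.
rewrite mulr_gt0// => /(_ isT)/nbhs_ballP[d /= d0 Hd].
have {}Hd (w : R) : `|w| < d -> `|K (w + rb) - K rb - w * h| <= th * h * `|w|.
  move=> wd; have := Hd w; rewrite /ball /= sub0r normrN => /(_ wd).
  by rewrite -[w *: (1 : R)]/(w * 1) mulr1.
pose k := Num.min (d / 2) (Num.min (th * rb) ((b - c) / 2)).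
have k0 : 0 < k by rewrite !lt_min !divr_gt0// ?mulr_gt0// ?divr_gt0// subr_gt0.
have kd : k <= d / 2 by rewrite ge_min lexx.
have kr : k <= th * rb by rewrite !ge_min lexx orbT.
have kb : k <= (b - c) / 2 by rewrite !ge_min lexx !orbT.
exists k => // s U sk U0 Uk.
set w := s - rb in sk.
have sE : s = w + rb by rewrite /w subrK.
have wd : `|w| < d by lra.
have wr : `|w| <= th * rb by lra.
have s0 : 0 < s.
  have : - w <= th * rb by apply: le_trans wr; rewrite -normrN ler_norm.
  have : th * rb <= 1 / 4 * rb by rewrite ler_pM2r.
  lra.
have srb : s <= (1 + th) * rb.
  by have : w <= th * rb := le_trans (ler_norm _) wr; lra.
have srb' : (1 - th) * rb <= s.
  have : - w <= th * rb by apply: le_trans wr; rewrite -normrN ler_norm.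
  lra.
have Bw : `|potential_flux s| <= c ^+ 2 * (1 + th) ^+ 2 * `|w|.
  have -> : potential_flux s = s * (K s - K rb).
    rewrite /potential_flux ppE ?(ltW s0)// -(mulr_powRB1 (ltW s0) g0) /K /Hb /a; ring.
  rewrite normrM (gtr0_norm s0).
  have KK : `|K s - K rb| <= (1 + th) * h * `|w|.
    have := Hd w wd; rewrite -sE => H.
    have -> : K s - K rb = (K s - K rb - w * h) + w * h by ring.
    apply: le_trans (ler_normD _ _) _; rewrite normrM (gtr0_norm h0).
    by lra.
  apply: (@le_trans _ _ ((1 + th) * rb * ((1 + th) * h * `|w|))).
    by apply: ler_pM => //; rewrite ltW.
  by rewrite -hc le_eqVlt; apply/orP; left; apply/eqP; ring.
have Sw : 1 / 2 * h * (1 - th) * w ^+ 2 <= potential s.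
  (* [D] vanishes at 0 and its derivative has the sign of v, because [K] is within th h |v| of its
     linearisation. *)
  pose D (v : R) := potential (v + rb) - 1 / 2 * h * (1 - th) * (v * v).
  pose D' (v : R) := A / (g - 1) * (g * pp (g - 1) (v + rb) * 1 - 0)
     - Hb * (1 - 0) - 1 / 2 * h * (1 - th) * (1 * v + v * 1).
  have dD (v : R) : is_derive v 1 D (D' v).
    have di := is_derive_id v (1 : R).
    have dv : is_derive v 1 (fun v : R => v + rb) 1.
      by have := derD di (derC v 1 rb); rewrite addr0.
    have d1 := der_comp (f := fun y : R => y + rb) (der_pp (v + rb) g1) dv.
    have d2 := derZ (A / (g - 1)) (derB d1 (derC v 1 (rb `^ g))).
    have d3 := derZ Hb (derB dv (derC v 1 rb)).
    have d4 := derZ (1 / 2 * h * (1 - th)) (derM di di).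
    exact: (derB (derB d2 d3) d4).
  have cD (v : R) : {for v, continuous D} by exact: is_derive_continuous (dD v).
  have D0 : D 0 = 0.
    rewrite /D /potential add0r ppE ?(ltW r0)//; ring.
  have D'E (v : R) : `|v| <= `|w| -> D' v = (K (v + rb) - K rb - v * h) + th * h * v.
    move=> vw; have vr : 0 < v + rb.
      have : - v <= th * rb.
        by apply: le_trans wr; apply: le_trans vw; rewrite -normrN ler_norm.
      have : th * rb <= 1 / 4 * rb by rewrite ler_pM2r.
      lra.
    by rewrite /D' ppE ?(ltW vr)// /K /Hb /a; field; rewrite gt_eqF.
  suff : 0 <= D w by rewrite /D -sE; lra.
  rewrite -D0; have [w0|w0] := leP 0 w.
    apply: (@ge0_derive_le _ D D') => // v /andP[v0 vw].
    have vw' : `|v| <= `|w| by rewrite !ger0_norm// ltW.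
    rewrite D'E//; have := Hd v (le_lt_trans vw' wd).
    rewrite (gtr0_norm v0) => /ler_normlP[]; lra.
  apply: (@le0_derive_le _ D D') => //; first exact: ltW.
  move=> v /andP[v0 vw].
  have vw' : `|v| <= `|w| by rewrite !ltr0_norm// lerN2 ltW.
  rewrite D'E//; have := Hd v (le_lt_trans vw' wd).
  rewrite (ltr0_norm vw) => /ler_normlP[]; lra.
have h1 : 0 < 1 / 2 * h * (1 - th).
  by apply: mulr_gt0; [apply: mulr_gt0 => //|]; lra.
have w20 := sqr_ge0 w; have U20 := sqr_ge0 U.
have S0 : 0 <= potential s by apply: le_trans Sw; rewrite mulr_ge0// ltW.
have sU0 : 0 <= 1 / 2 * s * U ^+ 2 by rewrite mulr_ge0// mulr_ge0// ?ltW.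
set e := 1 / 2 * s * U ^+ 2 + potential s.
have e0 : 0 <= e by rewrite addr_ge0.
split; last first.
  have [w00|wn] := eqVneq w 0.
    have [->|Un] := eqVneq U 0; first by right; split => //; lra.
    have Up : 0 < U by rewrite lt_neqAle eq_sym Un.
    by left; apply: ltr_wpDr => //; rewrite !mulr_gt0//.
  left; apply: ltr_wpDl => //; apply: lt_le_trans Sw.
  by rewrite mulr_gt0// lt_neqAle eq_sym sqrf_eq0 wn.
(* The AM-GM step: (rb U - c |w|)^2 >= 0 together with h rb = c^2. *)
have key : (1 - th) * (c * `|w| * U) <= e.
  apply: (@le_trans _ _ ((1 - th) * (1 / 2 * rb * U ^+ 2 + 1 / 2 * h * w ^+ 2))).
    rewrite ler_pM2l; last lra.
    have E : (rb * U - c * `|w|) ^+ 2 = 2 * rb * (1 / 2 * rb * U ^+ 2 + 1 / 2 * h * w ^+ 2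
       - c * `|w| * U).
      by rewrite sqrrB !exprMn -hc real_normK ?num_real//; field.
    have r2 : 0 < 2 * rb by rewrite mulr_gt0.
    by rewrite -subr_ge0 -(pmulr_rge0 _ r2) -E sqr_ge0.
  rewrite mulrDr; apply: lerD; last by apply: le_trans Sw; lra.
  rewrite [1 / 2 * s * _]mulrC [1 / 2 * s]mulrC -[1 / 2 * rb * _]mulrA.
  have : (1 - th) * rb * U ^+ 2 <= s * U ^+ 2 by rewrite ler_wpM2r.
  lra.
have BU : `|potential_flux s| * U <= c * (1 + 6 * th) * e.
  apply: (@le_trans _ _ (c ^+ 2 * (1 + th) ^+ 2 * `|w| * U)); first by rewrite ler_wpM2r.
  have tt : (1 + th) ^+ 2 <= (1 + 6 * th) * (1 - th) by nra.
  apply: (@le_trans _ _ (c * (1 + 6 * th) * ((1 - th) * (c * `|w| * U)))).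
    have -> : c ^+ 2 * (1 + th) ^+ 2 * `|w| * U = (1 + th) ^+ 2 * (c * (c * `|w| * U)) by ring.
    have -> : c * (1 + 6 * th) * ((1 - th) * (c * `|w| * U)) =
      (1 + 6 * th) * (1 - th) * (c * (c * `|w| * U)) by ring.
    by rewrite ler_wpM2r// !mulr_ge0// ltW.
  by rewrite ler_wpM2l// mulr_ge0//; lra.
have sUe : 1 / 2 * s * U ^+ 2 * U <= (b - c) / 2 * e.
  rewrite mulrC; apply: ler_pM => //; first exact: le_trans kb.
  by rewrite /e lerDl.
have ce : c * (6 * th) * e <= (b - c) / 2 * e by rewrite ler_wpM2r//; lra.
rewrite mulrDl; lra.
Qed.

End EntropyLocal.

(** * The energy identity *)

Section Propagation.
Context {R : realType}.
Variable n : nat.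

Lemma dot_CS (u y : 'I_n -> R) :
  `|\sum_i u i * y i| <=
    Num.sqrt (\sum_i u i ^+ 2) * Num.sqrt (\sum_i y i ^+ 2).
Proof.
set E := \sum_i u i ^+ 2; set F := \sum_i y i ^+ 2; set d := \sum_i u i * y i.
have E0 : 0 <= E by apply: sumr_ge0 => i _; exact: sqr_ge0.
have F0 : 0 <= F by apply: sumr_ge0 => i _; exact: sqr_ge0.
have q (s t : R) : 0 <= s ^+ 2 * E - 2 * (s * t) * d + t ^+ 2 * F.
  have -> : s ^+ 2 * E - 2 * (s * t) * d + t ^+ 2 * F =
      \sum_i (s * u i - t * y i) ^+ 2.
    rewrite /E /F /d !mulr_sumr -sumrB -big_split /=.
    by apply: eq_bigr => i _; ring.
  by apply: sumr_ge0 => i _; exact: sqr_ge0.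
have dEF : d ^+ 2 <= E * F.
  have [E00|En] := eqVneq E 0.
    have [->|dn] := eqVneq d 0; first by rewrite expr0n mulr_ge0.
    (* When E = 0 the form is affine in s, and this choice gives it the value -1. *)
    have := q ((F + 1) / (2 * d)) 1.
    have -> : ((F + 1) / (2 * d)) ^+ 2 * E - 2 * ((F + 1) / (2 * d) * 1) * d + 1 ^+ 2 * F = -1.
      by rewrite E00; field.
    by rewrite ler0N1.
  have Ep : 0 < E by rewrite lt_neqAle eq_sym En.
  have := q d E; rewrite -(pmulr_rge0 _ Ep).
  have -> : d ^+ 2 * E - 2 * (d * E) * d + E ^+ 2 * F = E * (E * F - d ^+ 2) by ring.
  by rewrite !pmulr_rge0// subr_ge0.
by rewrite -sqrtrM// -sqrtr_sqr ler_wsqrtr.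
Qed.

Variables (A g mu tau rb : R).
Variables (rho rhot : R -> 'rV[R]_n -> R) (rhox : 'I_n -> R -> 'rV[R]_n -> R).
Variables (u ut : 'I_n -> R -> 'rV[R]_n -> R).
Variable ux : 'I_n -> 'I_n -> R -> 'rV[R]_n -> R.
Hypothesis fl : flow A g mu tau rho rhot rhox u ut ux.
Hypotheses (A0 : 0 < A) (g1 : 1 < g) (rb0 : 0 < rb) (mu0 : 0 <= mu) (tau0 : 0 < tau).

Let Hb := A * g / (g - 1) * rb `^ (g - 1).
Let sq t x := \sum_j u j t x ^+ 2.

Definition rest t x := rho t x = rb /\ forall j, u j t x = 0.

(** Mechanical energy density relative to the rest state. *)
Definition entropy t x := 1 / 2 * rho t x * sq t x + potential A g rb (rho t x).

Definition entropy_dt t x :=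
  (1 / 2 * rhot t x) * sq t x + 1 / 2 * rho t x * \sum_j (2 * (u j t x * ut j t x))
  + (A / (g - 1) * (g * pp (g - 1) (rho t x) * rhot t x) - Hb * rhot t x).

Definition eflux (i : 'I_n) t x :=
  u i t x * (1 / 2 * rho t x * sq t x + potential_flux A g rb (rho t x)).

Definition eflux_dx (i : 'I_n) t x :=
  ux i i t x * (1 / 2 * rho t x * sq t x + potential_flux A g rb (rho t x)) +
  u i t x * ((1 / 2 * rhox i t x) * sq t x
     + 1 / 2 * rho t x * \sum_j (2 * (u j t x * ux j i t x))
     + (A * g / (g - 1) * (g * pp (g - 1) (rho t x) * rhox i t x) - Hb * rhox i t x)).

Let dersq (V : normedModType R) (x v : V) (f : V -> R) d :
  is_derive x v f d -> is_derive x v (fun y => f y ^+ 2) (2 * (f x * d)).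
Proof.
move=> df; have := derM df df; under eq_fun do rewrite -expr2.
by move=> H; apply: (is_derive_eq H); ring.
Qed.

Lemma is_derive_entropy (t : R) x : 0 < t -> t < tau ->
  is_derive t 1 (entropy ^~ x) (entropy_dt t x).
Proof.
move=> t0 tt; have dr := flow_dt fl x t0 tt.
have ds : is_derive t 1 (sq ^~ x) (\sum_j (2 * (u j t x * ut j t x))).
  by apply: der_sum => j; apply: dersq; exact: (flow_dut fl x j t0 tt).
have dp := derB (derZ (A / (g - 1)) (derB (der_comp (f := rho ^~ x) (der_pp _ g1) dr) (derC t 1 (rb `^ g))))
  (derZ Hb (derB dr (derC t 1 rb))).
have H := derD (derM (derZ (1 / 2) dr) ds) dp.
by apply: (is_derive_eq H); rewrite /entropy_dt !subr0.
Qed.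

Lemma is_derive_eflux i t x :
  is_derive x (delta_mx 0 i) (eflux i t) (eflux_dx i t x).
Proof.
have dr := flow_dx fl t x i.
have ds : is_derive x (delta_mx 0 i) (sq t) (\sum_j (2 * (u j t x * ux j i t x))).
  by apply: der_sum => j; apply: dersq; exact: (flow_dux fl t x j i).
have dp := derB (derZ (A * g / (g - 1)) (der_comp (f := rho t) (der_pp _ g1) dr)) (derZ Hb dr).
exact: (derM (flow_dux fl t x i i) (derD (derM (derZ (1 / 2) dr) ds) dp)).
Qed.

(** The momentum equation minus [u j] times the mass equation. The density is not divided out, so
    that vacuum remains allowed. *)
Lemma flow_momentum_nc (t : R) x j : 0 < t -> t < tau ->
  rho t x * ut j t x + rho t x * \sum_i ux j i t x * u i t x
  + A * g * pp (g - 1) (rho t x) * rhox j t x + mu / (1 + t) * (rho t x * u j t x) = 0.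
Proof.
move=> t0 tt; have M := flow_mass fl x t0 tt.
have := flow_momentum fl x j t0 tt.
have -> : \sum_i ((rhox i t x * u j t x + rho t x * ux j i t x) * u i t x
              + rho t x * u j t x * ux i i t x) =
   u j t x * (\sum_i (rhox i t x * u i t x + rho t x * ux i i t x)) +
   rho t x * \sum_i ux j i t x * u i t x.
  by rewrite !mulr_sumr -big_split /=; apply: eq_bigr => i _; ring.
move=> H; rewrite -[RHS]H.
have -> : \sum_i (rhox i t x * u i t x + rho t x * ux i i t x) = - rhot t x.
  by apply/eqP; rewrite -addr_eq0 addrC M.
have : 1 + t != 0 by rewrite gt_eqF//; lra.
by move=> ?; field.
Qed.

Lemma rho_pp (s : R) : 0 <= s -> s * pp (g - 1) s = pp g s.
Proof.
by move=> s0; rewrite !ppE// mulr_powRB1//; move: g1 => ?; lra.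
Qed.

(** Contracting the momentum equation with the velocity cancels the work of the pressure against the
    change of [potential]; only the damping is left. *)
Lemma entropy_identity (t : R) x : 0 < t -> t < tau ->
  entropy_dt t x + \sum_i eflux_dx i t x = - (mu / (1 + t) * (rho t x * sq t x)).
Proof.
move=> t0 tt.
have M := flow_mass fl x t0 tt.
have N j := flow_momentum_nc x j t0 tt.
set r := rho t x in M N *; set a := pp (g - 1) r in N *.
have [e eE] : exists e : R, sq t x = e by exists (sq t x).
pose S1 := \sum_i ux i i t x.
pose S2 := \sum_i rhox i t x * u i t x.
pose T := \sum_j u j t x * ut j t x.
pose Q := \sum_j u j t x * \sum_i ux j i t x * u i t x.
have {}M : rhot t x = - (S2 + r * S1).
  apply/eqP; rewrite -addr_eq0 -M /S1 mulr_sumr -big_split /=.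
  by rewrite eqxx.
have {}N : r * T = - (r * Q + A * g * a * S2 + mu / (1 + t) * (r * e)).
  apply/eqP; rewrite -addr_eq0; apply/eqP.
  transitivity (\sum_j u j t x * (r * ut j t x + r * \sum_i ux j i t x * u i t x
    + A * g * a * rhox j t x + mu / (1 + t) * (r * u j t x))).
    rewrite -eE /T /Q /S2 /sq !mulr_sumr -!big_split /=.
    by apply: eq_bigr => j _; ring.
  by apply: big1 => j _; rewrite N mulr0.
have E1 : \sum_j 2 * (u j t x * ut j t x) = 2 * T by rewrite mulr_sumr.
have E2 : \sum_i eflux_dx i t x = S1 * (1 / 2 * r * e + potential_flux A g rb r)
   + (1 / 2 * e * S2 + r * Q + (A * g / (g - 1) * g * a - Hb) * S2).
  have -> : Q = \sum_i u i t x * \sum_j u j t x * ux j i t x.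
    rewrite /Q; under eq_bigr do rewrite mulr_sumr.
    rewrite exchange_big /=; apply: eq_bigr => i _; rewrite mulr_sumr.
    by apply: eq_bigr => j _; ring.
  rewrite /S1 /S2 mulr_suml !mulr_sumr -!big_split /=.
  apply: eq_bigr => i _; rewrite /eflux_dx -/r -/a eE -mulr_sumr; field.
  by move: g1 => ?; rewrite subr_eq0 gt_eqF.
rewrite E2 /entropy_dt -/r -/a eE E1 M.
have -> : 1 / 2 * r * (2 * T) = r * T by field.
rewrite N /potential_flux -/Hb -rho_pp; last exact: (flow_ge0 fl).
rewrite -/a; field.
have : 1 + t != 0 by rewrite gt_eqF//; lra.
have : g - 1 != 0 by move: g1 => ?; rewrite subr_eq0 gt_eqF.
by move=> -> ->.
Qed.

End Propagation.

(** * Energy decay in a backward cone *)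

Section Cone.
Context {R : realType}.
Variable n : nat.
Variables (A g mu tau rb : R).
Variables (rho rhot : R -> 'rV[R]_n -> R) (rhox : 'I_n -> R -> 'rV[R]_n -> R).
Variables (u ut : 'I_n -> R -> 'rV[R]_n -> R).
Variable ux : 'I_n -> 'I_n -> R -> 'rV[R]_n -> R.
Hypothesis fl : flow A g mu tau rho rhot rhox u ut ux.
Hypotheses (A0 : 0 < A) (g1 : 1 < g) (rb0 : 0 < rb) (mu0 : 0 <= mu) (tau0 : 0 < tau).
Variables (x0 : 'rV[R]_n) (t1 b c k : R).
Hypotheses (c0 : 0 < c) (cb : c < b).
Hypothesis Hk : forall s U : R, `|s - rb| <= k -> 0 <= U -> U <= k ->
    (1 / 2 * s * U ^+ 2 + `|potential_flux A g rb s|) * U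
      <= b * (1 / 2 * s * U ^+ 2 + potential A g rb s) /\
    (0 < 1 / 2 * s * U ^+ 2 + potential A g rb s \/ s = rb /\ U = 0).

Let b0 : 0 < b. Proof. exact: lt_trans cb. Qed.
Let sq (t : R) x := \sum_j u j t x ^+ 2.
Let ysq (x : 'rV[R]_n) := \sum_i (x 0 i - x0 0 i) ^+ 2.
Let ent := entropy A g rb rho u.
Let ent_dt := entropy_dt A g rb rho rhot u ut.
Let efl := eflux A g rb rho u.
Let efl_dx := eflux_dx A g rb rho rhox u ux.

(* Positive exactly inside the cone with apex (t1, x0) and slope b. *)
Let D (t : R) (x : 'rV[R]_n) := b ^+ 2 * (t1 - clamp tau t) ^+ 2 - ysq x.
(** Squaring the positive part makes the cut-off C^1 across the cone. The derivatives below are kept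
    in the form in which the differentiation rules produce them. *)
Let chi t x := pp 2 (D t x).
Let chi_t t x := 2 * pp (2 - 1) (D t x) * (b ^+ 2 * (2 * ((t1 - clamp tau t) * (0 - 1))) - 0).
Let chi_x (i : 'I_n) t (x : 'rV[R]_n) :=
  2 * pp (2 - 1) (D t x) * (0 - \sum_j 2 * ((x 0 j - x0 0 j) * ((j == i)%:R - 0))).

Let csq t : continuous (fun x : 'rV[R]_n => x 0 t).
Proof. exact: coord_continuous. Qed.

Let jD : jc D.
Proof.
apply: (@contB _ _ (fun z => b ^+ 2 * (t1 - clamp tau z.1) ^+ 2) (fun z => ysq z.2)).
  apply: (jc_fst (h := fun t => b ^+ 2 * (t1 - clamp tau t) ^+ 2)).
  apply: contZ; apply: contX; apply: contB; [exact: contC|exact: cont_clamp].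
apply: jc_snd; apply: cont_sum => i; apply: contX; apply: contB; [exact: csq|exact: contC].
Qed.

Let jchi : jc chi.
Proof. by apply: (@cont_comp _ _ (pp 2) (fun z => D z.1 z.2)) jD; exact: cont_pp. Qed.

Let pp1_gt : (0 : R) < 2 - 1. Proof. lra. Qed.

Let jpD : jc (fun t x => 2 * pp (2 - 1) (D t x)).
Proof. by apply: contZ; apply: (@cont_comp _ _ (pp (2 - 1)) (fun z => D z.1 z.2)) jD; exact: cont_pp. Qed.

Let jchi_t : jc chi_t.
Proof.
apply: (contM jpD); apply: (jc_fst (h := fun t => b ^+ 2 * (2 * ((t1 - clamp tau t) * (0 - 1))) - 0)).
apply: contB; last exact: contC.
by apply: contZ; apply: contZ; apply: contM; [apply: contB; [exact: contC|exact: cont_clamp]|exact: contC].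
Qed.

Let jchi_x i : jc (chi_x i).
Proof.
apply: (contM jpD); apply: (jc_snd (h := fun x => 0 - \sum_j 2 * ((x 0 j - x0 0 j) * ((j == i)%:R - 0)))).
apply: contB; first exact: contC.
apply: cont_sum => j; apply: contZ; apply: contM; last exact: contC.
by apply: contB; [exact: csq|exact: contC].
Qed.

Let jsq : jc sq.
Proof. by apply: cont_sum => j; apply: contX; exact: (flow_cu fl). Qed.

Let jpp a : 0 < a -> jc (fun t x => pp a (rho t x)).
Proof.
by move=> a0; apply: (@cont_comp _ _ (pp a) (fun z => rho z.1 z.2)) (flow_c fl); exact: cont_pp.
Qed.

Let g0 : 0 < g. Proof. by apply: lt_trans g1. Qed.
Let g10 : 0 < g - 1. Proof. by rewrite subr_gt0. Qed.

Let jent : jc ent.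
Proof.
apply: contD; first by apply: contM jsq; apply: contZ; exact: (flow_c fl).
apply: contB; apply: contZ; apply: contB; [exact: jpp|exact: contC|exact: (flow_c fl)|exact: contC].
Qed.

Let jent_dt : jc ent_dt.
Proof.
apply: contD.
  apply: contD; apply: contM.
  - by apply: contZ; exact: (flow_ct fl).
  - exact: jsq.
  - by apply: contZ; exact: (flow_c fl).
  - by apply: cont_sum => j; apply: contZ; apply: contM; [exact: (flow_cu fl)|exact: (flow_cut fl)].
apply: contB; apply: contZ; last exact: (flow_ct fl).
by apply: contM; [apply: contZ; exact: jpp|exact: (flow_ct fl)].
Qed.

Let jW : jc (fun t x => 1 / 2 * rho t x * sq t x + potential_flux A g rb (rho t x)).
Proof.
apply: contD; first by apply: contM jsq; apply: contZ; exact: (flow_c fl).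
by apply: contB; apply: contZ; [exact: jpp|exact: (flow_c fl)].
Qed.

Let jefl i : jc (efl i).
Proof. by apply: contM; [exact: (flow_cu fl)|exact: jW]. Qed.

Let jefl_dx i : jc (efl_dx i).
Proof.
apply: contD; first by apply: contM; [exact: (flow_cux fl)|exact: jW].
apply: contM; first exact: (flow_cu fl).
apply: contD.
  apply: contD; apply: contM.
  - by apply: contZ; exact: (flow_cx fl).
  - exact: jsq.
  - by apply: contZ; exact: (flow_c fl).
  - by apply: cont_sum => j; apply: contZ; apply: contM; [exact: (flow_cu fl)|exact: (flow_cux fl)].
apply: contB; apply: contZ; last exact: (flow_cx fl).
by apply: contM; [apply: contZ; exact: jpp|exact: (flow_cx fl)].
Qed.

(** A max-norm radius that contains the cross-sections of the cone at all clamped times. *)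
Let L := `|x0| + b * (`|t1| + tau).
Let L0 : 0 <= L.
Proof. by rewrite addr_ge0// mulr_ge0 ?(ltW b0)// addr_ge0 ?(ltW tau0). Qed.

Let D_le0 t x : L < `|x| -> D t x <= 0.
Proof.
move=> Lx; rewrite leNgt; apply/negP => Dp; move: Lx; rewrite ltNge => /negP; apply.
apply/normrV_le => // i.
have H0 : `|x0 0 i| <= `|x0| by have := iffLR (normrV_le x0 (normr_ge0 x0)) (lexx _) i.
have yi : (x 0 i - x0 0 i) ^+ 2 <= ysq x.
  rewrite /ysq (bigD1 i)//= lerDl; apply: sumr_ge0 => j _; exact: sqr_ge0.
have H : `|x 0 i - x0 0 i| <= b * (`|t1| + tau).
  rewrite -ler_sqr ?nnegrE ?mulr_ge0 ?(ltW b0) ?addr_ge0 ?(ltW tau0)//.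
  rewrite real_normK ?num_real// (le_trans yi)//.
  move: Dp; rewrite /D subr_gt0 => /ltW/le_trans; apply.
  rewrite exprMn ler_pM2l ?exprn_gt0// -[leLHS]real_normK ?num_real//.
  rewrite ler_sqr ?nnegrE ?addr_ge0 ?(ltW tau0)//.
  apply: le_trans (ler_normB _ _) _; rewrite lerD2l.
  by have /andP[h1 h2] := clamp_itv t (ltW tau0); rewrite ger0_norm.
have -> : x 0 i = x0 0 i + (x 0 i - x0 0 i) by ring.
by apply: le_trans (ler_normD _ _) _; exact: (lerD H0 H).
Qed.

Let chi_csupp t : csupp L (chi t).
Proof. by move=> x Lx; rewrite /chi pp_le0// D_le0. Qed.

Let G (t : R) x := ent t x * chi t x.
Let Gt (t : R) x := ent_dt t x * chi t x + ent t x * chi_t t x.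

Let G_cs t : cs L (G t).
Proof.
split; first by apply: (@jc_slice _ _ _ G); apply: contM; [exact: jent|exact: jchi].
by move=> x Lx; rewrite /G chi_csupp// mulr0.
Qed.

Let jGt : jc Gt.
Proof.
by apply: contD; apply: contM; [exact: jent_dt|exact: jchi|exact: jent|exact: jchi_t].
Qed.

Let chi_t_csupp t : csupp L (chi_t t).
Proof. by move=> x Lx; rewrite /chi_t pp_le0 ?D_le0// mulr0 mul0r. Qed.

Let chi_x_csupp i t : csupp L (chi_x i t).
Proof. by move=> x Lx; rewrite /chi_x pp_le0 ?D_le0// mulr0 mul0r. Qed.

Let dersq (V : normedModType R) (x v : V) (f : V -> R) d :
  is_derive x v f d -> is_derive x v (fun y => f y ^+ 2) (2 * (f x * d)).
Proof.
move=> df; have := derM df df; under eq_fun do rewrite -expr2.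
by move=> H; apply: (is_derive_eq H); ring.
Qed.

Let der_coord (x : 'rV[R]_n) (i j : 'I_n) :
  is_derive x (delta_mx 0 i) (fun y : 'rV[R]_n => y 0 j) (j == i)%:R.
Proof.
apply/is_derive_epsP => e e0; near=> h.
by rewrite !mxE eqxx /= addrK subrr normr0 mulr_ge0// ltW.
Unshelve. all: by end_near. Qed.

Let dchi_x i t x : is_derive x (delta_mx 0 i) (chi t) (chi_x i t x).
Proof.
have d2 : (1 : R) < 2 by lra.
have dy : is_derive x (delta_mx 0 i) ysq
    (\sum_j 2 * ((x 0 j - x0 0 j) * ((j == i)%:R - 0))).
  by apply: der_sum => j; apply: dersq; exact: (derB (der_coord x i j) (derC _ _ _)).
exact: (der_comp (f := D t) (der_pp _ d2) (derB (derC _ _ _) dy)).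
Qed.

Let dchi_t (t : R) x : 0 < t -> t < tau -> is_derive t 1 (chi ^~ x) (chi_t t x).
Proof.
move=> t0 tt; have d2 : (1 : R) < 2 by lra.
have dc : is_derive t 1 (clamp tau) 1.
  exact: near_eq_is_derive (near_clamp t0 tt) (is_derive_id t (1 : R)).
exact: (der_comp (f := D ^~ x) (der_pp _ d2) (derB (derZ (b ^+ 2) (dersq (derB (derC t 1 t1) dc))) (derC t 1 (ysq x)))).
Qed.

Let dG (t : R) : 0 < t -> t < tau ->
  is_derive t 1 (fun t => integralRn (G t)) (integralRn (Gt t)).
Proof.
move=> t0 tt; apply: (@is_derive_integralRn _ _ L) => //.
have [H1 H2] := (lt_nbhsr t0, lt_nbhsl tt).
move: H2; apply: filter_app; move: H1; apply: filter_app; near=> s => s0 st x.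
exact: (derM (is_derive_entropy rb fl g1 x s0 st) (dchi_t x s0 st)).
Unshelve. all: by end_near. Qed.

Let div_eq0 i t : integralRn (fun x => efl_dx i t x * chi t x + efl i t x * chi_x i t x) = 0.
Proof.
apply: (@integralRn_partial _ _ L i (fun x => efl i t x * chi t x)) => //.
- split; first by apply: (@jc_slice _ _ _ (fun t x => efl i t x * chi t x)); apply: contM; [exact: jefl|exact: jchi].
  by move=> x Lx; rewrite chi_csupp// mulr0.
- apply: (@jc_slice _ _ _ (fun t x => efl_dx i t x * chi t x + efl i t x * chi_x i t x)).
  by apply: contD; apply: contM; [exact: jefl_dx|exact: jchi|exact: jefl|exact: jchi_x].
- by move=> x; exact: (derM (is_derive_eflux rb fl g1 i t x) (dchi_x i t x)).
Qed.

(** Tested against the cut-off, the energy identity leaves the damping term and -4 D+ (b^2 (t1 - t)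
    e + (u . (x - x0)) W), where D+ is the positive part of D, e the energy and u W its flux. In the
    cone |x - x0| <= b (t1 - t), so the Cauchy-Schwarz inequality and [Hk] make the bracket
    nonnegative. *)
Lemma energy_decay (t : R) : 0 < t -> t < tau -> t <= t1 ->
  (forall x, 0 < D t x -> `|rho t x - rb| <= k /\ Num.sqrt (sq t x) <= k) ->
  integralRn (Gt t) <= 0.
Proof.
move=> t0 tt tt1 near.
pose Q (i : 'I_n) x := efl_dx i t x * chi t x + efl i t x * chi_x i t x.
have csQ i : cs L (Q i).
  split.
    apply: (@jc_slice _ _ _ (fun t x => efl_dx i t x * chi t x + efl i t x * chi_x i t x)).
    by apply: contD; apply: contM; [exact: jefl_dx|exact: jchi|exact: jefl|exact: jchi_x].
  by move=> x Lx; rewrite /Q chi_csupp// chi_x_csupp// !mulr0 addr0.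
have csG : cs L (Gt t).
  split; first exact: jc_slice jGt.
  by move=> x Lx; rewrite /Gt chi_csupp// chi_t_csupp// !mulr0 addr0.
have csS : cs L (fun x => \sum_i Q i x) by exact: cs_sum.
have -> : integralRn (Gt t) = integralRn (fun x => Gt t x + \sum_i Q i x).
  rewrite (integralRnD csG csS) (integralRn_sum _ csQ) big1 ?addr0// => i _.
  exact: div_eq0.
rewrite -[leRHS](@integralRn0 R n); apply: (@le_integralRn _ _ L).
- exact: csD.
- exact: cs0.
move=> x.
have -> : Gt t x + \sum_i Q i x = (ent_dt t x + \sum_i efl_dx i t x) * chi t x +
    (ent t x * chi_t t x + \sum_i efl i t x * chi_x i t x).
  rewrite /Gt /Q big_split /= -mulr_suml; ring.
have [D0|D0] := leP (D t x) 0.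
  have -> : chi t x = 0 by rewrite /chi pp_le0.
  have -> : chi_t t x = 0 by rewrite /chi_t pp_le0// mulr0 mul0r.
  rewrite !mulr0 !add0r big1// => i _.
  by rewrite /chi_x pp_le0// mulr0 mul0r mulr0.
have [rk uk] := near x D0.
have U0 : 0 <= Num.sqrt (sq t x) by exact: sqrtr_ge0.
have [K1 _] := Hk rk U0 uk.
have sq0 : 0 <= sq t x by apply: sumr_ge0 => j _; exact: sqr_ge0.
rewrite sqr_sqrtr// in K1.
rewrite -[leRHS]addr0; apply: lerD.
  rewrite (entropy_identity rb fl g1)// mulNr oppr_le0.
  rewrite mulr_ge0 ?pp_ge0// mulr_ge0//; last by rewrite mulr_ge0// (flow_ge0 fl).
  by rewrite divr_ge0//; lra.
pose V := \sum_i u i t x * (x 0 i - x0 0 i).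
pose W := 1 / 2 * rho t x * sq t x + potential_flux A g rb (rho t x).
have clt : clamp tau t = t by rewrite clamp_id// ltW.
have -> : ent t x * chi_t t x + \sum_i efl i t x * chi_x i t x =
  - (4 * pp (2 - 1) (D t x) * (b ^+ 2 * (t1 - t) * ent t x + V * W)).
  have -> : \sum_i efl i t x * chi_x i t x = - (4 * pp (2 - 1) (D t x) * (V * W)).
    rewrite /V mulr_suml mulr_sumr -sumrN; apply: eq_bigr => i _.
    have cx : \sum_j 2 * ((x 0 j - x0 0 j) * ((j == i)%:R - 0)) = 2 * (x 0 i - x0 0 i).
      rewrite (bigD1 i)//= eqxx big1 => [|j /negbTE ->]; last by rewrite subrr !mulr0.
      by rewrite addr0 subr0 mulr1.
    by rewrite /efl /eflux /chi_x cx -/(sq t x) -/W; ring.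
  by rewrite /chi_t clt; ring.
rewrite oppr_le0 mulr_ge0//; first by rewrite mulr_ge0// pp_ge0.
have y0 : 0 <= ysq x by apply: sumr_ge0 => i _; exact: sqr_ge0.
have tt0 : 0 <= t1 - t by lra.
have Yb : Num.sqrt (ysq x) <= b * (t1 - t).
  rewrite -ler_sqr ?nnegrE ?sqrtr_ge0 ?mulr_ge0 ?(ltW b0)//.
  rewrite sqr_sqrtr// exprMn; move: D0; rewrite /D clt subr_gt0; exact: ltW.
have Vb : `|V| <= Num.sqrt (sq t x) * Num.sqrt (ysq x) := dot_CS _ _.
have Wb : `|W| <= 1 / 2 * rho t x * sq t x + `|potential_flux A g rb (rho t x)|.
  apply: le_trans (ler_normD _ _) _; rewrite lerD2r ger0_norm//.
  by rewrite mulr_ge0// mulr_ge0// (flow_ge0 fl).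
have VW : `|V * W| <= b ^+ 2 * (t1 - t) * ent t x.
  rewrite normrM; apply: (@le_trans _ _ (Num.sqrt (sq t x) * Num.sqrt (ysq x) *
    (1 / 2 * rho t x * sq t x + `|potential_flux A g rb (rho t x)|))).
    exact: ler_pM.
  set Z := _ + `|_| in K1 Wb *.
  have Z0 : 0 <= Z by apply: le_trans Wb.
  have -> : Num.sqrt (sq t x) * Num.sqrt (ysq x) * Z =
    (Z * Num.sqrt (sq t x)) * Num.sqrt (ysq x) by ring.
  have -> : b ^+ 2 * (t1 - t) * ent t x = (b * ent t x) * (b * (t1 - t)) by ring.
  by apply: ler_pM => //; rewrite ?sqrtr_ge0// mulr_ge0// sqrtr_ge0.
have := ler_norm (- (V * W)); rewrite normrN; lra.
Qed.

Let rst := rest rb rho u.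

Hypothesis jk : 0 < k.

(** For a short time continuity keeps the flow within k of rest in the cone, where [Hk] applies: the
    energy is nonnegative, starts at 0 and does not increase, so it vanishes, and with it the
    deviation from rest. *)
Lemma cone_step (t : R) : 0 <= t -> t < Num.min t1 tau ->
  (forall x, 0 < D t x -> rst t x) ->
  exists2 d : R, 0 < d & forall s, t < s -> s < t + d -> s < Num.min t1 tau ->
    forall x, 0 < D s x -> rst s x.
Proof.
move=> t0; rewrite lt_min => /andP[tt1 tt] rt.
(* Small enough that n components of size k' have Euclidean norm at most k. *)
pose k' := k / n.+1%:R.
have k'0 : 0 < k' by rewrite divr_gt0.
have N1 := @jc_unif R R n rho L t k' (flow_c fl) k'0.
have N2 : \forall s \near t, forall j x, `|x| <= L -> `|u j s x - u j t x| <= k'.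
  pose P (j : 'I_n) (s : R) := forall x, `|x| <= L -> `|u j s x - u j t x| <= k'.
  apply: (@filter_forall R 'I_n P (nbhs t) (nbhs_filter t)) => j.
  have cuj : jc (u j) by exact: (flow_cu fl).
  have H := @jc_unif R R n (u j) L t k' cuj k'0.
  by apply: filterS H => s.
have N3 : \forall s \near t, (forall x, `|x| <= L -> `|rho s x - rho t x| <= k') /\
    (forall j x, `|x| <= L -> `|u j s x - u j t x| <= k') by exact: filterI N1 N2.
have /nbhs_ballP[d /= d0 Hd] := N3.
exists d => // s ts sd; rewrite lt_min => /andP[st1 stau].
have Dmon (v w : R) x : t <= v -> v <= w -> w <= s -> 0 < D w x -> 0 < D v x.
  move=> tv vw ws; rewrite /D !clamp_id; try lra.
  move=> H; apply: lt_le_trans H _; rewrite lerD2r ler_pM2l ?exprn_gt0//.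
  by rewrite ler_sqr ?nnegrE; lra.
have nr (v : R) x : t <= v -> v <= s -> 0 < D v x ->
    `|rho v x - rb| <= k /\ Num.sqrt (sq v x) <= k.
  move=> tv vs Dv; have Dt : 0 < D t x by apply: (Dmon t v) => //; lra.
  have [r1 u1] := rt x Dt.
  have xL : `|x| <= L by rewrite leNgt; apply/negP => /(D_le0 t); rewrite leNgt Dt.
  have [|B1 B2] := Hd v.
    by rewrite /ball /= ltr_norml; apply/andP; split; lra.
  have kk : k' <= k by rewrite /k' ler_pdivrMr// ler_peMr ?(ltW jk)// ler1n.
  split; first by have := B1 x xL; rewrite r1 => /le_trans; apply.
  rewrite -ler_sqr ?nnegrE ?sqrtr_ge0 ?(ltW jk)// sqr_sqrtr; last first.
    by apply: sumr_ge0 => j _; exact: sqr_ge0.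
  apply: (@le_trans _ _ (\sum_(j < n) k' ^+ 2)).
    apply: ler_sum => j _; have := B2 j x xL; rewrite u1 subr0 => H.
    by rewrite -[leLHS]real_normK ?num_real// ler_sqr ?nnegrE// ltW.
  rewrite sumr_const card_ord -mulr_natr /k' expr_div_n -mulrA ger_pMr ?exprn_gt0//.
  rewrite mulrC ler_pdivrMr ?exprn_gt0// mul1r.
  by rewrite -natrX ler_nat expnS expn1 (leq_trans (leqnSn n))// leq_pmulr.
have Gge v x : t <= v -> v <= s -> 0 <= G v x.
  move=> tv vs; rewrite /G; have [Dv|Dv] := leP (D v x) 0.
    by rewrite /chi pp_le0// mulr0.
  have [rk uk] := nr v x tv vs Dv.
  rewrite mulr_ge0 ?pp_ge0//.
  have [_ []] := Hk rk (sqrtr_ge0 _) uk.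
    by rewrite sqr_sqrtr; [exact: ltW|apply: sumr_ge0 => j _; exact: sqr_ge0].
  case=> rr UU; rewrite /ent /entropy -/(sq v x).
  have -> : sq v x = 0.
    have s0 : 0 <= sq v x by apply: sumr_ge0 => j _; exact: sqr_ge0.
    by rewrite -(sqr_sqrtr s0) UU expr0n.
  rewrite mulr0 add0r rr /potential ppE ?(ltW rb0)// !subrr !mulr0 subrr//.
have E0 : integralRn (G t) = 0.
  rewrite -[RHS](@integralRn0 R n); congr integralRn; apply/funext => x.
  rewrite /G; have [Dv|Dv] := leP (D t x) 0; first by rewrite /chi pp_le0// mulr0.
  have [rr uu] := rt x Dv.
  rewrite /ent /entropy big1 ?mulr0 ?add0r; last by move=> j _; rewrite uu expr0n.
  by rewrite rr /potential ppE ?(ltW rb0)// !subrr !mulr0 subrr mul0r.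
have Es : integralRn (G s) <= 0.
  rewrite -E0; apply: (@le0_derive_le _ (fun t => integralRn (G t)) (fun t => integralRn (Gt t))).
  - exact: ltW.
  - move=> v _; apply: (@continuous_integralRn _ _ _ L) => //; last by move=> w; exact: (G_cs w).2.
    by apply: contM; [exact: jent|exact: jchi].
  - by move=> v /andP[tv vs]; apply: dG; lra.
  - move=> v /andP[tv vs]; apply: energy_decay; try lra.
    by move=> x; apply: nr; lra.
move=> x Ds.
have [rk uk] := nr s x (ltW ts) (lexx _) Ds.
have [_ [H|[rr UU]]] := Hk rk (sqrtr_ge0 _) uk; last first.
  split=> // j.
  have s0 : 0 <= sq s x by apply: sumr_ge0 => i _; exact: sqr_ge0.
  have sq0 : sq s x = 0 by rewrite -(sqr_sqrtr s0) UU expr0n.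
  have : u j s x ^+ 2 = 0.
    apply/eqP; rewrite eq_le sqr_ge0 andbT -sq0 /sq (bigD1 j)//= lerDl.
    by apply: sumr_ge0 => i _; exact: sqr_ge0.
  by move=> /eqP; rewrite sqrf_eq0 => /eqP.
exfalso.
have : 0 < integralRn (G s).
  apply: (@integralRn_gt0 _ _ L _ x) => //; first by move=> y; apply: Gge => //; exact: ltW.
  rewrite /G mulr_gt0 ?pp_gt0//.
  by move: H; rewrite sqr_sqrtr//; apply: sumr_ge0 => j _; exact: sqr_ge0.
by rewrite ltNge Es.
Qed.

(** Real induction. The closed step is a limit from the left: a point of the cone at time t lies in
    it at all earlier times, and the fields are continuous. *)
Lemma cone_rest : (forall x, 0 < D 0 x -> rst 0 x) ->
  forall t : R, 0 <= t -> t < Num.min t1 tau -> forall x, 0 < D t x -> rst t x.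
Proof.
move=> r0; apply: (real_induction (P := fun t => forall x, 0 < D t x -> rst t x)); last first.
  by move=> t t0 tT Pt; exact: cone_step.
move=> t t0 tT; have [->|tn] := eqVneq t 0; first by move=> _; exact: r0.
have {tn}tp : 0 < t by rewrite lt_neqAle eq_sym tn.
move: tT; rewrite lt_min => /andP[tt1 tt] Ps x Dx.
have Dmon (s : R) : 0 <= s -> s < t -> 0 < D s x.
  move=> s0 st; apply: lt_trans Dx _; rewrite /D !clamp_id; try lra.
  by rewrite ltrD2r ltr_pM2l ?exprn_gt0// ltr_sqr ?nnegrE; lra.
have lim (f : R -> R) v : continuous f -> (forall s : R, 0 <= s -> s < t -> f s = v) -> f t = v.
  move=> cf fv; apply/eqP; rewrite -subr_eq0 -normr_le0; apply/ler_addgt0Pr => e e0.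
  rewrite add0r.
  have /cvgrPdist_le/(_ e e0)/nbhs_ballP[d /= d0 Hd] := cf t.
  pose s := t - Num.min (d / 2) (t / 2).
  have m0 : 0 < Num.min (d / 2) (t / 2) by rewrite lt_min !divr_gt0.
  have m1 : Num.min (d / 2) (t / 2) <= d / 2 by rewrite ge_min lexx.
  have m2 : Num.min (d / 2) (t / 2) <= t / 2 by rewrite ge_min lexx orbT.
  have := Hd s; rewrite (fv s) /s; [|lra|lra]; apply.
  by rewrite /ball /= subKr ger0_norm ?ltW//; lra.
split=> [|j].
  apply: (lim (rho ^~ x)); first exact: (@jc_slice1 R _ _ rho x (flow_c fl)).
  by move=> s s0 st; have [] := Ps s s0 st x (Dmon s s0 st).
have cuj : jc (u j) by exact: (flow_cu fl).
apply: (lim (u j ^~ x)); first exact: (@jc_slice1 R _ _ (u j) x cuj).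
by move=> s s0 st; have [_] := Ps s s0 st x (Dmon s s0 st).
Qed.

End Cone.

Section FiniteSpeed.
Context {R : realType}.
Variable n : nat.

Lemma enorm_sum (x : 'rV[R]_n) : enorm x = Num.sqrt (\sum_i x 0 i ^+ 2).
Proof. by rewrite /enorm /dotv; under eq_bigr do rewrite -expr2. Qed.

Lemma enorm_ge0 (x : 'rV[R]_n) : 0 <= enorm x.
Proof. exact: sqrtr_ge0. Qed.

Lemma sqr_enorm (x : 'rV[R]_n) : enorm x ^+ 2 = \sum_i x 0 i ^+ 2.
Proof. by rewrite enorm_sum sqr_sqrtr// sumr_ge0// => i _; exact: sqr_ge0. Qed.

Lemma normr_dotv (x y : 'rV[R]_n) : `|dotv x y| <= enorm x * enorm y.
Proof. by rewrite !enorm_sum; exact: dot_CS. Qed.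

Lemma ler_enormD (x y : 'rV[R]_n) : enorm (x + y) <= enorm x + enorm y.
Proof.
rewrite -ler_sqr ?nnegrE ?addr_ge0 ?enorm_ge0// sqrrD !sqr_enorm.
have -> : \sum_i (x + y) 0 i ^+ 2 =
    \sum_i x 0 i ^+ 2 + dotv x y *+ 2 + \sum_i y 0 i ^+ 2.
  rewrite /dotv -mulr_natr mulr_suml -!big_split /=.
  by apply: eq_bigr => i _; rewrite !mxE; ring.
rewrite lerD2r lerD2l lerMn2r orFb.
exact: le_trans (ler_norm _) (normr_dotv x y).
Qed.

Lemma normr_le_enorm (x : 'rV[R]_n) : `|x| <= enorm x.
Proof.
apply/normrV_le => [|i]; first exact: enorm_ge0.
rewrite -ler_sqr ?nnegrE ?enorm_ge0// real_normK ?num_real// sqr_enorm (bigD1 i)//=.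
by rewrite lerDl sumr_ge0// => j _; exact: sqr_ge0.
Qed.

(** Every slope b > c is admissible, though with its own k; [cone_rest] needs no uniformity in k. So
    each point beyond r + c t gets its own cone, of slope c + d and with apex slightly later than
    t. *)
Lemma finite_speed (A g mu tau rb r c : R)
    (rho rhot : R -> 'rV[R]_n -> R) (rhox : 'I_n -> R -> 'rV[R]_n -> R)
    (u ut : 'I_n -> R -> 'rV[R]_n -> R) (ux : 'I_n -> 'I_n -> R -> 'rV[R]_n -> R) :
  flow A g mu tau rho rhot rhox u ut ux ->
  0 < A -> 1 < g -> 0 < rb -> 0 <= mu -> 0 < tau -> 0 < c ->
  c ^+ 2 = A * g * rb `^ (g - 1) ->
  (forall x, r < enorm x -> rest rb rho u 0 x) ->
  forall t : R, 0 <= t -> t < tau -> forall x, r + c * t < enorm x -> rest rb rho u t x.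
Proof.
move=> fl A0 g1 rb0 mu0 tau0 c0 c2 init t t0 tt x xr.
pose s := enorm x - r - c * t.
have s0 : 0 < s by rewrite /s; lra.
(* As d <= 1, (c + d) (t + d) exceeds c t by at most d (c + t + 1) <= s, so the base of the cone
   stays outside the ball of radius r. *)
pose d := Num.min 1 (s / (c + t + 1)).
have ct : 0 < c + t + 1 by lra.
have d0 : 0 < d by rewrite lt_min ltr01 divr_gt0.
have d1 : d <= 1 by rewrite ge_min lexx.
have ds : d * (c + t + 1) <= s by rewrite -ler_pdivlMr// ge_min lexx orbT.
have [k k0 Hk] := entropy_local A0 g1 rb0 c0 c2 (b := c + d) ltac:(lra).
have b0 : 0 < c + d by lra.
have bt : r + (c + d) * (t + d) <= enorm x.
  have : d * d <= d * 1 by rewrite ler_pM2l.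
  rewrite /s in ds; lra.
apply: (cone_rest (x0 := x) (t1 := t + d) fl g1 rb0 mu0 tau0 c0 _ Hk k0) => //.
- lra.
- move=> y; rewrite clamp_id ?(ltW tau0)// subr0 -exprMn subr_gt0 => yx.
  apply: init.
  have E : \sum_i (y 0 i - x 0 i) ^+ 2 = enorm (x - y) ^+ 2.
    by rewrite sqr_enorm; apply: eq_bigr => i _; rewrite !mxE -sqrrN opprB.
  move: yx; rewrite E ltr_sqr ?nnegrE ?enorm_ge0 ?mulr_ge0//; try lra.
  move=> yx; have := ler_enormD y (x - y); rewrite addrC subrK; lra.
- by rewrite lt_min tt andbT; lra.
- rewrite big1 => [|i _]; last by rewrite subrr expr0n.
  rewrite subr0 clamp_id ?(ltW tt)// -exprMn exprn_gt0// mulr_gt0//; lra.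
Qed.

End FiniteSpeed.

(** * The test function *)

Section CircleKernel.
Context {R : realType}.
Local Notation mu := (@lebesgue_measure R).

Lemma continuous_eps (V : normedModType R) (f : V -> R) :
  (forall x (e : R), 0 < e -> exists2 d : R, 0 < d &
     forall y, `|x - y| < d -> `|f x - f y| <= e) -> continuous f.
Proof.
move=> H x; apply/cvgrPdist_le => e e0; have [d d0 Hd] := H x e e0.
apply/nbhs_ballP; exists d => //= y; rewrite -ball_normE /=; exact: Hd.
Qed.

(** The upper bound comes from squaring e^(-z/2) >= 1 - z / 2, which gives e^z <= (1 - z / 2)^(-2)
    <= 1 + z + z^2 for small z. *)
Lemma expR_taylor1 (z : R) : `|z| <= 1 / 4 -> `|expR z - 1 - z| <= z ^+ 2.
Proof.
rewrite ler_norml => /andP[z1 z2].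
have h1 := expR_ge1Dx z.
rewrite ger0_norm; last lra.
have h2 := expR_ge1Dx (- z / 2).
have p : 0 < 1 - z / 2 by lra.
have e : expR z * (1 - z / 2) ^+ 2 <= 1.
  have -> : z = z / 2 + z / 2 by lra.
  rewrite expRD.
  have -> : z / 2 + z / 2 = z by lra.
  have := expR_gt0 (z / 2).
  have : expR (z / 2) * expR (- z / 2) = 1.
    by rewrite -expRD mulNr subrr expR0.
  move: (expR (z / 2)) (expR (- z / 2)) h2 => a b h2 ab a0.
  have : a * (1 - z / 2) <= 1 by nra.
  have : 0 <= a * (1 - z / 2) by rewrite mulr_ge0// ltW.
  nra.
have q : 1 <= (1 - z / 2) ^+ 2 * (1 + z + z ^+ 2).
  have -> : (1 - z / 2) ^+ 2 * (1 + z + z ^+ 2) = 1 + z ^+ 2 / 4 * (1 - 3 * z + z ^+ 2) by field.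
  rewrite lerDl mulr_ge0//; first by rewrite divr_ge0// sqr_ge0.
  have := sqr_ge0 z; lra.
have z3 : 0 <= 1 + z + z ^+ 2 by have := sqr_ge0 z; lra.
have p2 : 0 < (1 - z / 2) ^+ 2 by rewrite exprn_gt0.
rewrite -subr_ge0 -(pmulr_rge0 _ p2); nra.
Qed.

(* For [s = 1] and [s = -1], [(cos th, s sin th)] with [0 <= th <= pi] runs through
   the two half circles of the recursive definition of [integralS]. *)
Definition sg (s : R) (i : 'I_2) (th : R) : R := if i == 0 then cos th else s * sin th.

Definition Kr (s th : R) (x : 'rV[R]_2) : R := expR (\sum_i x 0 i * sg s i th).

(** The free weight [w] closes the family under differentiation: a partial derivative multiplies [w]
    by a coordinate on the circle. The free endpoints allow differentiation in the arc. *)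
Definition psi (s a b : R) (w : R -> R) (x : 'rV[R]_2) : R :=
  \int[mu]_(th in `[a, b]) (w th * Kr s th x).

Lemma continuous_sg s i : continuous (sg s i).
Proof.
rewrite /sg; case: (i == 0); first exact: continuous_cos.
by apply: contZ; exact: continuous_sin.
Qed.

Variable s : R.
Hypothesis s1 : s ^+ 2 = 1.

Lemma sum_sg2 th : \sum_i sg s i th ^+ 2 = 1.
Proof.
by rewrite !big_ord_recl big_ord0 /sg /= addr0 exprMn s1 mul1r cos2Dsin2.
Qed.

Lemma normr_sg_le1 i th : `|sg s i th| <= 1.
Proof.
rewrite -(@ler_sqr _ _ 1) ?nnegrE// real_normK ?num_real// expr1n -(sum_sg2 th).
by rewrite (bigD1 i)//= lerDl sumr_ge0// => j _; exact: sqr_ge0.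
Qed.

Lemma jc_Kr : jc (Kr s).
Proof.
apply: (@cont_comp _ _ expR (fun z : R * 'rV[R]_2 => \sum_i z.2 0 i * sg s i z.1)).
  exact: continuous_expR.
apply: cont_sum => i; apply: contM => z.
  apply: (@continuous_comp _ _ _ snd (fun x : 'rV[R]_2 => x 0 i)); [exact: cvg_snd|exact: coord_continuous].
by apply: (@continuous_comp _ _ _ fst (sg s i)); [exact: cvg_fst|exact: continuous_sg].
Qed.

Lemma Kr_gt0 th x : 0 < Kr s th x.
Proof. exact: expR_gt0. Qed.

Lemma continuous_Kr x : continuous (fun th => Kr s th x).
Proof. exact: (@jc_slice1 R _ _ (Kr s) x jc_Kr). Qed.

Section Psi.
Variables (a b : R) (ab : a <= b).
Implicit Types w : R -> R.

Lemma psi_integrable w x : continuous w ->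
  mu.-integrable `[a, b] (EFin \o (fun th => w th * Kr s th x)).
Proof.
by move=> cw; apply: integrable_segment; apply: contM => //; exact: continuous_Kr.
Qed.

Lemma psiD w v x : continuous w -> continuous v ->
  psi s a b (fun th => w th + v th) x = psi s a b w x + psi s a b v x.
Proof.
move=> cw cv; rewrite /psi -RintegralD//; try exact: psi_integrable.
by apply: eq_Rintegral => th _; rewrite mulrDl.
Qed.

Lemma psiZ k w x : continuous w ->
  psi s a b (fun th => k * w th) x = k * psi s a b w x.
Proof.
move=> cw; rewrite /psi -RintegralZl//; try exact: psi_integrable.
by apply: eq_Rintegral => th _; rewrite mulrA.
Qed.

Lemma psi_ge0 w x : (forall th, 0 <= w th) -> 0 <= psi s a b w x.
Proof. by move=> w0; apply: Rintegral_ge0 => th _; rewrite mulr_ge0// ltW// Kr_gt0. Qed.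

Lemma psi_diff_bound (f : R -> R) w x (M : R) : continuous f -> continuous w ->
  (forall th, `|f th| <= M * (`|w th| * Kr s th x)) ->
  `|\int[mu]_(th in `[a, b]) f th| <= M * psi s a b (fun th => `|w th|) x.
Proof.
move=> cf cw fM.
have cn : continuous (fun th => `|w th|) by move=> th; apply: cvg_norm; exact: cw.
apply: le_trans (le_normr_Rintegral _ (integrable_segment _ _ cf)) _ => //.
rewrite /psi -RintegralZl//; last exact: psi_integrable.
apply: le_Rintegral => //; apply: integrable_segment.
  by move=> th; apply: cvg_norm; exact: cf.
by apply: contZ; apply: contM => //; exact: continuous_Kr.
Qed.

Lemma Kr_shift th (x y : 'rV[R]_2) :
  Kr s th (y + x) = Kr s th x * expR (\sum_i y 0 i * sg s i th).
Proof.
rewrite /Kr -expRD -big_split /=; congr expR; apply: eq_bigr => i _.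
by rewrite !mxE; ring.
Qed.

Lemma Kr_diff_integral w (x y : 'rV[R]_2) : continuous w ->
  psi s a b w (y + x) - psi s a b w x =
  \int[mu]_(th in `[a, b]) (w th * Kr s th x * (expR (\sum_i y 0 i * sg s i th) - 1)).
Proof.
move=> cw; rewrite /psi -RintegralB//; try exact: psi_integrable.
by apply: eq_Rintegral => th _; rewrite Kr_shift; ring.
Qed.

Lemma continuous_sgsum (y : 'rV[R]_2) : continuous (fun th => \sum_i y 0 i * sg s i th).
Proof. by apply: cont_sum => i; apply: contZ; exact: continuous_sg. Qed.

(** A shift in x multiplies the kernel by an exponential, so the remainder is the kernel times e^z -
    1 - z with |z| <= |h|. *)
Lemma is_derive_psi w x i : continuous w ->
  is_derive x (delta_mx 0 i) (psi s a b w) (psi s a b (fun th => w th * sg s i th) x).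
Proof.
move=> cw; apply/is_derive_epsP => e e0.
set P := psi s a b (fun th => `|w th|) x.
have P0 : 0 <= P by exact: psi_ge0.
have d0 : 0 < e / (P + 1) by rewrite divr_gt0//; lra.
have q0 : 0 < 1 / 4 :> R by lra.
have N : \forall h \near (0 : R), `|h| < e / (P + 1) /\ `|h| < 1 / 4.
  exact: filterI (near0_normr_lt d0) (near0_normr_lt q0).
move: N; apply: filter_app; near=> h => -[h1 h2].
have sE th : \sum_j (h *: delta_mx 0 i : 'rV[R]_2) 0 j * sg s j th = h * sg s i th.
  rewrite (bigD1 i)//= big1 ?addr0 => [|j ji]; rewrite !mxE eqxx ?eqxx /= ?mulr1//.
  by rewrite (negbTE ji) mulr0 mul0r.
have cws : continuous (fun th => w th * sg s i th) by apply: contM => //; exact: continuous_sg.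
have -> : psi s a b w (h *: delta_mx 0 i + x) - psi s a b w x -
    h * psi s a b (fun th => w th * sg s i th) x =
  \int[mu]_(th in `[a, b]) (w th * Kr s th x * (expR (h * sg s i th) - 1 - h * sg s i th)).
  rewrite Kr_diff_integral// -psiZ// /psi -RintegralB//.
  - by apply: eq_Rintegral => th _; rewrite sE; ring.
  - apply: integrable_segment; apply: contM; first by apply: contM => //; exact: continuous_Kr.
    apply: contB; last exact: contC.
    by apply: cont_comp; [exact: continuous_expR|exact: continuous_sgsum].
  - by apply: psi_integrable; exact: contZ.
have cE : continuous (fun th => w th * Kr s th x * (expR (h * sg s i th) - 1 - h * sg s i th)).
  apply: contM; first by apply: contM => //; exact: continuous_Kr.
  have ch : continuous (fun th => h * sg s i th) by apply: contZ; exact: continuous_sg.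
  apply: contB => //; apply: contB; last exact: contC.
  by apply: cont_comp => //; exact: continuous_expR.
apply: (@le_trans _ _ (h ^+ 2 * P)).
  apply: psi_diff_bound => // th.
  rewrite !normrM (gtr0_norm (Kr_gt0 th x)) mulrC.
  rewrite ler_wpM2r//; first by rewrite mulr_ge0// ltW// Kr_gt0.
  have hs : `|h * sg s i th| <= `|h|.
    by rewrite normrM ler_piMr// normr_sg_le1.
  apply: le_trans (expR_taylor1 _) _; first by apply: le_trans hs _; exact: ltW.
  by rewrite -[leLHS]real_normK ?num_real// -[leRHS]real_normK ?num_real// ler_sqr ?nnegrE.
rewrite -real_normK ?num_real// expr2 -mulrA mulrC ler_wpM2r//.
have : `|h| * (P + 1) <= e by rewrite -ler_pdivlMr ?ltW//; lra.
by apply: le_trans; rewrite ler_wpM2l//; lra.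
Unshelve. all: by end_near. Qed.

Lemma continuous_psi w : continuous w -> continuous (psi s a b w).
Proof.
move=> cw; apply: continuous_eps => x e e0.
set P := psi s a b (fun th => `|w th|) x.
have P0 : 0 <= P by exact: psi_ge0.
have d0 : 0 < e / (4 * (P + 1)) by rewrite divr_gt0//; lra.
have q0 : 0 < 1 / 8 :> R by lra.
have m0 : 0 < Num.min (e / (4 * (P + 1))) (1 / 8) by rewrite lt_min d0.
exists (Num.min (e / (4 * (P + 1))) (1 / 8)) => // y; rewrite lt_min => /andP[y1 y2].
rewrite distrC; have {1}-> : y = (y - x) + x by rewrite subrK.
rewrite Kr_diff_integral//.
have dl th : `|\sum_i (y - x) 0 i * sg s i th| <= 2 * `|x - y|.
  apply: le_trans (ler_norm_sum _ _ _) _.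
  apply: (@le_trans _ _ (\sum_(i < 2) `|x - y|)); last first.
    by rewrite sumr_const card_ord mulr_natl.
  apply: ler_sum => i _; rewrite normrM.
  have : `|(y - x) 0 i| <= `|x - y|.
    by rewrite distrC; have := iffLR (normrV_le (y - x) (normr_ge0 _)) (lexx _) i.
  by move=> H; apply: le_trans H; rewrite ler_piMr// normr_sg_le1.
apply: (@le_trans _ _ (4 * `|x - y| * P)).
  apply: psi_diff_bound => //.
    apply: contM; first by apply: contM => //; exact: continuous_Kr.
    apply: contB; last exact: contC.
    by apply: cont_comp; [exact: continuous_expR|exact: continuous_sgsum].
  move=> th; rewrite !normrM (gtr0_norm (Kr_gt0 th x)) mulrC.
  rewrite ler_wpM2r//; first by rewrite mulr_ge0// ltW// Kr_gt0.
  set z := \sum_i _; have zl : `|z| <= 2 * `|x - y| := dl th.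
  have z4 : `|z| <= 1 / 4 by lra.
  have -> : expR z - 1 = (expR z - 1 - z) + z by ring.
  apply: le_trans (ler_normD _ _) _.
  have := expR_taylor1 z4; rewrite -real_normK ?num_real//.
  have : `|z| ^+ 2 <= `|z| * 1 by rewrite expr2 ler_wpM2l//; lra.
  by move=> *; lra.
have : `|x - y| * (4 * (P + 1)) <= e by rewrite -ler_pdivlMr ?ltW//; lra.
have := normr_ge0 (x - y); move: (`|x - y|) => t t0; nra.
Qed.

End Psi.
End CircleKernel.

(** * A radial cut-off *)

Section Disc.
Context {R : realType}.

(* C^1, at least 1 on the ball of radius L, and 0 outside that of radius L + 1. *)
Definition disc n (L : R) (x : 'rV[R]_n) : R :=
  pp 2 ((L + 1) ^+ 2 - \sum_i x 0 i ^+ 2) / (2 * L + 1) ^+ 2.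

Definition disc_dx n (L : R) (i : 'I_n) (x : 'rV[R]_n) : R :=
  2 * pp (2 - 1) ((L + 1) ^+ 2 - \sum_i x 0 i ^+ 2) * (0 - 2 * x 0 i) / (2 * L + 1) ^+ 2.

Lemma is_derive_coord n (x : 'rV[R]_n) (i j : 'I_n) :
  is_derive x (delta_mx 0 i) (fun y : 'rV[R]_n => y 0 j) (j == i)%:R.
Proof.
apply/is_derive_epsP => e e0; near=> h.
by rewrite !mxE eqxx /= addrK subrr normr0 mulr_ge0// ltW.
Unshelve. all: by end_near. Qed.

Variables (n : nat) (L : R).
Hypothesis L0 : 0 <= L.
Let c0 : 0 < (2 * L + 1) ^+ 2.
Proof. by move: L0 => ?; apply: exprn_gt0; lra. Qed.

Lemma continuous_sqsum : continuous (fun x : 'rV[R]_n => \sum_i x 0 i ^+ 2).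
Proof. by apply: cont_sum => i; apply: contX; exact: coord_continuous. Qed.

Lemma continuous_disc : continuous (@disc n L).
Proof.
apply: contM; last exact: contC.
apply: cont_comp; first by apply: cont_pp.
by apply: contB; [exact: contC|exact: continuous_sqsum].
Qed.

Lemma continuous_disc_dx i : continuous (@disc_dx n L i).
Proof.
apply: contM; last exact: contC.
apply: contM; last by apply: contB; [exact: contC|apply: contZ; exact: coord_continuous].
apply: contZ; apply: cont_comp; first by apply: cont_pp; lra.
by apply: contB; [exact: contC|exact: continuous_sqsum].
Qed.

Lemma is_derive_disc i (x : 'rV[R]_n) :
  is_derive x (delta_mx 0 i) (@disc n L) (disc_dx L i x).
Proof.
have d2 : (1 : R) < 2 by lra.
have ds : is_derive x (delta_mx 0 i) (fun y : 'rV[R]_n => \sum_j y 0 j ^+ 2) (2 * x 0 i).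
  have H : is_derive x (delta_mx 0 i) (fun y : 'rV[R]_n => \sum_j y 0 j ^+ 2)
      (\sum_j ((j == i)%:R * x 0 j + x 0 j * (j == i)%:R)).
    apply: der_sum => j; under eq_fun do rewrite expr2.
    exact: (derM (is_derive_coord x i j) (is_derive_coord x i j)).
  apply: (is_derive_eq H); rewrite (bigD1 i)//= eqxx big1 ?addr0 => [|j /negbTE ->].
    by rewrite mul1r mulr1; ring.
  by rewrite mul0r mulr0 addr0.
have H := derM (der_comp (f := fun y : 'rV[R]_n => (L + 1) ^+ 2 - \sum_j y 0 j ^+ 2) (der_pp _ d2)
  (derB (derC _ _ ((L + 1) ^+ 2)) ds)) (derC x (delta_mx 0 i) ((2 * L + 1) ^+ 2)^-1).
by apply: (is_derive_eq H); rewrite mulr0 addr0.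
Qed.

Lemma disc_ge0 (x : 'rV[R]_n) : 0 <= disc L x.
Proof. by rewrite divr_ge0 ?pp_ge0// ltW. Qed.

Lemma disc_eq0 (x : 'rV[R]_n) : (L + 1) ^+ 2 <= \sum_i x 0 i ^+ 2 -> disc L x = 0.
Proof. by move=> H; rewrite /disc pp_le0 ?mul0r// subr_le0. Qed.

Lemma disc_cs : cs (L + 1) (@disc n L).
Proof.
split; first exact: continuous_disc.
move=> x Lx; apply: disc_eq0; rewrite -sqr_enorm ler_sqr ?nnegrE ?enorm_ge0//; last first.
  by move: L0 => ?; lra.
exact: le_trans (ltW Lx) (normr_le_enorm x).
Qed.

Lemma disc_ge1 (x : 'rV[R]_n) : enorm x <= L -> 1 <= disc L x.
Proof.
move=> xL; rewrite /disc ler_pdivlMr// mul1r.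
have : 2 * L + 1 <= (L + 1) ^+ 2 - \sum_i x 0 i ^+ 2.
  rewrite -sqr_enorm; have : enorm x ^+ 2 <= L ^+ 2 by rewrite ler_sqr ?nnegrE// enorm_ge0.
  by lra.
move: (_ - _) => D DL; have D0 : 0 <= D by move: L0 => ?; lra.
rewrite ppE// powR_mulrn// ler_sqr ?nnegrE//; move: L0 => ?; lra.
Qed.

(** The cut-off vanishes to second order at the boundary, also when measured by one coordinate t;
    the normalisation by (2 L + 1)^2 makes the constant uniform in L. *)
Lemma disc_le (x : 'rV[R]_n) (t : R) : t ^+ 2 <= \sum_i x 0 i ^+ 2 ->
  disc L x <= 4 * (L + 1 - t) ^+ 2.
Proof.
move=> tx; have L0' := L0.
have [H|H] := leP ((L + 1) ^+ 2) (\sum_i x 0 i ^+ 2).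
  by rewrite disc_eq0// mulr_ge0// sqr_ge0.
have tL : `|t| <= L + 1.
  by rewrite -ler_sqr ?nnegrE//; [rewrite real_normK ?num_real//; exact: le_trans (ltW H)|lra].
move: tL; rewrite ler_norml => /andP[t1 t2].
rewrite /disc ler_pdivrMr// ppE ?subr_ge0 ?(ltW H)// powR_mulrn ?subr_ge0 ?(ltW H)//.
have -> : 4 * (L + 1 - t) ^+ 2 * (2 * L + 1) ^+ 2 = (2 * (L + 1 - t) * (2 * L + 1)) ^+ 2 by ring.
have v0 : 0 <= L + 1 - t by lra.
rewrite ler_sqr ?nnegrE ?subr_ge0 ?(ltW H)//; last by rewrite !mulr_ge0//; lra.
apply: (@le_trans _ _ ((L + 1) ^+ 2 - t ^+ 2)); first by rewrite lerD2l lerN2.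
have -> : (L + 1) ^+ 2 - t ^+ 2 = (L + 1 - t) * (L + 1 + t) by ring.
have -> : 2 * (L + 1 - t) * (2 * L + 1) = (L + 1 - t) * (2 * (2 * L + 1)) by ring.
by rewrite ler_wpM2l//; lra.
Qed.

End Disc.

(** * Exponential mass of the cut-off *)

Section Mass.
Context {R : realType}.
Local Notation mu := (@lebesgue_measure R).

Lemma sqr_le_expR (v : R) : 0 <= v -> v ^+ 2 <= 64 * expR (v / 4).
Proof.
move=> v0; have -> : v / 4 = v / 8 + v / 8 by field.
rewrite expRD; have := expR_ge1Dx (v / 8); move: (expR _) => a h; nra.
Qed.

Lemma exp_integral_le (M : R) : 0 <= M ->
  \int[mu]_(t in `[- M, M]) expR ((t - M) / 4) <= 4 /\
  \int[mu]_(t in `[- M, M]) expR ((- t - M) / 4) <= 4.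
Proof.
move=> M0; have MM : - M <= M by lra.
have dl (t : R) : is_derive t 1 (fun t : R => (t - M) / 4) (4^-1).
  have := derM (derB (is_derive_id t (1 : R)) (derC t 1 M)) (derC t 1 (4^-1)).
  by move=> H; apply: (is_derive_eq H); rewrite mulr0 addr0 subr0 mul1r.
have dr (t : R) : is_derive t 1 (fun t : R => (- t - M) / 4) (- 4^-1).
  have := derM (derB (derN (is_derive_id t (1 : R))) (derC t 1 M)) (derC t 1 (4^-1)).
  by move=> H; apply: (is_derive_eq H); rewrite mulr0 addr0 subr0 mulN1r.
have cl : continuous (fun t : R => expR ((t - M) / 4)).
  by apply: cont_comp; [exact: continuous_expR|move=> t; exact: is_derive_continuous (dl t)].
have cr : continuous (fun t : R => expR ((- t - M) / 4)).
  by apply: cont_comp; [exact: continuous_expR|move=> t; exact: is_derive_continuous (dr t)].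
have E0 (z : R) : is_derive z 1 expR (expR z) by exact: is_derive_expR.
have dF (t : R) : is_derive t 1 (fun t : R => 4 * expR ((t - M) / 4)) (expR ((t - M) / 4)).
  have H := derZ 4 (der_comp (f := fun t : R => (t - M) / 4) (E0 _) (dl t)).
  by apply: (is_derive_eq H); field.
have dG (t : R) : is_derive t 1 (fun t : R => - (4 * expR ((- t - M) / 4))) (expR ((- t - M) / 4)).
  have H := derN (derZ 4 (der_comp (f := fun t : R => (- t - M) / 4) (E0 _) (dr t))).
  by apply: (is_derive_eq H); field.
split.
  rewrite (Rintegral_segment_FTC MM cl dF) subrr mul0r expR0.
  have := expR_gt0 ((- M - M) / 4); lra.
rewrite (Rintegral_segment_FTC MM cr dG).
have -> : (- - M - M) / 4 = 0 by ring.
rewrite expR0.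
have := expR_gt0 ((- M - M) / 4); lra.
Qed.

Lemma row_mx_0 m (t : R) (y : 'rV[R]_m) : (row_mx t%:M y : 'rV[R]_(m.+1)) 0 0 = t.
Proof.
have E : row_mx t%:M y 0 (lshift m (0 : 'I_1)) = t by rewrite row_mxEl mxE eqxx mulr1n.
by rewrite -[RHS]E; congr (fun_of_matrix _ _ _); exact: val_inj.
Qed.

Lemma sum_row_mx m (t : R) (y : 'rV[R]_m) (F : R -> R) :
  \sum_(i < m.+1) F ((row_mx t%:M y : 'rV[R]_(m.+1)) 0 i) = F t + \sum_i F (y 0 i).
Proof.
rewrite (@big_split_ord _ _ _ 1 m) /= big_ord_recl big_ord0 addr0; congr (_ + _).
  have E : row_mx t%:M y 0 (lshift m (0 : 'I_1)) = t by rewrite row_mxEl mxE eqxx mulr1n.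
  by congr F; exact: E.
by apply: eq_bigr => i _; congr F; exact: row_mxEr.
Qed.

(** Budget for e^t = e^(L+1) e^(-v): a part e^(-v/4) pays for v^2, a part e^(-v/2) for the width of
    a slice in dimension 2, and e^(-v/4) is left to be integrated. *)
Lemma exp_disc_le (L t v : R) : v = L + 1 - t -> 0 <= v ->
  4 * v ^+ 2 * expR t <= 256 * (expR (L + 1) * expR ((t - (L + 1)) / 4)) /\
  4 * v ^+ 2 * expR (v / 2) * expR t <= 256 * (expR (L + 1) * expR ((t - (L + 1)) / 4)).
Proof.
move=> vE v0; have := sqr_le_expR v0.
have e1 : 1 <= expR (v / 2) by rewrite -[leLHS]expR0 ler_expR; lra.
have -> : expR (L + 1) * expR ((t - (L + 1)) / 4) = expR (v / 4) * expR (v / 2) * expR t.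
  by rewrite -!expRD; congr expR; rewrite vE; field.
have := expR_gt0 (v / 4); have := expR_gt0 t.
move: (expR t) (expR (v / 4)) (expR (v / 2)) e1 => a b c c1 a0 b0 vb.
have vc : v ^+ 2 * c <= 64 * b * c by rewrite ler_wpM2r//; lra.
have v2 : v ^+ 2 <= v ^+ 2 * c by rewrite ler_peMr ?sqr_ge0.
have -> : 256 * (b * c * a) = 256 * b * c * a by ring.
by split; rewrite ler_pM2r//; lra.
Qed.

Lemma disc_mass1 (L : R) : 0 <= L ->
  integralRn (fun x : 'rV[R]_1 => disc L x * ((expR (x 0 0) + expR (- x 0 0)) / 2))
    <= 1024 * expR (L + 1).
Proof.
move=> L0; set f := fun x : 'rV[R]_1 => _.
have cx : continuous (fun x : 'rV[R]_1 => x 0 0) by exact: coord_continuous.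
have csf : cs (L + 1) f.
  apply: csM; first exact: disc_cs.
  apply: contM; last exact: contC.
  by apply: contD; apply: cont_comp; rewrite ?cx; [exact: continuous_expR|exact: cx|exact: continuous_expR|exact: contN].
have M0 : 0 <= L + 1 by lra.
have [I1 I2] := exp_integral_le M0.
pose h (t : R) := f (row_mx (t%:M : 'rV_1) (0 : 'rV_0)).
have ch : continuous h by exact: jc_slice1 (jc_row_mx csf.1).
have hs t : L + 1 < `|t| -> h t = 0.
  by move=> Lt; apply: csf.2; rewrite normr_row_mx lt_max Lt.
rewrite [integralRn f](_ : _ = \int[mu]_(t in setT) h t)//.
rewrite (Rintegral_supp hs).
pose l (t : R) := expR ((t - (L + 1)) / 4).
pose r (t : R) := expR ((- t - (L + 1)) / 4).
have cl : continuous l.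
  apply: cont_comp; first exact: continuous_expR.
  by apply: contM; [apply: contB; [move=> t A|exact: contC]|exact: contC].
have cr : continuous r.
  apply: cont_comp; first exact: continuous_expR.
  by apply: contM; [apply: contB; [apply: contN => t A|exact: contC]|exact: contC].
apply: (@le_trans _ _ (\int[mu]_(t in `[- (L + 1), L + 1]) (128 * expR (L + 1) * (l t + r t)))).
  apply: le_Rintegral => //; try apply: integrable_segment => //.
    by apply: contZ; exact: contD.
  move=> t /=; rewrite in_itv /= => /andP[t1 t2].
  pose x : 'rV[R]_1 := row_mx (t%:M : 'rV_1) (0 : 'rV_0).
  have xt : x 0 0 = t by exact: row_mx_0.
  have sx : \sum_i x 0 i ^+ 2 = t ^+ 2 by rewrite big_ord_recl big_ord0 addr0 xt.
  have d1 : disc L x <= 4 * (L + 1 - t) ^+ 2 by apply: disc_le => //; rewrite sx.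
  have d2 : disc L x <= 4 * (L + 1 - - t) ^+ 2 by apply: disc_le => //; rewrite sx sqrrN.
  have [e1 _] := @exp_disc_le _ t _ erefl (ltac:(lra) : 0 <= L + 1 - t).
  have [e2 _] := @exp_disc_le _ (- t) _ erefl (ltac:(lra) : 0 <= L + 1 - - t).
  rewrite -[h t]/(disc L x * ((expR (x 0 0) + expR (- x 0 0)) / 2)) xt.
  have f1 := ler_wpM2r (ltW (expR_gt0 t)) d1.
  have f2 := ler_wpM2r (ltW (expR_gt0 (- t))) d2.
  rewrite /l /r; lra.
rewrite RintegralZl//; last by apply: integrable_segment; exact: contD.
rewrite RintegralD//; try exact: integrable_segment.
have -> : 1024 * expR (L + 1) = 128 * expR (L + 1) * (4 + 4) by ring.
by rewrite ler_pM2l ?mulr_gt0 ?expR_gt0//; exact: lerD.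
Qed.

(** The mass of e^(x_0) sits within bounded distance of the pole x_0 = L + 1, where the slices have
    width of order sqrt(L); hence the exponent (n - 1) / 2 = 1/2. *)
Lemma disc_mass2 (L : R) : 0 <= L ->
  integralRn (fun x : 'rV[R]_2 => disc L x * expR (x 0 0))
    <= 2048 * expR (L + 1) * Num.sqrt (2 * (L + 1)).
Proof.
move=> L0; set f := fun x : 'rV[R]_2 => _.
have M0 : 0 <= L + 1 by lra.
have csf : cs (L + 1) f.
  apply: csM; first exact: disc_cs.
  by apply: cont_comp; [exact: continuous_expR|exact: coord_continuous].
pose h (t : R) := integralRn (fun y : 'rV[R]_1 => f (row_mx t%:M y)).
have ch : continuous h.
  apply: (@continuous_integralRn _ _ _ (L + 1)) => //; first exact/jc_row_mx/csf.1.
  by move=> t; exact/csupp_slice/csf.2.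
have hs t : L + 1 < `|t| -> h t = 0.
  by move=> Lt; rewrite /h (csupp_slice0 csf.2 Lt) integralRn0.
rewrite [integralRn f](_ : _ = \int[mu]_(t in setT) h t)// (Rintegral_supp hs).
pose l (t : R) := expR ((t - (L + 1)) / 4).
have cl : continuous l.
  apply: cont_comp; first exact: continuous_expR.
  by apply: contM; [apply: contB; [move=> t A|exact: contC]|exact: contC].
have [I1 _] := exp_integral_le M0.
pose S := Num.sqrt (2 * (L + 1)).
have S0 : 0 <= S by exact: sqrtr_ge0.
apply: (@le_trans _ _ (\int[mu]_(t in `[- (L + 1), L + 1]) (512 * expR (L + 1) * S * l t))).
  apply: le_Rintegral => //; try apply: integrable_segment => //; first exact: contZ.
  move=> t /=; rewrite in_itv /= => /andP[t1 t2].
  have v0 : 0 <= L + 1 - t by lra.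
  pose W := Num.sqrt ((L + 1) ^+ 2 - t ^+ 2).
  have W0 : 0 <= W by exact: sqrtr_ge0.
  have tt : 0 <= (L + 1) ^+ 2 - t ^+ 2.
    have -> : (L + 1) ^+ 2 - t ^+ 2 = (L + 1 - t) * (L + 1 + t) by ring.
    by rewrite mulr_ge0//; lra.
  have sx (y : 'rV[R]_1) : \sum_i (row_mx t%:M y : 'rV[R]_2) 0 i ^+ 2 = t ^+ 2 + y 0 0 ^+ 2.
    by rewrite (@sum_row_mx 1 t y (fun z => z ^+ 2)) big_ord_recl big_ord0 addr0.
  have hb : `|h t| <= 4 * (L + 1 - t) ^+ 2 * expR t * (2 * W) ^+ 1.
    apply: integralRn_bound => //.
      split; first exact: jc_slice (jc_row_mx csf.1).
      move=> y Wy; rewrite /f disc_eq0 ?mul0r// sx -lerBlDl.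
      have : W ^+ 2 <= y 0 0 ^+ 2.
        rewrite -[leRHS]real_normK ?num_real// ler_sqr ?nnegrE//.
        apply: le_trans (ltW Wy) _; apply/normrV_le => // i; by rewrite ord1.
      by rewrite sqr_sqrtr.
    move=> y; rewrite /f row_mx_0 ger0_norm; last first.
      by apply: mulr_ge0; [exact: disc_ge0|exact: expR_ge0].
    rewrite ler_wpM2r ?expR_ge0//; apply: disc_le => //.
    by rewrite sx lerDl sqr_ge0.
  apply: le_trans (ler_norm _) _; apply: le_trans hb _; rewrite expr1.
  have [_ e2] := @exp_disc_le _ t _ erefl v0.
  (* W^2 = (L + 1 + t) v with v = L + 1 - t, where the first factor is at most 2 (L + 1) and v <=
     e^v. *)
  have WS : W <= S * expR ((L + 1 - t) / 2).
    rewrite -ler_sqr ?nnegrE ?mulr_ge0 ?expR_ge0// exprMn !sqr_sqrtr//; last lra.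
    have -> : (L + 1) ^+ 2 - t ^+ 2 = (L + 1 + t) * (L + 1 - t) by ring.
    apply: ler_pM => //; [lra|lra|].
    rewrite expr2 -expRD; have -> : (L + 1 - t) / 2 + (L + 1 - t) / 2 = L + 1 - t by field.
    have := expR_ge1Dx (L + 1 - t); lra.
  apply: (@le_trans _ _ (4 * (L + 1 - t) ^+ 2 * expR t * (2 * (S * expR ((L + 1 - t) / 2))))).
    rewrite ler_wpM2l// ?ler_wpM2l// mulr_ge0 ?expR_ge0// mulr_ge0 ?sqr_ge0//.
  have := ler_wpM2l S0 e2; rewrite /l.
  by move=> e3; apply: le_trans (ler_wpM2l (ler0n _ 2) e3) _ || idtac; lra.
rewrite RintegralZl//; last exact: integrable_segment.
have -> : 2048 * expR (L + 1) * S = 512 * expR (L + 1) * S * 4 by ring.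
apply: ler_wpM2l I1; apply: mulr_ge0; last exact: S0.
by apply: mulr_ge0; [exact: ler0n|exact: expR_ge0].
Qed.

End Mass.

(** * Rotation invariance and the average over a half circle *)

Section Rotation.
Context {R : realType}.
Local Notation mu := (@lebesgue_measure R).
Variables (s L : R).
Hypotheses (s1 : s ^+ 2 = 1) (L0 : 0 <= L).

Let L10 : 0 <= L + 1. Proof. by move: L0 => ?; lra. Qed.

Lemma is_derive_Kr th (x : 'rV[R]_2) i :
  is_derive x (delta_mx 0 i) (Kr s th) (Kr s th x * sg s i th).
Proof.
have E0 (z : R) : is_derive z 1 expR (expR z) by exact: is_derive_expR.
have H : is_derive x (delta_mx 0 i) (fun y : 'rV[R]_2 => \sum_j y 0 j * sg s j th) (sg s i th).
  have H : is_derive x (delta_mx 0 i) (fun y : 'rV[R]_2 => \sum_j y 0 j * sg s j th)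
     (\sum_j ((j == i)%:R * sg s j th + x 0 j * 0)).
    by apply: der_sum => j; exact: (derM (is_derive_coord x i j) (derC _ _ _)).
  apply: (is_derive_eq H); rewrite (bigD1 i)//= eqxx big1 ?addr0 => [|j /negbTE ->].
    by rewrite mulr0 addr0 mul1r.
  by rewrite mulr0 addr0 mul0r.
exact: (der_comp (E0 _) H).
Qed.

Let cK th : continuous (Kr s th). Proof. exact: (@jc_slice R R _ (Kr s) th (@jc_Kr R s)). Qed.

(* As [disc] is radial, the derivative in th of [disc * Kr] is a rotation field
   applied to it, hence has integral 0. *)
Let Bt (th : R) (x : 'rV[R]_2) :=
  disc L x * (Kr s th x * (x 0 0 * - sin th + x 0 1 * (s * cos th))).

Let jBt : jc Bt.
Proof.
have jd : jc (fun (_ : R) (x : 'rV[R]_2) => disc L x).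
  by apply: jc_snd; exact: continuous_disc.
have j0 (i : 'I_2) : jc (fun (_ : R) (x : 'rV[R]_2) => x 0 i).
  by apply: jc_snd; exact: coord_continuous.
apply: (contM jd); apply: (contM (@jc_Kr R s)).
apply: contD.
  by apply: (contM (j0 0)); apply: (jc_fst (h := fun t => - sin t)); apply: contN; exact: continuous_sin.
by apply: (contM (j0 1)); apply: (jc_fst (h := fun t => s * cos t)); apply: contZ; exact: continuous_cos.
Qed.

Let integralBt th : integralRn (Bt th) = 0.
Proof.
pose P (i j : 'I_2) (x : 'rV[R]_2) := x 0 j * (disc L x * Kr s th x).
pose P' (i j : 'I_2) (x : 'rV[R]_2) :=
  x 0 j * (disc_dx L i x * Kr s th x + disc L x * (Kr s th x * sg s i th)).
have cj (j : 'I_2) : continuous (fun x : 'rV[R]_2 => x 0 j) by exact: coord_continuous.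
have csP' i j : cs (L + 1) (P' i j).
  split.
    apply: contM; first exact: cj.
    apply: contD; first by apply: contM; [exact: continuous_disc_dx|exact: cK].
    apply: contM; first exact: continuous_disc.
    by apply: contM; [exact: cK|exact: contC].
  move=> x Lx; have d0 := (disc_cs 2 L0).2 x Lx.
  have d1 : disc_dx L i x = 0.
    exact: (csupp_partial (disc_cs 2 L0).2 Lx (is_derive_disc L i x)).
  by rewrite /P' d0 d1 !mul0r addr0 mulr0.
have I0 (i j : 'I_2) : i != j -> integralRn (P' i j) = 0.
  move=> ij; apply: (@integralRn_partial _ _ (L + 1) i (P i j)) => //.
  - split.
      apply: contM; first exact: cj.
      by apply: contM; [exact: continuous_disc|exact: cK].
    by move=> x Lx; rewrite /P (disc_cs 2 L0).2// mul0r mulr0.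
  - exact: (csP' i j).1.
  - move=> x; have H := derM (is_derive_coord x i j) (derM (is_derive_disc L i x) (is_derive_Kr th x i)).
    by apply: (is_derive_eq H); rewrite eq_sym (negbTE ij) mul0r add0r.
(* The gradient of [disc] is radial, so it drops out of the rotation field x_0 d_1 - x_1 d_0. *)
have -> : Bt th = (fun x => - s * (P' 1 0 x - P' 0 1 x)).
  apply/funext => x; rewrite /Bt /P' /disc_dx /sg /=.
  have -> : x 0 0 * - sin th = s ^+ 2 * (x 0 0 * - sin th) by rewrite s1 mul1r.
  by ring.
rewrite (integralRnZ _ (csB (csP' 1 0) (csP' 0 1))).
by rewrite (integralRnB (csP' 1 0) (csP' 0 1)) !I0// subrr mulr0.
Qed.

Definition Kmass (th : R) := integralRn (fun x => disc L x * Kr s th x).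

Let is_derive_Kmass (th : R) : is_derive th 1 Kmass 0.
Proof.
rewrite -(integralBt th).
apply: (@is_derive_integralRn _ _ (L + 1) (fun th x => disc L x * Kr s th x) Bt) => //.
  by move=> t; apply: csM; [exact: disc_cs|exact: cK].
near=> t => x; apply: derZ.
have E0 (z : R) : is_derive z 1 expR (expR z) by exact: is_derive_expR.
have H : is_derive t 1 (fun t => \sum_i x 0 i * sg s i t) (x 0 0 * - sin t + x 0 1 * (s * cos t)).
  have -> : (fun t => \sum_i x 0 i * sg s i t) = (fun t => x 0 0 * cos t + x 0 1 * (s * sin t)).
    apply/funext => u; rewrite !big_ord_recl big_ord0 addr0 /sg /=.
    by congr (_ + x _ _ * _); exact: val_inj.
  exact: (derD (derZ _ (is_derive_cos t)) (derZ _ (derZ s (is_derive_sin t)))).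
exact: (der_comp (f := fun t => \sum_i x 0 i * sg s i t) (E0 _) H).
Unshelve. all: by end_near. Qed.

Lemma Kmass_cst th : Kmass th = Kmass 0.
Proof. exact: (@is_derive_0_is_cst R Kmass th 0 is_derive_Kmass). Qed.

(* The integrals in x and th are exchanged by differentiating in the endpoint. *)
Let V (t : R) := integralRn (fun x => disc L x * psi s (-1) t (fun=> 1) x).

Let csV (t : R) : cs (L + 1) (fun x => disc L x * psi s (-1) t (fun=> 1) x).
Proof. by apply: csM; [exact: disc_cs|apply: continuous_psi => //; exact: contC]. Qed.

(** The lower endpoint -1 of the arc makes t = 0 interior, so that this holds at 0 too. *)
Let is_derive_V (t : R) : 0 <= t -> is_derive t 1 V (Kmass 0).
Proof.
move=> t0; rewrite -(Kmass_cst t).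
apply: (@is_derive_integralRn _ _ (L + 1)
  (fun t x => disc L x * psi s (-1) t (fun=> 1) x) (fun th x => disc L x * Kr s th x)) => //.
  have jd : jc (fun (_ : R) (x : 'rV[R]_2) => disc L x).
    by apply: jc_snd; exact: continuous_disc.
  exact: (contM jd (@jc_Kr R s)).
have t1 : -1 < t by lra.
have := lt_nbhsr t1; apply: filter_app; near=> u => u1 x; apply: derZ.
have cf : continuous (fun th => 1 * Kr s th x) by apply: contM; [exact: contC|exact: continuous_Kr].
have uu : u < u + 1 by rewrite ltrDl.
have [d1 d2] := @continuous_FTC1_closed R (fun th => 1 * Kr s th x) (-1) u (u + 1) uu
  (integrable_segment _ _ cf) u1 (cf u).
split => //; move: d2; rewrite derive1E mul1r; exact.
Unshelve. all: by end_near. Qed.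

(** The left side is V pi - V 0, and V has the constant derivative [Kmass 0]. *)
Lemma psi_mass : integralRn (fun x => disc L x * psi s 0 pi (fun=> 1) x) <= pi * Kmass 0.
Proof.
have -> : integralRn (fun x => disc L x * psi s 0 pi (fun=> 1) x) = V pi - V 0.
  rewrite /V -(integralRnB (csV pi) (csV 0)); congr integralRn; apply/funext => x.
  rewrite -mulrBr; congr (_ * _); rewrite /psi.
  have cf : continuous (fun th => 1 * Kr s th x) by apply: contM; [exact: contC|exact: continuous_Kr].
  rewrite (@Rintegral_itvB _ _ (BLeft (-1)) (BRight pi) 0).
  - rewrite Rintegral_itv_obnd_cbnd//; apply: integrableS (integrable_segment 0 pi cf) => //.
    by apply: subset_itv; rewrite bnd_simp.
  - exact: integrable_segment.
  - by rewrite bnd_simp; lra.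
  - by rewrite bnd_simp pi_ge0.
pose h (t : R) := Kmass 0 * t - V t.
have dh (t : R) : 0 <= t -> is_derive t 1 h (Kmass 0 * 1 - Kmass 0).
  by move=> t0; exact: (derB (derZ (Kmass 0) (is_derive_id t (1 : R))) (is_derive_V t0)).
have : h 0 <= h pi.
  apply: (@ge0_derive_le _ h (fun=> Kmass 0 * 1 - Kmass 0)); first exact: pi_ge0.
  - by move=> t /andP[t0 _]; exact: is_derive_continuous (dh t t0).
  - by move=> t /andP[t0 _]; exact/dh/ltW.
  - by move=> t _; rewrite mulr1 subrr.
have -> : h 0 = - V 0 by rewrite /h mulr0 sub0r.
rewrite -[h pi]/(Kmass 0 * pi - V pi); move: (V 0) (V pi) (Kmass 0) (@pi R) => v0 v1 k p.
lra.
Qed.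

Lemma Kmass0_le : Kmass 0 <= 2048 * expR (L + 1) * Num.sqrt (2 * (L + 1)).
Proof.
have := @disc_mass2 R L L0; apply: le_trans; rewrite le_eqVlt; apply/orP; left; apply/eqP.
congr integralRn; apply/funext => x; congr (_ * expR _).
by rewrite !big_ord_recl big_ord0 /sg /= sin0 cos0 !mulr0 mulr1 !addr0.
Qed.

End Rotation.

(** * The properties of the test function in dimensions 1 and 2 *)

Section TestWeight.
Context {R : realType}.

(** The interface between [phi] and the moment argument, which then treats both dimensions at
    once. *)
Record test_weight n (phi : 'rV[R]_n -> R) (phix : 'I_n -> 'rV[R]_n -> R)
    (phixx : 'I_n -> 'I_n -> 'rV[R]_n -> R) (C0 : R) : Prop := TestWeight {
  tw_c : continuous phi; tw_cx : forall i, continuous (phix i);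
  tw_cxx : forall i j, continuous (phixx i j);
  tw_ge0 : forall x, 0 <= phi x;
  tw_dx : forall i x, is_derive x (delta_mx 0 i) phi (phix i x);
  tw_dxx : forall i j x, is_derive x (delta_mx 0 j) (phix i) (phixx i j x);
  tw_laplace : forall x, \sum_i phixx i i x = phi x;
  (* [phi] is an average of [e^(x.sigma)], and this one of
     [(v.sigma - b)^2 e^(x.sigma)]. *)
  tw_hessian : forall x (v : 'I_n -> R) (b : R),
    0 <= \sum_i \sum_j phixx i j x * (v i * v j) - 2 * b * (\sum_i phix i x * v i)
         + b ^+ 2 * phi x;
  tw_mass : forall L, 0 <= L -> integralRn (fun x => disc L x * phi x) <=
    C0 * (1 + L) `^ ((n%:R - 1) / 2) * expR L }.

Lemma test_weight1 : exists phix phixx C0, 0 < C0 /\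
  test_weight (@phi R 1) phix phixx C0.
Proof.
pose sh (x : 'rV[R]_1) := (expR (x 0 0) - expR (- x 0 0)) / 2.
have cx : continuous (fun x : 'rV[R]_1 => x 0 0) by exact: coord_continuous.
have ce : continuous (fun x : 'rV[R]_1 => expR (x 0 0)).
  by apply: cont_comp => //; exact: continuous_expR.
have cn : continuous (fun x : 'rV[R]_1 => expR (- x 0 0)).
  by apply: cont_comp; [exact: continuous_expR|exact: contN].
have cphi : continuous (@phi R 1) by apply: contM; [exact: contD|exact: contC].
have csh : continuous sh by apply: contM; [exact: contB|exact: contC].
have E0 (z : R) : is_derive z 1 expR (expR z) by exact: is_derive_expR.
have dx0 (x : 'rV[R]_1) (i : 'I_1) : is_derive x (delta_mx 0 i) (fun y : 'rV[R]_1 => y 0 0) 1.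
  by have := is_derive_coord x i 0; rewrite ord1 eqxx.
have de (x : 'rV[R]_1) (i : 'I_1) := der_comp (f := fun y : 'rV[R]_1 => y 0 0) (E0 (x 0 0)) (dx0 x i).
have dn (x : 'rV[R]_1) (i : 'I_1) := der_comp (f := fun y : 'rV[R]_1 => - y 0 0) (E0 (- x 0 0)) (derN (dx0 x i)).
exists (fun=> sh), (fun _ _ => @phi R 1), (1024 * expR 1); split.
  by have := expR_gt0 (1 : R); lra.
split => //.
- by move=> x /=; rewrite divr_ge0// addr_ge0// expR_ge0.
- move=> i x; have H := derM (derD (de x i) (dn x i)) (derC x (delta_mx 0 i) (2^-1)).
  by apply: (is_derive_eq H); rewrite /sh; ring.
- move=> i j x; have H := derM (derB (de x j) (dn x j)) (derC x (delta_mx 0 j) (2^-1)).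
  by apply: (is_derive_eq H); rewrite /=; ring.
- by move=> x; rewrite big_ord_recl big_ord0 addr0.
- move=> x v b; rewrite !big_ord_recl !big_ord0 !addr0 /= /sh.
  set p := expR (x 0 0); set q := expR (- x 0 0); set w := v 0.
  have -> : (p + q) / 2 * (w * w) - 2 * b * ((p - q) / 2 * w) + b ^+ 2 * ((p + q) / 2) =
    1 / 2 * (p * (w - b) ^+ 2 + q * (w + b) ^+ 2) by field.
  by rewrite mulr_ge0// addr_ge0// mulr_ge0 ?sqr_ge0// expR_ge0.
- move=> L L0; rewrite subrr mul0r powRr0 mulr1 -mulrA -expRD [1 + L]addrC.
  exact: disc_mass1 L0.
Qed.

(** [P w] averages w(sigma) e^(x.sigma) over the circle. It is linear and monotone in w, and
    differentiation multiplies w by a coordinate of sigma; so [tw_laplace] comes from |sigma| = 1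
    and [tw_hessian] from a square. *)
Lemma test_weight2 : exists phix phixx C0, 0 < C0 /\
  test_weight (@phi R 2) phix phixx C0.
Proof.
have s1 : (1 : R) ^+ 2 = 1 by rewrite expr1n.
have s2 : (-1 : R) ^+ 2 = 1 by rewrite sqrrN expr1n.
pose k : R := (2%:R * omega 2)^-1.
have k0 : 0 <= k.
  rewrite invr_ge0 mulr_ge0// divr_ge0 ?powR_ge0//.
  by apply: Rintegral_ge0 => t _; rewrite mulr_ge0 ?powR_ge0// expR_ge0.
pose P (w : R -> R -> R) (x : 'rV[R]_2) := k * (psi 1 0 pi (w 1) x + psi (-1) 0 pi (w (-1)) x).
pose cw (w : R -> R -> R) := forall s, continuous (w s).
have PE w v x : w 1 =1 v 1 -> w (-1) =1 v (-1) -> P w x = P v x.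
  by move=> /funext h1 /funext h2; rewrite /P h1 h2.
have PD w v x : cw w -> cw v -> P (fun s th => w s th + v s th) x = P w x + P v x.
  move=> c1 c2; rewrite /P (psiD _ _ _ _ (c1 1) (c2 1)) (psiD _ _ _ _ (c1 (-1)) (c2 (-1))).
  by rewrite addrACA mulrDr.
have PZ a w x : cw w -> P (fun s th => a * w s th) x = a * P w x.
  move=> c1; rewrite /P (psiZ _ _ _ _ _ (c1 1)) (psiZ _ _ _ _ _ (c1 (-1))).
  by rewrite -mulrDr mulrCA.
have c0 : cw (fun _ _ => 0) by move=> s; exact: contC.
have csum (I : Type) (r : seq I) (W : I -> R -> R -> R) : (forall i, cw (W i)) ->
    cw (fun s th => \sum_(i <- r) W i s th).
  by move=> cW s; apply: cont_sum => i; exact: cW.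
have PS (I : Type) (r : seq I) (W : I -> R -> R -> R) x : (forall i, cw (W i)) ->
    P (fun s th => \sum_(i <- r) W i s th) x = \sum_(i <- r) P (W i) x.
  move=> cW; elim: r => [|i r IH].
    rewrite big_nil -[RHS](mul0r (P (fun _ _ => 0) x)) -(PZ _ _ _ c0).
    by apply: PE => th; rewrite big_nil mul0r.
  rewrite big_cons -IH -(PD _ _ _ (cW i) (csum _ r _ cW)).
  by apply: PE => th; rewrite big_cons.
have P0 w x : (forall s th, 0 <= w s th) -> 0 <= P w x.
  by move=> w0; rewrite mulr_ge0// addr_ge0//; apply: psi_ge0 => th; exact: w0.
have cP w : cw w -> continuous (P w).
  move=> c1; apply: contZ; apply: contD.
    by apply: (continuous_psi s1); exact: c1.
  by apply: (continuous_psi s2); exact: c1.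
have dP w i x : cw w -> is_derive x (delta_mx 0 i) (P w) (P (fun s th => w s th * sg s i th) x).
  move=> c1; exact: (derZ k (derD (is_derive_psi s1 0 pi x i (c1 1)) (is_derive_psi s2 0 pi x i (c1 (-1))))).
pose w0 (s th : R) : R := 1.
pose w1 i s th := w0 s th * sg s i th.
pose w2 i j s th := w1 i s th * sg s j th.
have cw0 : cw w0 by move=> s; exact: contC.
have cw1 i : cw (w1 i) by move=> s; apply: contM; [exact: cw0|exact: continuous_sg].
have cw2 i j : cw (w2 i j) by move=> s; apply: contM; [exact: cw1|exact: continuous_sg].
have phiE : @phi R 2 = P w0.
  have E s' th (i : 'I_2) : (row_mx (cos th)%:M (sin th *: const_mx s' : 'rV_1) : 'rV_(1 + 1)) 0 i = sg s' i th.
    rewrite /sg; have [->|i0] := eqVneq i 0; first exact: row_mx_0.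
    have -> : i = rshift 1 (0 : 'I_1) by apply/val_inj; case: i i0 => [[|[|m]]] //=.
    transitivity ((sin th *: const_mx s' : 'rV_1) 0 0); first exact: row_mxEr.
    by rewrite !mxE mulrC.
  apply/funext => x; rewrite /phi /P; congr (_ * _) => /=.
  have I1 := psi_integrable 1 0 pi x (cw0 1).
  have I2 := psi_integrable (-1) 0 pi x (cw0 (-1)).
  rewrite /psi -(RintegralD _ I1 I2)//.
  apply: eq_Rintegral => th _; rewrite expr0 !mul1r /Kr /dotv.
  by congr (expR _ + expR _); apply: eq_bigr => i _; rewrite E.
exists (fun i => P (w1 i)), (fun i j => P (w2 i j)),
  (* Two half circles of length pi, each with the mass bound of [Kmass0_le]; the + 1 ensures
     positivity when only k >= 0 is known. *)
  (k * (2 * pi * (2048 * expR 1 * Num.sqrt 2)) + 1); split.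
  have c1 : 0 <= 2048 :> R by lra.
  have c2 := mulr_ge0 (mulr_ge0 c1 (expR_ge0 (1 : R))) (sqrtr_ge0 (2 : R)).
  have c3 : 0 <= 2 * pi :> R by apply: mulr_ge0; [lra|exact: pi_ge0].
  exact: (ltr_wpDl (mulr_ge0 k0 (mulr_ge0 c3 c2)) ltr01).
rewrite phiE; split => //.
- exact: cP.
- by move=> i; exact: cP.
- by move=> i j; exact: cP.
- by move=> x; apply: P0.
- by move=> i x; exact: dP.
- by move=> i j x; exact: dP.
- move=> x; rewrite -PS//; apply: PE => th.
    transitivity (\sum_i sg 1 i th ^+ 2); last exact: sum_sg2.
    by apply: eq_bigr => i _; rewrite /w2 /w1 /w0 mul1r expr2.
  transitivity (\sum_i sg (-1) i th ^+ 2); last exact: sum_sg2.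
  by apply: eq_bigr => i _; rewrite /w2 /w1 /w0 mul1r expr2.
- move=> x v b.
  pose W s th := (\sum_i (\sum_j (v i * v j) * w2 i j s th)) + ((- 2 * b) * (\sum_i v i * w1 i s th) + b ^+ 2 * w0 s th).
  have cz a w : cw w -> cw (fun s th => a * w s th) by move=> c1 s; exact/contZ/c1.
  have ci i : cw (fun s th => \sum_j v i * v j * w2 i j s th).
    by apply: (csum) => j; exact: cz.
  have cv : cw (fun s th => \sum_i v i * w1 i s th) by apply: (csum) => i; exact: cz.
  have -> : \sum_i \sum_j P (w2 i j) x * (v i * v j) - 2 * b * (\sum_i P (w1 i) x * v i)
         + b ^+ 2 * P w0 x = P W x.
    rewrite /W PD; last 2 first.
    - exact: csum.
    - move=> s; apply: contD; last by apply: contZ; exact: cw0.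
      by apply: contZ; exact: cv.
    rewrite (PS _ _ _ _ ci).
    rewrite PD; last 2 first.
    - exact: cz.
    - exact: cz.
    rewrite (PZ _ _ _ cv).
    rewrite PS; last by move=> i; exact: cz.
    rewrite (PZ (b ^+ 2))// addrA; congr (_ + _ + _).
      apply: eq_bigr => i _; rewrite PS; last by move=> j; exact: cz.
      by apply: eq_bigr => j _; rewrite PZ// mulrC.
    rewrite !mulNr; congr (- (_ * _)).
    by apply: eq_bigr => i _; rewrite PZ// mulrC.
  apply: P0 => s th.
  have -> : W s th = (\sum_i v i * sg s i th - b) ^+ 2.
    rewrite /W /w2 /w1 /w0 !big_ord_recl !big_ord0; ring.
  exact: sqr_ge0.
- move=> L L0.
  have csp s (ss : s ^+ 2 = 1) : cs (L + 1) (fun x => disc L x * psi s 0 pi (w0 s) x).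
    by apply: csM; [exact: disc_cs|apply: (continuous_psi ss); exact: cw0].
  have -> : integralRn (fun x => disc L x * P w0 x) =
      k * (integralRn (fun x => disc L x * psi 1 0 pi (w0 1) x) +
           integralRn (fun x => disc L x * psi (-1) 0 pi (w0 (-1)) x)).
    rewrite -(integralRnD (csp 1 s1) (csp (-1) s2)) -(integralRnZ _ (csD (csp 1 s1) (csp (-1) s2))).
    by congr integralRn; apply/funext => x; rewrite /P -mulrDr mulrCA.
  have L1 : 0 <= 1 + L by lra.
  have b1 := le_trans (psi_mass s1 L0) (ler_wpM2l (pi_ge0 R) (Kmass0_le 1 L0)).
  have b2 := le_trans (psi_mass s2 L0) (ler_wpM2l (pi_ge0 R) (Kmass0_le (-1) L0)).
  apply: le_trans (ler_wpM2l k0 (lerD b1 b2)) _; clear b1 b2.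
  have -> : (2%:R - 1) / 2 = 2^-1 :> R by field.
  rewrite (powR12_sqrt L1).
  rewrite expRD sqrtrM// [L + 1]addrC.
  have := mulr_ge0 (sqrtr_ge0 (1 + L)) (expR_ge0 L).
  move: (expR L) (expR 1) (Num.sqrt 2) (Num.sqrt (1 + L)) (@pi R) => e e1 q q1 p.
  lra.
Qed.

End TestWeight.

(** * Moments of a flow *)

Section Moments.
Context {R : realType}.
Variable n : nat.
Variables (A g mu tau rb r c sig C0 : R).
Variables (rho rhot : R -> 'rV[R]_n -> R) (rhox : 'I_n -> R -> 'rV[R]_n -> R).
Variables (u ut : 'I_n -> R -> 'rV[R]_n -> R).
Variable ux : 'I_n -> 'I_n -> R -> 'rV[R]_n -> R.
Variables (phi : 'rV[R]_n -> R) (phix : 'I_n -> 'rV[R]_n -> R).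
Variable phixx : 'I_n -> 'I_n -> 'rV[R]_n -> R.
Hypothesis fl : flow A g mu tau rho rhot rhox u ut ux.
Hypothesis tw : test_weight phi phix phixx C0.
Hypotheses (A0 : 0 < A) (g1 : 1 < g) (rb0 : 0 < rb) (mu0 : 0 <= mu) (tau0 : 0 < tau).
Hypotheses (c0 : 0 < c) (c2 : c ^+ 2 = A * g * rb `^ (g - 1)) (r0 : 0 < r).
Hypothesis init : forall x, r < enorm x -> rest rb rho u 0 x.
Hypotheses (sig0 : 0 < sig) (sigt : sig < tau).

(** A second clamp, at sig < tau: finite speed is known strictly before tau, and up to sig all
    slices share one support radius. *)
Let cl := clamp sig.
(** The extra 1 makes room for the support of [disc (r + c * t)]. *)
Let L := r + c * sig + 1.
Let L0 : 0 <= L.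
Proof.
have := mulr_gt0 c0 sig0; rewrite /L; move: r0 => h1 h2; apply: addr_ge0 => //.
by apply: addr_ge0; exact: ltW.
Qed.

Let cl_itv t : 0 <= cl t <= sig. Proof. exact: clamp_itv (ltW sig0). Qed.

Lemma rest_at (t : R) x : 0 <= t -> t <= sig -> r + c * t < enorm x -> rest rb rho u t x.
Proof.
move=> t0 ts; apply: (finite_speed fl) => //; exact: le_lt_trans sigt.
Qed.

Let rest_cl t x : L < `|x| -> rest rb rho u (cl t) x.
Proof.
move=> Lx; have /andP[h1 h2] := cl_itv t; apply: rest_at => //.
apply: lt_le_trans (normr_le_enorm x); apply: le_lt_trans Lx.
by rewrite /L -addrA lerD2l (le_trans (ler_wpM2l (ltW c0) h2))// lerDl.
Qed.

Let rest_t (t : R) x : 0 <= t -> t <= sig -> L < `|x| -> rest rb rho u t x.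
Proof. by move=> t0 ts; have := @rest_cl t x; rewrite /cl clamp_id. Qed.

Let jcl (f : R -> 'rV[R]_n -> R) : jc f -> jc (fun t => f (cl t)).
Proof.
move=> cf z; apply: (@continuous_comp _ _ _ (fun z : R * 'rV[R]_n => (cl z.1, z.2)) (fun z => f z.1 z.2)); last exact: cf.
apply: (@continuous_pair _ _ _ (cl \o fst) snd) => y; last exact: cvg_snd.
by apply: (@continuous_comp _ _ _ fst cl); [exact: cvg_fst|exact: cont_clamp].
Qed.

Let ju j : jc (u j). Proof. exact: (flow_cu fl). Qed.
Let jut j : jc (ut j). Proof. exact: (flow_cut fl). Qed.
Let jux j i : jc (ux j i). Proof. exact: (flow_cux fl). Qed.
Let jr : jc rho := flow_c fl.
Let jrt : jc rhot := flow_ct fl.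
Let jrx i : jc (rhox i). Proof. exact: (flow_cx fl). Qed.
Let jphi : jc (fun (_ : R) => phi). Proof. exact: jc_snd (tw_c tw). Qed.
Let jphix i : jc (fun (_ : R) => phix i). Proof. by apply: jc_snd; exact: (tw_cx tw). Qed.
Let jphixx i j : jc (fun (_ : R) => phixx i j). Proof. by apply: jc_snd; exact: (tw_cxx tw). Qed.
Let g10 : 0 < g - 1. Proof. by rewrite subr_gt0. Qed.
Let g0 : 0 < g. Proof. exact: lt_trans g1. Qed.
Let jpp a : 0 < a -> jc (fun t x => pp a (rho t x)).
Proof. by move=> a0; apply: (@cont_comp _ _ (pp a) (fun z => rho z.1 z.2)) jr; exact: cont_pp. Qed.

Let fX (t : R) x := (rho t x - rb) * phi x.
Let fY (t : R) x := \sum_j rho t x * u j t x * phix j x.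
Let fYt (t : R) x := \sum_j (rhot t x * u j t x + rho t x * ut j t x) * phix j x.
(** The momentum flux contracted with the Hessian of the test function, plus what the pressure has
    beyond its linearisation at rest. *)
Let fG (t : R) x := rho t x * (\sum_j \sum_i phixx j i x * (u j t x * u i t x))
  + (A * pp g (rho t x) - A * rb `^ g) * phi x - c ^+ 2 * ((rho t x - rb) * phi x).

Let jfX : jc fX. Proof. by apply: contM; [apply: contB; [exact: jr|exact: contC]|exact: jphi]. Qed.
Let jfY : jc fY.
Proof. by apply: cont_sum => j; apply: contM; [apply: contM; [exact: jr|exact: ju]|exact: jphix]. Qed.
Let jfXt : jc (fun t x => rhot t x * phi x).
Proof. by apply: contM; [exact: jrt|exact: jphi]. Qed.
Let jfYt : jc fYt.
Proof.
apply: cont_sum => j; apply: contM; last exact: jphix.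
by apply: contD; apply: contM; [exact: jrt|exact: ju|exact: jr|exact: jut].
Qed.
Let jfG : jc fG.
Proof.
apply: contB; last by apply: contZ; exact: jfX.
apply: contD.
  apply: contM; first exact: jr.
  apply: cont_sum => j; apply: cont_sum => i; apply: contM; first exact: jphixx.
  by apply: contM; exact: ju.
apply: contM; last exact: jphi.
by apply: contB; [apply: contZ; exact: jpp|exact: contC].
Qed.

Let restX t x : rest rb rho u t x -> fX t x = 0.
Proof. by case=> h _; rewrite /fX h subrr mul0r. Qed.
Let restY t x : rest rb rho u t x -> fY t x = 0.
Proof. by case=> _ h; apply: big1 => j _; rewrite h mulr0 mul0r. Qed.
Let restG t x : rest rb rho u t x -> fG t x = 0.
Proof.
case=> h1 h2; rewrite /fG big1 => [|j _]; last by apply: big1 => i _; rewrite h2 mul0r mulr0.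
by rewrite h1 ppE ?(ltW rb0)// !subrr !mul0r !mulr0 addr0 subr0.
Qed.

Let cs_of (f : R -> 'rV[R]_n -> R) : jc f -> (forall t x, rest rb rho u t x -> f t x = 0) ->
  forall t : R, 0 <= t -> t <= sig -> cs L (f t).
Proof.
move=> cf f0 t t0 ts; split; first exact: (@jc_slice _ _ _ f).
by move=> x Lx; apply: f0; exact: rest_t.
Qed.

Let cs_cl (f : R -> 'rV[R]_n -> R) : jc f -> (forall t x, rest rb rho u t x -> f t x = 0) ->
  forall t : R, cs L (f (cl t)).
Proof. by move=> cf f0 t; have /andP[h1 h2] := cl_itv t; exact: cs_of. Qed.

Definition momX (t : R) := integralRn (fX (cl t)).
Definition momY (t : R) := integralRn (fY (cl t)).
Definition force (t : R) := integralRn (fG t).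

Lemma continuous_momX : continuous momX.
Proof.
apply: (@continuous_integralRn _ _ _ L (fun t => fX (cl t))) => //; first exact: jcl jfX.
by move=> t; exact: (cs_cl jfX restX t).2.
Qed.

Lemma continuous_momY : continuous momY.
Proof.
apply: (@continuous_integralRn _ _ _ L (fun t => fY (cl t))) => //; first exact: jcl jfY.
by move=> t; exact: (cs_cl jfY restY t).2.
Qed.

Let der_cl (f ft : R -> 'rV[R]_n -> R) (t : R) :
  jc f -> jc ft -> (forall t x, rest rb rho u t x -> f t x = 0) ->
  (forall (t : R) x, 0 < t -> t < tau -> is_derive t 1 (f ^~ x) (ft t x)) ->
  0 < t -> t < sig ->
  is_derive t 1 (fun t => integralRn (f (cl t))) (integralRn (ft t)) /\ cs L (ft t).
Proof.
move=> cf cft f0 df t0 ts.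
have E : cl t = t by rewrite /cl clamp_id// ltW.
have dcl (s : R) x : 0 < s -> s < sig -> is_derive s 1 (fun v => f (cl v) x) (ft (cl s) x).
  move=> s0 ss; rewrite [X in ft X]/cl clamp_id ?(ltW s0) ?(ltW ss)//.
  by apply: clamp_derive => //; apply: df => //; exact: lt_trans sigt.
split.
  have -> : integralRn (ft t) = integralRn (ft (cl t)) by rewrite E.
  apply: (@is_derive_integralRn _ _ L (fun t => f (cl t)) (fun t => ft (cl t))) => //.
  - by move=> s; exact: cs_cl.
  - exact: jcl.
  - have [H1 H2] := (lt_nbhsr t0, lt_nbhsl ts).
    move: H2; apply: filter_app; move: H1; apply: filter_app; near=> s => s0 ss x.
    exact: dcl.
split; first exact: (@jc_slice _ _ _ ft).
move=> x Lx; rewrite -E.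
apply: (is_derive_uniq (dcl t x t0 ts)).
have -> : (fun v => f (cl v) x) = (fun=> 0).
  by apply/funext => v; exact: (cs_cl cf f0 v).2.
exact: derC.
Unshelve. all: by end_near. Qed.

Let part0 (i : 'I_n) (F F' : 'rV[R]_n -> R) : cs L F -> continuous F' ->
  (forall x, is_derive x (delta_mx 0 i) F (F' x)) -> integralRn F' = 0 /\ cs L F'.
Proof.
move=> csF cF' dF; split; first exact: (integralRn_partial L0 csF cF' dF).
by split => // x Lx; exact: (csupp_partial csF.2 Lx (dF x)).
Qed.

Lemma is_derive_momX (t : R) : 0 < t -> t < sig -> is_derive t 1 momX (momY t).
Proof.
move=> t0 ts.
have dX : forall (t : R) x, 0 < t -> t < tau -> is_derive t 1 (fX ^~ x) (rhot t x * phi x).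
  move=> s x s0 st; have H := derM (derB (flow_dt fl x s0 st) (derC s 1 rb)) (derC s 1 (phi x)).
  by apply: (is_derive_eq H); rewrite subr0 mulr0 addr0.
have [d1 cs1] := der_cl jfX jfXt restX dX t0 ts.
apply: (is_derive_eq d1); rewrite /momY.
have -> : cl t = t by rewrite /cl clamp_id// ltW.
have csY : cs L (fY t) by apply: (cs_of jfY restY); exact: ltW.
pose Q' (i : 'I_n) x := (rhox i t x * u i t x + rho t x * ux i i t x) * phi x +
  rho t x * u i t x * phix i x.
have HQ i : integralRn (Q' i) = 0 /\ cs L (Q' i).
  apply: (part0 (F := fun x => rho t x * u i t x * phi x)).
  - apply: (cs_of (f := fun t x => rho t x * u i t x * phi x)); rewrite ?(ltW t0) ?(ltW ts)//.
      by apply: contM; [apply: contM; [exact: jr|exact: ju]|exact: jphi].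
    by move=> s x [_ h]; rewrite h mulr0 mul0r.
  - apply: (@jc_slice _ _ _ (fun t x => (rhox i t x * u i t x + rho t x * ux i i t x) * phi x +
      rho t x * u i t x * phix i x)).
    apply: contD; apply: contM.
    + by apply: contD; apply: contM; [exact: jrx|exact: ju|exact: jr|exact: jux].
    + exact: jphi.
    + by apply: contM; [exact: jr|exact: ju].
    + exact: jphix.
  - move=> x; exact: (derM (derM (flow_dx fl t x i) (flow_dux fl t x i i)) (tw_dx tw i x)).
have csQ i := (HQ i).2.
have S0 : \sum_i integralRn (Q' i) = 0 by apply: big1 => i _; exact: (HQ i).1.
rewrite -[LHS]addr0 -[X in _ + X]S0.
rewrite -(integralRn_sum _ csQ) -(integralRnD cs1 (cs_sum _ csQ)).
congr integralRn; apply/funext => x; rewrite /Q' big_split /= -mulr_suml addrA -mulrDl.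
by rewrite (flow_mass fl)// ?mul0r ?add0r//; exact: lt_trans sigt.
Qed.

(** The momentum equation is tested with d_j phi, after adding the vanishing integrals of d_i (rho
    u_j u_i d_j phi) and d_j (P d_j phi), where P is the excess pressure. Since Delta phi = phi, the
    latter sum to P phi, whose linear part gives c^2 X. *)
Lemma is_derive_momY (t : R) : 0 < t -> t < sig ->
  is_derive t 1 momY (force t + c ^+ 2 * momX t - mu / (1 + t) * momY t).
Proof.
move=> t0 ts; have tt : t < tau by exact: lt_trans sigt.
have dY : forall (t : R) x, 0 < t -> t < tau -> is_derive t 1 (fY ^~ x) (fYt t x).
  move=> s x s0 st; apply: der_sum => j.
  have H := derM (derM (flow_dt fl x s0 st) (flow_dut fl x j s0 st)) (derC s 1 (phix j x)).
  by apply: (is_derive_eq H); rewrite mulr0 addr0.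
have [d1 cs1] := der_cl jfY jfYt restY dY t0 ts.
apply: (is_derive_eq d1); rewrite /momY /momX /force.
have -> : cl t = t by rewrite /cl clamp_id// ltW.
have csX : cs L (fX t) by apply: (cs_of jfX restX); exact: ltW.
have csY : cs L (fY t) by apply: (cs_of jfY restY); exact: ltW.
have csG : cs L (fG t) by apply: (cs_of jfG restG); exact: ltW.
pose Q' (j i : 'I_n) x :=
  ((rhox i t x * u j t x + rho t x * ux j i t x) * u i t x
              + rho t x * u j t x * ux i i t x) * phix j x +
  rho t x * u j t x * u i t x * phixx j i x.
have HQ j i : integralRn (Q' j i) = 0 /\ cs L (Q' j i).
  apply: (part0 (i := i) (F := fun x => rho t x * u j t x * u i t x * phix j x)).
  - apply: (cs_of (f := fun t x => rho t x * u j t x * u i t x * phix j x)); rewrite ?(ltW t0) ?(ltW ts)//.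
      by apply: contM; [apply: contM; [apply: contM; [exact: jr|exact: ju]|exact: ju]|exact: jphix].
    by move=> s x [_ h]; rewrite h mulr0 !mul0r.
  - apply: (@jc_slice _ _ _ (fun t x => ((rhox i t x * u j t x + rho t x * ux j i t x) * u i t x
              + rho t x * u j t x * ux i i t x) * phix j x +
      rho t x * u j t x * u i t x * phixx j i x)).
    apply: contD; apply: contM.
    + apply: contD; apply: contM.
      * by apply: contD; apply: contM; [exact: jrx|exact: ju|exact: jr|exact: jux].
      * exact: ju.
      * by apply: contM; [exact: jr|exact: ju].
      * exact: jux.
    + exact: jphix.
    + by apply: contM; [apply: contM; [exact: jr|exact: ju]|exact: ju].
    + exact: jphixx.
  - move=> x; exact: (derM (derM (derM (flow_dx fl t x i) (flow_dux fl t x j i)) (flow_dux fl t x i i)) (tw_dxx tw j i x)).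
pose P' (j : 'I_n) x := A * (g * pp (g - 1) (rho t x) * rhox j t x) * phix j x +
  (A * pp g (rho t x) - A * rb `^ g) * phixx j j x.
have HP j : integralRn (P' j) = 0 /\ cs L (P' j).
  apply: (part0 (i := j) (F := fun x => (A * pp g (rho t x) - A * rb `^ g) * phix j x)).
  - apply: (cs_of (f := fun t x => (A * pp g (rho t x) - A * rb `^ g) * phix j x)); rewrite ?(ltW t0) ?(ltW ts)//.
      by apply: contM; [apply: contB; [apply: contZ; exact: jpp|exact: contC]|exact: jphix].
    by move=> s x [h _]; rewrite h ppE ?(ltW rb0)// subrr mul0r.
  - apply: (@jc_slice _ _ _ (fun t x => A * (g * pp (g - 1) (rho t x) * rhox j t x) * phix j x +
      (A * pp g (rho t x) - A * rb `^ g) * phixx j j x)).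
    apply: contD; apply: contM.
    + by apply: contZ; apply: contM; [apply: contZ; exact: jpp|exact: jrx].
    + exact: jphix.
    + by apply: contB; [apply: contZ; exact: jpp|exact: contC].
    + exact: jphixx.
  - move=> x; have H := derM (derB (derZ A (der_comp (f := rho t) (der_pp _ g1) (flow_dx fl t x j)))
      (derC x (delta_mx 0 j) (A * rb `^ g))) (tw_dxx tw j j x).
    by apply: (is_derive_eq H); rewrite subr0.
pose S' (j : 'I_n) x := \sum_i Q' j i x + P' j x.
have csS j : cs L (S' j).
  by apply: csD; [apply: cs_sum => i; exact: (HQ j i).2|exact: (HP j).2].
have IS j : integralRn (S' j) = 0.
  rewrite (integralRnD (cs_sum _ (fun i => (HQ j i).2)) (HP j).2) (HP j).1 addr0.
  rewrite (integralRn_sum _ (fun i => (HQ j i).2)); apply: big1 => i _; exact: (HQ j i).1.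
have S0 : \sum_j integralRn (S' j) = 0 by apply: big1 => j _; exact: IS.
rewrite -[LHS]addr0 -[X in _ + X]S0.
rewrite -(integralRn_sum _ csS) -(integralRnD cs1 (cs_sum _ csS)).
rewrite -(integralRnZ _ csX) -(integralRnZ (mu / (1 + t)) csY) -(integralRnD csG (csZ _ csX)).
rewrite -(integralRnB (csD csG (csZ _ csX)) (csZ _ csY)).
congr integralRn; apply/funext => x.
have M j := flow_momentum fl x j t0 tt.
have t1 : 1 + t != 0 by rewrite gt_eqF//; move: t0 => ?; lra.
have -> : fG t x + c ^+ 2 * fX t x - mu / (1 + t) * fY t x =
  \sum_j (rho t x * (\sum_i phixx j i x * (u j t x * u i t x)) +
     (A * pp g (rho t x) - A * rb `^ g) * phixx j j x -
     mu / (1 + t) * (rho t x * u j t x * phix j x)).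
  rewrite /fG /fX /fY sumrB big_split /= -!mulr_sumr (tw_laplace tw); ring.
rewrite /fYt -big_split /=; apply: eq_bigr => j _.
rewrite /S' /Q' /P' big_split /= -mulr_suml.
set Z := \sum_i (_ + _ * ux i i t x) in M *.
have -> : \sum_i rho t x * u j t x * u i t x * phixx j i x =
  rho t x * (\sum_i phixx j i x * (u j t x * u i t x)).
  by rewrite mulr_sumr; apply: eq_bigr => i _; ring.
have := M j; rewrite -/Z => Mj.
have -> : rhot t x * u j t x + rho t x * ut j t x = - (Z +
   A * (g * pp (g - 1) (rho t x) * rhox j t x) + mu * (rho t x * u j t x) / (1 + t)).
  by apply/eqP; rewrite -addr_eq0 -Mj; apply/eqP; ring.
by field.
Qed.

(* Jensen's inequality, by comparison with the tangents at the mean velocity b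
   and the mean excess density s. *)
Lemma force_ge (t Phi : R) : 0 < t -> t < sig -> 0 < Phi ->
  integralRn (fun x => disc (r + c * t) x * phi x) <= Phi ->
  0 <= momX t -> 0 <= momY t ->
  Phi * ((momY t / Phi) ^+ 2 / (rb + momX t / Phi) +
     (A * (rb + momX t / Phi) `^ g - A * rb `^ g - A * g * rb `^ (g - 1) * (momX t / Phi)))
  <= force t.
Proof.
move=> t0 ts Phi0 dP X0 Y0.
have E : cl t = t by rewrite /cl clamp_id// ltW.
have csX : cs L (fX t) by apply: (cs_of jfX restX); exact: ltW.
have csY : cs L (fY t) by apply: (cs_of jfY restY); exact: ltW.
have csG : cs L (fG t) by apply: (cs_of jfG restG); exact: ltW.
have Lt0 : 0 <= r + c * t by rewrite addr_ge0 ?mulr_ge0// ltW.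
have csd : cs L (fun x => disc (r + c * t) x * phi x).
  apply: csM; last exact: (tw_c tw).
  apply: (csW _ (disc_cs n Lt0)); rewrite /L lerD2r lerD2l ler_pM2l//; exact: ltW.
set X := momX t in X0 *; set Y := momY t in Y0 *.
have XE : X = integralRn (fX t) by rewrite /X /momX E.
have YE : Y = integralRn (fY t) by rewrite /Y /momY E.
pose s := X / Phi; have s0 : 0 <= s by rewrite divr_ge0// ltW.
have rs : 0 < rb + s by rewrite ltr_pwDl.
(* Mean momentum over mean density; this b maximises the lower bound 2 b Y - b^2 (X + rb Phi) for
   the kinetic part. *)
pose b := Y / Phi / (rb + s).
pose p' := A * g * (rb + s) `^ (g - 1) - c ^+ 2.
pose q := s * p' - (A * (rb + s) `^ g - A * rb `^ g - c ^+ 2 * s).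
have tan (z : R) : 0 <= z -> p' * (z - rb) - q <= A * z `^ g - A * rb `^ g - c ^+ 2 * (z - rb).
  move=> z0; have H := powR_tangent z0 rs g1.
  have := ler_wpM2l (ltW A0) H.
  move=> H2; rewrite /q /p' -subr_ge0.
  have -> : A * z `^ g - A * rb `^ g - c ^+ 2 * (z - rb) -
    ((A * g * (rb + s) `^ (g - 1) - c ^+ 2) * (z - rb) -
     (s * (A * g * (rb + s) `^ (g - 1) - c ^+ 2) - (A * (rb + s) `^ g - A * rb `^ g - c ^+ 2 * s))) =
    A * z `^ g - A * ((rb + s) `^ g + g * (rb + s) `^ (g - 1) * (z - (rb + s))) by ring.
  by rewrite subr_ge0.
(* The tangent has the value - q at rest. This sign, like that of - b^2 rb, lets the constant terms
   be extended from the support to [disc], which only lowers the bound. *)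
have q0 : 0 <= q.
  by have := tan rb (ltW rb0); rewrite !subrr !mulr0 subrr sub0r oppr_le0.
pose F x := 2 * b * fY t x - b ^+ 2 * fX t x + p' * fX t x -
  (b ^+ 2 * rb + q) * (disc (r + c * t) x * phi x).
have csF : cs L F.
  by apply: csB; [apply: csD; [apply: csB|]|]; exact: csZ.
have IF : integralRn F = 2 * b * Y - b ^+ 2 * X + p' * X -
    (b ^+ 2 * rb + q) * integralRn (fun x => disc (r + c * t) x * phi x).
  rewrite (integralRnB (csD (csB (csZ _ csY) (csZ _ csX)) (csZ _ csX)) (csZ _ csd)).
  rewrite (integralRnD (csB (csZ _ csY) (csZ _ csX)) (csZ _ csX)).
  rewrite (integralRnB (csZ _ csY) (csZ _ csX)).
  by rewrite (integralRnZ _ csY) !(integralRnZ _ csX) (integralRnZ _ csd) XE YE.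
have FG : integralRn F <= force t.
  apply: (le_integralRn csF csG) => x.
  have ph0 := tw_ge0 tw x.
  have b2 : 0 <= b ^+ 2 * rb + q by rewrite addr_ge0// mulr_ge0 ?sqr_ge0// ltW.
  have [xL|xL] := leP (enorm x) (r + c * t); last first.
    have rx : rest rb rho u t x by apply: rest_at => //; exact: ltW.
    rewrite /F restX// restY// restG// !mulr0 subr0 addr0 sub0r oppr_le0.
    by rewrite mulr_ge0// mulr_ge0// disc_ge0.
  have d1 := disc_ge1 Lt0 xL.
  have rho0 := flow_ge0 fl t x.
  have H := tw_hessian tw x (fun i => u i t x) b.
  have T := tan _ rho0.
  have d2 : phi x <= disc (r + c * t) x * phi x by rewrite ler_peMl.
  have d3 := ler_wpM2l b2 d2.
  have T2 := ler_wpM2r ph0 T.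
  have H2 := mulr_ge0 rho0 H.
  have fYE : fY t x = rho t x * (\sum_i phix i x * u i t x).
    by rewrite mulr_sumr; apply: eq_bigr => i _; ring.
  rewrite /F fYE /fG /fX ppE//.
  move: H2 T2 d3; set U := \sum_j \sum_i _; set V := \sum_i _; set ph := phi x.
  set dd := disc _ _ * ph; set rr := rho t x; move: (rr `^ g) => pg H2 T2 d3.
  lra.
apply: le_trans FG; rewrite IF.
have I0 : (b ^+ 2 * rb + q) * integralRn (fun x => disc (r + c * t) x * phi x) <=
   (b ^+ 2 * rb + q) * Phi.
  by rewrite ler_wpM2l// addr_ge0// mulr_ge0 ?sqr_ge0// ltW.
have Xs : X = Phi * s by rewrite /s mulrCA divff ?mulr1// gt_eqF.
have Yb : Y = Phi * (b * (rb + s)) by rewrite /b divfK ?gt_eqF// mulrCA divff ?mulr1// gt_eqF.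
apply: le_trans (lerB (lexx _) I0); rewrite le_eqVlt; apply/orP; left; apply/eqP.
rewrite -/s -c2 /q Yb Xs.
have -> : Phi * (b * (rb + s)) / Phi = b * (rb + s) by field; rewrite gt_eqF.
by field; rewrite gt_eqF.
Qed.

End Moments.

(** * Growth of the moments and lifespan *)

Section Growth.
Context {R : realType}.
Implicit Types t s : R.

(** N (f / N)^e = f^e N^(1-e) does not increase with N for e >= 1. *)
Lemma scaled_min_anti (p N1 N2 f : R) : 1 < p -> 0 < N1 -> N1 <= N2 -> 0 <= f ->
  N2 * Num.min ((f / N2) ^+ 2) ((f / N2) `^ p) <=
  N1 * Num.min ((f / N1) ^+ 2) ((f / N1) `^ p).
Proof.
move=> p1 N10 N12 f0; have N20 : 0 < N2 by exact: lt_le_trans N12.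
have H2 : N2 * (f / N2) ^+ 2 <= N1 * (f / N1) ^+ 2.
  have E N : 0 < N -> N * (f / N) ^+ 2 = f ^+ 2 / N by move=> N0; field; rewrite gt_eqF.
  by rewrite !E// ler_wpM2l ?sqr_ge0// lef_pV2.
have Hp : N2 * (f / N2) `^ p <= N1 * (f / N1) `^ p.
  have E N : 0 < N -> N * (f / N) `^ p = f `^ p * N `^ (1 - p).
    move=> N0; rewrite powRM ?invr_ge0 ?(ltW N0)// -(powR_inv1 (ltW N0)) -powRrM mulN1r mulrCA.
    by rewrite powRD ?(gt_eqF N0) ?implybT// powRr1// ltW.
  rewrite !E// ler_wpM2l ?powR_ge0// -(opprB p 1) !powRN lef_pV2 ?posrE ?powR_gt0//.
  by apply: ge0_ler_powR; rewrite ?nnegrE ?(ltW N10) ?(ltW N20)//; lra.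
rewrite !minr_pMr ?(ltW N10) ?(ltW N20)// le_min !ge_min H2 /=.
by rewrite Hp orbT.
Qed.

Lemma der_add1 t : is_derive t 1 (fun s => 1 + s) (1 : R).
Proof. by have H := derD (derC t 1 1) (is_derive_id t 1); apply: (is_derive_eq H); rewrite add0r. Qed.

Lemma der_powR_add1 (a t : R) : 0 <= t -> is_derive t 1 (fun s => (1 + s) `^ a) (a * (1 + t) `^ (a - 1)).
Proof.
move=> t0; have t1 : 0 < 1 + t by lra.
by have H := der_powR a t1 (der_add1 t); apply: (is_derive_eq H); rewrite mulr1.
Qed.

Variables (c mu b K C1 d p sig : R) (X Y G : R -> R).
Hypotheses (c0 : 0 < c) (mu0 : 0 <= mu) (b0 : 0 <= b) (ab1 : b + mu / 2 <= 1).
Hypotheses (KE : K = c + mu / 2) (C10 : 0 < C1) (d0 : 0 < d) (p1 : 1 < p) (p2 : p <= 2).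
Hypotheses (sig0 : 0 < sig) (cX : continuous X) (cY : continuous Y).
Hypothesis dX : forall t, 0 < t -> t < sig -> is_derive t 1 X (Y t).
Hypothesis dY : forall t, 0 < t -> t < sig ->
  is_derive t 1 Y (G t + c ^+ 2 * X t - mu / (1 + t) * Y t).
Let Phi t := C1 * (expR (c * t) * (1 + t) `^ b).
Hypothesis GE : forall t k, 0 < t -> t < sig -> 0 <= X t -> 0 <= Y t -> 0 <= k <= K ->
  Phi t * (d * Num.min (((Y t + k * X t) / Phi t) ^+ 2) (((Y t + k * X t) / Phi t) `^ p)) <= G t.
Hypotheses (X0 : 0 < X 0) (Y0 : 0 < Y 0).

Let Phi0 t : 0 <= t -> 0 < Phi t.
Proof.
move=> t0; have t1 : 0 < 1 + t by lra.
by rewrite mulr_gt0// mulr_gt0 ?expR_gt0 ?powR_gt0.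
Qed.

Let G0 t : 0 < t -> t < sig -> 0 <= X t -> 0 <= Y t -> 0 <= G t.
Proof.
move=> t0 ts X0' Y0'; apply: le_trans (GE (k := 0) t0 ts X0' Y0' _); last first.
  by rewrite lexx KE /= addr_ge0 ?divr_ge0// ltW.
have P := Phi0 (ltW t0).
rewrite mulr_ge0 ?(ltW P)// mulr_ge0 ?(ltW d0)// le_min sqr_ge0 powR_ge0//.
Qed.

(** The integrating factor of the damping, which leaves W' = (1 + t)^mu (G + c^2 X). *)
Let W t := (1 + t) `^ mu * Y t.

Let cW t : 0 <= t -> {for t, continuous W}.
Proof.
move=> t0; apply: continuousM; last exact: cY.
exact: is_derive_continuous (der_powR_add1 mu t0).
Qed.

Let dW t : 0 < t -> t < sig -> is_derive t 1 W ((1 + t) `^ mu * (G t + c ^+ 2 * X t)).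
Proof.
move=> t0 ts; have H := derM (der_powR_add1 mu (ltW t0)) (dY t0 ts).
have t1 : 0 < 1 + t by lra.
apply: (is_derive_eq H); rewrite powRB ?(gt_eqF t1) ?implybT// powRr1 ?(ltW t1)//.
by field; rewrite gt_eqF.
Qed.

Let mono t0 t1 : 0 <= t0 -> t0 <= t1 -> t1 < sig ->
  (forall t, t0 < t -> t < t1 -> 0 <= X t /\ 0 <= Y t) -> X t0 <= X t1 /\ W t0 <= W t1.
Proof.
move=> t00 t01 t1s H; split.
  apply: (@ge0_derive_le _ X Y) => // [t _|t /andP[h1 h2]|t /andP[h1 h2]]; first exact: cX.
    by apply: dX; [exact: le_lt_trans h1|exact: lt_trans t1s].
  by have [] := H t h1 h2.
apply: (@ge0_derive_le _ W _ _ _ t01) => [t /andP[h1 _]|t /andP[h1 h2]|t /andP[h1 h2]].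
- by apply: cW; exact: le_trans h1.
- by apply: dW; [exact: le_lt_trans h1|exact: lt_trans t1s].
have [HX HY] := H t h1 h2.
have h3 : 0 < t by exact: le_lt_trans h1.
have G0' := G0 h3 (lt_trans h2 t1s) HX HY.
by rewrite mulr_ge0 ?powR_ge0// addr_ge0// mulr_ge0// sqr_ge0.
Qed.

Let W_gt0 t : 0 <= t -> Y 0 <= W t -> 0 < Y t.
Proof.
move=> t0 H; have t1 : 0 < 1 + t by lra.
by have := lt_le_trans Y0 H; rewrite /W pmulr_rgt0 ?powR_gt0.
Qed.

(** Bootstrap: while X and Y are positive, G >= 0, so X and W increase; hence X and Y stay
    positive. *)
Lemma moments_increase t : 0 <= t -> t < sig -> X 0 <= X t /\ Y 0 <= W t.
Proof.
have W0 : W 0 = Y 0 by rewrite /W addr0 powR1 mul1r.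
move: t; apply: real_induction => [t t0 ts H|t t0 ts [HX HW]].
  rewrite -W0; apply: (mono (lexx 0) t0 ts) => s s0 st.
  have [h1 h2] := H s (ltW s0) st.
  by split; [exact: le_trans (ltW X0) h1|exact: ltW (W_gt0 (ltW s0) h2)].
have Xt := lt_le_trans X0 HX; have Yt := W_gt0 t0 HW.
have cXt : X x @[x --> t] --> X t by exact: cX.
have cYt : Y x @[x --> t] --> Y t by exact: cY.
have [e /= e0 P] : nbhs t [set s | 0 < X s /\ 0 < Y s].
  by apply: filterI; [exact: (cvgr_gt _ cXt _ Xt)|exact: (cvgr_gt _ cYt _ Yt)].
exists e => // s ts' se ss.
have [HX2 HW2] : X t <= X s /\ W t <= W s.
  apply: mono => // [|v tv vs]; first exact: ltW.
  have [] : 0 < X v /\ 0 < Y v.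
    by apply: P; rewrite /ball_ /= distrC gtr0_norm ?subr_gt0// ltrBlDl (lt_trans vs).
  by move=> /ltW h1 /ltW h2.
by split; [exact: le_trans HX2|exact: le_trans HW2].
Qed.

Let beta := mu / 2.
(* The shift k makes the coefficient of X in D nonnegative ([bracket]) and changes
   the growth of E only by a bounded factor. *)
Let k := (2 * c)^-1.
Let q t := 1 + t + k.
Let kap t := c + beta / q t.
Let E t := expR (- (c * t)) * ((1 + t) `^ mu * q t `^ (- beta)).
Let F t := (Y t + kap t * X t) * E t.
Let D t := E t * (G t + X t * (c ^+ 2 - beta / q t ^+ 2 - kap t ^+ 2 + mu / (1 + t) * kap t)).

Let k0 : 0 < k. Proof. by rewrite invr_gt0 mulr_gt0. Qed.
Let beta0 : 0 <= beta. Proof. by rewrite divr_ge0. Qed.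
Let q0 t : 0 <= t -> 0 < q t.
Proof. by move=> t0; rewrite /q; move: k0 => ?; lra. Qed.
Let E0 t : 0 <= t -> 0 < E t.
Proof.
move=> t0; have t1 : 0 < 1 + t by lra.
by rewrite mulr_gt0 ?expR_gt0// mulr_gt0 ?powR_gt0// q0.
Qed.

Let dq t : is_derive t 1 q (1 : R).
Proof. by have H := derD (der_add1 t) (derC t 1 k); apply: (is_derive_eq H); rewrite addr0. Qed.

Let dkap t : 0 <= t -> is_derive t 1 kap (- (beta / q t ^+ 2)).
Proof.
move=> t0; have q1 : q t != 0 by rewrite gt_eqF// q0.
have H := derD (derC t 1 c) (derZ beta (derV q1 (dq t))).
by apply: (is_derive_eq H); rewrite add0r mulrN mul1r.
Qed.

Let dE t : 0 <= t -> is_derive t 1 E (- (E t * (kap t - mu / (1 + t)))).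
Proof.
move=> t0; have q1 := q0 t0; have t1 : 0 < 1 + t by lra.
have He := der_comp (h := expR) (f := fun s => - (c * s)) (is_derive_expR _) (derN (derZ c (is_derive_id t 1))).
have H := derM He (derM (der_powR_add1 mu t0) (der_powR (- beta) q1 (dq t))).
apply: (is_derive_eq H); rewrite /E /kap.
rewrite !powRB ?(gt_eqF t1) ?(gt_eqF q1) ?implybT// !powRr1 ?(ltW t1) ?(ltW q1)//.
by field; rewrite !gt_eqF.
Qed.

Let cF t : 0 <= t -> {for t, continuous F}.
Proof.
move=> t0; apply: continuousM; last exact: is_derive_continuous (dE t0).
apply: continuousD; first exact: cY.
by apply: continuousM; [exact: is_derive_continuous (dkap t0)|exact: cX].
Qed.

Let dF t : 0 < t -> t < sig -> is_derive t 1 F (D t).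
Proof.
move=> t0 ts; have t0' := ltW t0; have q1 := q0 t0'; have t1 : 0 < 1 + t by lra.
have H := derM (derD (dY t0 ts) (derM (dkap t0') (dX t0 ts))) (dE t0').
apply: (is_derive_eq H); rewrite /D; ring.
Qed.

(** The choice k = 1 / (2 c) gives 2 c (1 / (1 + t) - 1 / q) = 1 / ((1 + t) q), which offsets the
    term - beta / q^2. *)
Let bracket t : 0 <= t ->
  0 <= c ^+ 2 - beta / q t ^+ 2 - kap t ^+ 2 + mu / (1 + t) * kap t.
Proof.
move=> t0; have q1 := q0 t0; have t1 : 0 < 1 + t by lra.
have qE : q t = 1 + t + k by [].
have -> : c ^+ 2 - beta / q t ^+ 2 - kap t ^+ 2 + mu / (1 + t) * kap t =
  (beta + 2 * beta ^+ 2) * (1 / (1 + t) - 1 / q t) / q t + beta ^+ 2 / q t ^+ 2.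
  rewrite /kap /beta qE /k; field; apply/and3P; split; rewrite gt_eqF//.
  by move: c0 => ?; have := mulr_ge0 (ltW c0) t0 => ?; lra.
have h1 : 0 <= 1 / (1 + t) - 1 / q t.
  by rewrite subr_ge0 !div1r lef_pV2 ?posrE// qE lerDl ltW.
have h2 : 0 <= beta + 2 * beta ^+ 2.
  by apply: addr_ge0 => //; apply: mulr_ge0 => //; exact: sqr_ge0.
apply: addr_ge0; apply: divr_ge0; [exact: mulr_ge0|exact: ltW|exact: sqr_ge0|exact: sqr_ge0].
Qed.

(** The exponentials cancel, and q >= 1 + t leaves the exponent b + mu - beta = b + beta. *)
Let PhiE t : 0 <= t -> Phi t * E t <= C1 * (1 + t) `^ (b + beta).
Proof.
move=> t0; have q1 := q0 t0; have t1 : 0 < 1 + t by lra.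
have -> : Phi t * E t = C1 * ((1 + t) `^ b * ((1 + t) `^ mu * q t `^ (- beta))).
  have ee : expR (c * t) * expR (- (c * t)) = 1 by rewrite -expRD subrr expR0.
  by rewrite -[RHS]mul1r -{1}ee /Phi /E; ring.
rewrite ler_pM2l// powRD ?(gt_eqF t1) ?implybT// ler_pM2l ?powR_gt0//.
have -> : mu = beta + beta by rewrite /beta; field.
rewrite powRD ?(gt_eqF t1) ?implybT// -mulrA ler_piMr ?powR_ge0//.
rewrite powRN ler_pdivrMr ?powR_gt0// mul1r.
apply: ge0_ler_powR; rewrite ?nnegrE ?(ltW t1) ?(ltW q1)//.
by rewrite /q lerDl ltW.
Qed.

Lemma growth_bound (A : R -> R) th ts :
  (forall t, 0 <= t -> is_derive t 1 A ((1 + t) `^ (- (b + mu / 2)))) ->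
  0 <= ts -> ts <= th -> 4 / ((p - 1) * d) < 1 + ts -> 2 * (1 + th) <= 1 + sig ->
  A th - A ts <= C1 / (d * (Y 0 * (1 + k) `^ (- beta))).
Proof.
move=> dA; apply: (ode_bound (f := fun t => F (clamp sig t)) (f' := D)) => //.
- by rewrite addr_ge0.
- by rewrite mulr_gt0// powR_gt0// ltr_pwDl// ltW.
- move=> t; apply: continuous_comp; first exact: cont_clamp.
  by apply: cF; case/andP: (clamp_itv t (ltW sig0)).
(* [clamp_derive] concerns functions of time and space; here the space variable is a dummy in
   dimension 0. *)
- move=> t /andP[t0 ts']; exact: (clamp_derive (f := fun s (_ : 'rV[R]_0) => F s) (x := 0) t0 ts' (dF t0 ts')).
- move=> t /andP[t0 ts'] /=; rewrite clamp_id ?(ltW t0) ?(ltW ts')//.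
  have t0' := ltW t0; have q1 := q0 t0'; have t1 : 0 < 1 + t by lra.
  have [HX HW] := moments_increase t0' ts'.
  have Xt : 0 <= X t by exact: le_trans (ltW X0) HX.
  have Yt : 0 <= Y t := ltW (W_gt0 t0' HW).
  have kt : 0 <= kap t <= K.
    have kq : 0 <= beta / q t <= beta.
      rewrite divr_ge0 ?(ltW q1)//= ler_pdivrMr// ler_peMr// /q.
      by move: k0 => ?; lra.
    by rewrite KE -/beta /kap; move: c0 => ?; lra.
  have P0 := Phi0 t0'; have E0' := E0 t0'.
  have Z0 : 0 <= Y t + kap t * X t.
    by rewrite addr_ge0// mulr_ge0//; case/andP: kt.
  have F0 : 0 <= F t by rewrite mulr_ge0// ltW.
  (* Replaces the weight [Phi t * E t] by its explicit majorant. *)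
  have H1 := scaled_min_anti p1 (mulr_gt0 P0 E0') (PhiE t0') F0.
  apply: le_trans (ler_wpM2l (ltW d0) H1) _.
  have -> : F t / (Phi t * E t) = (Y t + kap t * X t) / Phi t.
    by rewrite /F; field; rewrite !gt_eqF.
  have H2 := GE t0 ts' Xt Yt kt.
  apply: (@le_trans _ _ (E t * G t)).
    apply: le_trans (ler_wpM2l (ltW E0') H2).
    by rewrite le_eqVlt; apply/orP; left; apply/eqP; ring.
  by rewrite /D ler_pM2l// lerDl mulr_ge0// bracket.
- rewrite /= clamp_id ?(ltW sig0)// /F /E mulr0 oppr0 expR0 mul1r /q addr0 powR1 mul1r.
  rewrite ler_pM2r ?powR_gt0 ?ltr_pwDl// ?(ltW k0)//.
  rewrite lerDl mulr_ge0 ?(ltW X0)// /kap addr_ge0 ?(ltW c0)// divr_ge0// ltW// q0//.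
Qed.

End Growth.

Section TimeBound.
Context {R : realType}.

(** The threshold s0 is independent of eps. If th stays below it, sig is bounded by a constant,
    which eps <= 1 keeps below both right-hand sides. Otherwise the hypothesis is used on [s0, th]
    with the primitive (1 + t)^(1-a) / (1 - a) or ln (1 + t). *)
Lemma time_bound (a s0 B : R) : 0 <= a -> a <= 1 -> 0 < s0 -> 0 < B ->
  exists2 C, 0 < C & forall eps sig : R, 0 < eps <= 1 -> 0 < sig ->
    (forall (A : R -> R) (th ts : R),
       (forall t : R, 0 <= t -> is_derive t 1 A ((1 + t) `^ (- a))) ->
       0 <= ts -> ts <= th -> s0 < 1 + ts -> 2 * (1 + th) <= 1 + sig ->
       A th - A ts <= B / eps) ->
    (a < 1 -> sig <= C * eps `^ (- (1 - a)^-1)) /\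
    (a = 1 -> sig <= expR (C * eps^-1)).
Proof.
move=> a0 a1 s00 B0; pose s1 := 1 + s0.
pose C' := (1 - a) * B + s1 `^ (1 - a).
pose q := (1 - a)^-1.
have s10 : 0 < s1 by rewrite addr_gt0.
have C0 : 0 <= 2 * C' `^ q by rewrite mulr_ge0// powR_ge0.
have s1E : s1 = 1 + s0 by [].
(* One constant for all cases: D serves the power bound, B + s1 + 1 the exponential one, and 2 s1
   the case th < s0. At a = 1 the convention 0^-1 = 0 keeps D a fixed number. *)
move C'q : (2 * C' `^ q) C0 => D C0; pose C := D + B + 2 * s1 + 1; exists C.
  by move: B0 s10 C0; rewrite /C => h1 h2 h3; lra.
move=> eps sig /andP[e0 e1] sig0 H.
(* The largest time allowed by 2 (1 + th) <= 1 + sig. *)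
pose th := (1 + sig) / 2 - 1.
have th2 : 2 * (1 + th) = 1 + sig by rewrite /th; field.
have e1' : 1 <= eps^-1 by rewrite invf_ge1.
have CDs : 2 * s1 <= C by move: B0 s10 C0; rewrite /C => h1 h2 h3; lra.
have CD : D <= C by move: B0 s10 C0; rewrite /C => h1 h2 h3; lra.
have CB : B + s1 + 1 <= C by move: B0 s10 C0; rewrite /C => h1 h2 h3; lra.
have Cp : 0 <= C by move: B0 s10 C0; rewrite /C => h1 h2 h3; lra.
have exp1 (x : R) : x <= expR x by apply: le_trans (expR_ge1Dx x); rewrite lerDr.
have [ths|ths] := ltP th s0.
  have ss : sig <= C by apply: le_trans CDs; move: ths th2; rewrite s1E => h1 h2; lra.
  split=> [al|_]; apply: (le_trans ss).
    rewrite ler_peMr// -[leLHS](powRr0 eps); apply: ger_powR; first by rewrite e0.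
    by rewrite oppr_le0 invr_ge0 subr_ge0 ltW.
  by apply: le_trans (exp1 _); rewrite ler_peMr.
have HA (A : R -> R) : (forall t : R, 0 <= t -> is_derive t 1 A ((1 + t) `^ (- a))) ->
    A th - A s0 <= B / eps.
  by move=> dA; apply: (H A th s0 dA (ltW s00) ths); rewrite ?ltrDr ?th2.
have th0 : 0 < 1 + th by move: ths s00 => h1 h2; lra.
have sth : sig <= 2 * (1 + th) by rewrite th2 lerDr.
split=> [al|aE]; apply: (le_trans sth).
  have b0 : 0 < 1 - a by rewrite subr_gt0.
  have {}HA : (1 + th) `^ (1 - a) / (1 - a) - s1 `^ (1 - a) / (1 - a) <= B / eps.
    apply: (HA (fun t => (1 + t) `^ (1 - a) / (1 - a))) => t t0.
    have H1 := derM (der_powR_add1 (1 - a) t0) (derC t 1 (1 - a)^-1).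
    apply: (is_derive_eq H1); rewrite mulr0 addr0.
    have -> : 1 - a - 1 = - a by ring.
    by field; rewrite gt_eqF.
  have HP : (1 + th) `^ (1 - a) <= C' / eps.
    have : (1 + th) `^ (1 - a) <= (1 - a) * (B / eps) + s1 `^ (1 - a).
      by rewrite -lerBlDr -ler_pdivrMl// mulrBr ![(1 - a)^-1 * _]mulrC.
    move=> h; apply: (le_trans h).
    have -> : C' / eps = (1 - a) * (B / eps) + s1 `^ (1 - a) / eps.
      by rewrite /C'; field; rewrite gt_eqF.
    rewrite lerD2l.
    by rewrite ler_peMr ?powR_ge0.
  have -> : 1 + th = ((1 + th) `^ (1 - a)) `^ q.
    by rewrite -powRrM divff ?gt_eqF// powRr1// ltW.
  have q0 : 0 <= q by rewrite invr_ge0 ltW.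
  have C'0 : 0 <= C' by rewrite addr_ge0 ?mulr_ge0 ?powR_ge0// ltW.
  apply: (@le_trans _ _ (2 * (C' / eps) `^ q)).
    rewrite ler_pM2l//; apply: ge0_ler_powR; rewrite ?nnegrE ?powR_ge0//.
    by rewrite divr_ge0// ltW.
  rewrite powRM ?invr_ge0 ?(ltW e0)// mulrA C'q -(powR_inv1 (ltW e0)) -powRrM mulN1r.
  by rewrite ler_wpM2r ?powR_ge0.
have {}HA : ln (1 + th) - ln s1 <= B / eps.
  apply: (HA (fun t => ln (1 + t))) => t t0; have t1 : 0 < 1 + t by lra.
  have H1 := der_comp (h := @ln R) (is_derive1_ln t1) (der_add1 t).
  by apply: (is_derive_eq H1); rewrite aE mulr1 powR_inv1// ltW.
(* Absorbs the factor 2 of sig <= 2 (1 + th); it accounts for the + 1 in B + s1 + 1. *)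
have le2 : 2 <= expR eps^-1.
  by apply: le_trans (expR_ge1Dx _); move: e1' => ?; lra.
have le3 : 1 + th <= expR ((B + s1) / eps).
  rewrite -[leLHS]lnK ?posrE// ler_expR.
  have l1 : ln s1 <= s1 / eps by apply: le_trans (ltW (ln_sublinear s10)) _; rewrite ler_peMr// ltW.
  by rewrite mulrDl; move: HA l1 => h1 h2; lra.
apply: (@le_trans _ _ (expR eps^-1 * expR ((B + s1) / eps))).
  by apply: ler_pM => //; exact: ltW.
rewrite -expRD ler_expR -[X in X + _]mul1r -mulrDl ler_wpM2r ?invr_ge0 ?(ltW e0)//.
by rewrite addrC.
Qed.

End TimeBound.

(** * From the initial data to the bound on the existence time *)

Section Lifespan.
Context {R : realType}.
Variable n : nat.
Variables (A gamma mu rb r : R) (rho0 : 'rV[R]_n -> R) (u0 : 'rV[R]_n -> 'rV[R]_n).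
Variables (phix : 'I_n -> 'rV[R]_n -> R) (phixx : 'I_n -> 'I_n -> 'rV[R]_n -> R) (C0 : R).
Hypothesis tw : test_weight (@phi R n) phix phixx C0.
Hypotheses (n1 : (0 < n)%N) (C00 : 0 < C0) (gamma1 : 1 < gamma) (mu0 : 0 <= mu).
Hypotheses (mun : mu <= 3 - n%:R) (A0 : 0 < A) (rb0 : 0 < rb) (r0 : 0 < r).
Hypotheses (hrho0 : test_fun rho0) (hu0 : test_field u0).
Hypotheses (srho0 : supp rho0 `<=` [set x | enorm x <= r]).
Hypotheses (su0 : supp u0 `<=` [set x | enorm x <= r]).
Let Irho := integralRn (fun x => rho0 x * phi x).
Let Iu := integralRn (fun x => dotv (u0 x) (gradv (@phi R n) x)).
Hypotheses (Irho_gt0 : 0 < Irho) (Iu_gt0 : 0 < Iu).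

Lemma supp_out (V : zmodType) (f : 'rV[R]_n -> V) x :
  supp f `<=` [set x | enorm x <= r] -> r < enorm x -> f x = 0.
Proof.
move=> sf rx; apply/eqP; apply: contraTT rx => fx; rewrite -leNgt.
by apply: sf; exact: subset_closure.
Qed.

Let rL x : r < `|x : 'rV[R]_n| -> r < enorm x.
Proof. by move=> h; apply: lt_le_trans (normr_le_enorm x). Qed.

Let cs_rho0 : cs r rho0.
Proof.
split; first by have [/(_ [::])[]] := hrho0.
by move=> x /rL; exact: supp_out.
Qed.

Let cs_u0 j : cs r (fun x => u0 x 0 j).
Proof.
split; first by have [/(_ j [::])[]] := hu0.
by move=> x /rL h; rewrite (supp_out su0 h) mxE.
Qed.

Let flux x := \sum_j u0 x 0 j * phix j x.

Let cs_flux : cs r flux.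
Proof. by apply: cs_sum => j; apply: csM; [exact: cs_u0|exact: (tw_cx tw)]. Qed.

Let IuE : Iu = integralRn flux.
Proof.
congr integralRn; apply/funext => x; apply: eq_bigr => j _; rewrite mxE; congr (_ * _).
by rewrite /partial; have [_ ->] := tw_dx tw j x.
Qed.

Let c := Num.sqrt (A * gamma * rb `^ (gamma - 1)).
Let b : R := (n%:R - 1) / 2.

(** All constants are fixed before eps, T and the solution; sig < tau < T leaves room for the two
    clamps. *)
Lemma euler_time_bound : exists eps0 C : R, [/\ 0 < eps0, 0 < C &
  forall eps T rho u sig tau, 0 < eps <= eps0 ->
    euler_solution A gamma mu rb eps rho0 u0 T rho u ->
    0 < sig -> sig < tau -> (tau%:E < T)%E ->
    (mu < 3 - n%:R -> sig <= C * eps `^ (- (2 / (3 - n%:R - mu)))) /\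
    (mu = 3 - n%:R -> sig <= expR (C * eps^-1))].
Proof.
have g0 : 0 < gamma by exact: lt_trans gamma1.
have cc : 0 < A * gamma * rb `^ (gamma - 1) by rewrite !mulr_gt0// powR_gt0.
have c0 : 0 < c by rewrite sqrtr_gt0.
have c2 : c ^+ 2 = A * gamma * rb `^ (gamma - 1) by rewrite sqr_sqrtr// ltW.
have b0 : 0 <= b by rewrite divr_ge0// subr_ge0 ler1n.
have ab1 : b + mu / 2 <= 1 by rewrite /b; move: mun => h; lra.
have K0 : 0 < c + mu / 2 by rewrite ltr_pwDl// divr_ge0.
have [d [p [d0 p1 p2 coer]]] := pressure_coercive A0 gamma1 rb0 K0.
(* From 1 + r + c t <= (1 + r + c) (1 + t), with the factor e^r split off e^(r + c t). *)
pose C1 := C0 * ((1 + r + c) `^ b * expR r).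
have C10 : 0 < C1.
  by rewrite mulr_gt0// mulr_gt0 ?expR_gt0// powR_gt0// !addr_gt0.
(* Y 0 = eps rb Iu + eps^2 I2, and eps0 is chosen so that the second term costs at most half of the
   first. *)
pose m1 := rb * Iu / 2; have m10 : 0 < m1 by rewrite divr_gt0// mulr_gt0.
pose w := (1 + (2 * c)^-1) `^ (- (mu / 2)).
have w0 : 0 < w by rewrite powR_gt0// ltr_pwDl// invr_ge0 mulr_ge0// ltW.
have B0 : 0 < C1 / (d * (m1 * w)) by rewrite divr_gt0// mulr_gt0// mulr_gt0.
have s00 : 0 < 4 / ((p - 1) * d) by rewrite divr_gt0// mulr_gt0// subr_gt0.
have a0 : 0 <= b + mu / 2 by rewrite addr_ge0// divr_ge0.
have [C Cgt0 HC] := time_bound a0 ab1 s00 B0.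
pose I2 := integralRn (fun x => flux x * rho0 x).
have I20 : 0 < `|I2| + 1 by rewrite ltr_wpDl.
exists (Num.min 1 (m1 / (`|I2| + 1))), C; split => //.
  by rewrite lt_min ltr01 divr_gt0.
move=> eps T rho u sig tau /andP[e0 +] sol sig0 sigtau tauT.
rewrite le_min => /andP[e1 e2].
have tau0 : 0 < tau by exact: lt_trans sigtau.
have [rhot [rhox [ut [ux fl]]]] := flow_of_euler gamma1 sol tau0 tauT.
have cl0 (s : R) : 0 < s -> clamp s 0 = 0 by move=> s0; rewrite clamp_id// ltW.
have [_ _ _ _ sol0] := sol.
have init x : r < enorm x ->
    rest rb (fun t => rho (clamp tau t)) (fun j t x => u (clamp tau t) x 0 j) 0 x.
  move=> rx; have [u0E r0E] := sol0 x; split.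
    by rewrite cl0// r0E (supp_out srho0 rx) mulr0 addr0.
  by move=> j; rewrite cl0// u0E (supp_out su0 rx) scaler0 mxE.
set rho' := fun t => rho (clamp tau t) in fl init.
set u' := fun j t x => u (clamp tau t) x 0 j in fl init.
pose X := momX rb sig rho' (@phi R n).
pose Y := momY sig rho' u' phix.
pose G := force A gamma rb c rho' u' (@phi R n) phixx.
have cX : continuous X by exact: (continuous_momX fl tw A0 gamma1 rb0 mu0 tau0 c0 c2 r0 init sig0 sigtau).
have cY : continuous Y by exact: (continuous_momY fl tw A0 gamma1 rb0 mu0 tau0 c0 c2 r0 init sig0 sigtau).
have dX := is_derive_momX fl tw A0 gamma1 rb0 mu0 tau0 c0 c2 r0 init sig0 sigtau.
have dY := is_derive_momY fl tw A0 gamma1 rb0 mu0 tau0 c0 c2 r0 init sig0 sigtau.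
have X0 : 0 < X 0.
  have -> : X 0 = eps * Irho.
    rewrite -(integralRnZ _ (csM cs_rho0 (tw_c tw))).
    congr integralRn; apply/funext => x; have [_ r0E] := sol0 x.
    by rewrite /rho' !cl0// r0E; ring.
  exact: mulr_gt0.
have Y0 : eps * m1 <= Y 0.
  have -> : Y 0 = eps * rb * Iu + eps ^+ 2 * I2.
    have cs2 : cs r (fun x => flux x * rho0 x) by apply: csM; [exact: cs_flux|exact: cs_rho0.1].
    rewrite IuE -(integralRnZ _ cs_flux) -(integralRnZ _ cs2).
    rewrite -(integralRnD (csZ _ cs_flux) (csZ _ cs2)).
    congr integralRn; apply/funext => x; have [u0E r0E] := sol0 x.
    rewrite /flux mulr_suml !mulr_sumr -big_split /=; apply: eq_bigr => j _.
    by rewrite /rho' /u' !cl0// r0E u0E mxE; ring.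
  have h1 : - `|I2| <= I2 by rewrite lerNl ler_normr lerN2 orbC lexx.
  have h2 : eps * (`|I2| + 1) <= m1 by rewrite -ler_pdivlMr.
  have h3 : eps * m1 <= eps * (rb * Iu + eps * I2).
    rewrite ler_pM2l//.
    have := ler_wpM2l (ltW e0) h1.
    have m1E : rb * Iu = 2 * m1 by rewrite /m1; field.
    by rewrite m1E; move: h2 e0 => h2 h4 h5; lra.
  by apply: (le_trans h3); rewrite le_eqVlt; apply/orP; left; apply/eqP; ring.
have Y0' : 0 < Y 0 by apply: lt_le_trans Y0; exact: mulr_gt0.
pose Phi (t : R) := C1 * (expR (c * t) * (1 + t) `^ b).
have GE (t k : R) : 0 < t -> t < sig -> 0 <= X t -> 0 <= Y t -> 0 <= k <= c + mu / 2 ->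
  Phi t * (d * Num.min (((Y t + k * X t) / Phi t) ^+ 2) (((Y t + k * X t) / Phi t) `^ p)) <= G t.
  move=> t0 ts Xt Yt kK.
  have t1 : 0 < 1 + t by rewrite addr_gt0.
  have P0 : 0 < Phi t by rewrite mulr_gt0// mulr_gt0 ?expR_gt0 ?powR_gt0.
  have rct : 0 <= r + c * t by rewrite addr_ge0 ?mulr_ge0// ltW.
  have mass : integralRn (fun x => disc (r + c * t) x * @phi R n x) <= Phi t.
    apply: (le_trans (tw_mass tw rct)); rewrite -/b /Phi /C1 expRD.
    have -> : C0 * ((1 + r + c) `^ b * expR r) * (expR (c * t) * (1 + t) `^ b) =
      C0 * ((1 + r + c) `^ b * (1 + t) `^ b) * (expR r * expR (c * t)) by ring.
    rewrite ler_pM2r ?mulr_gt0 ?expR_gt0// ler_pM2l//.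
    rewrite -powRM ?(ltW t1)//; last by rewrite !addr_ge0// ltW.
    apply: ge0_ler_powR => //; rewrite ?nnegrE ?addr_ge0 ?mulr_ge0 ?addr_ge0 ?(ltW c0) ?(ltW r0) ?(ltW t0)//.
    have h1 := mulr_ge0 (ltW r0) (ltW t0).
    by move: h1 c0 t0 => h1 h2 h3; lra.
  apply: le_trans (force_ge fl tw A0 gamma1 rb0 mu0 tau0 c0 c2 r0 init sig0 sigtau t0 ts P0 mass Xt Yt).
  rewrite ler_pM2l//.
  have -> : (Y t + k * X t) / Phi t = Y t / Phi t + k * (X t / Phi t) by field; rewrite gt_eqF.
  by apply: coer => //; rewrite divr_ge0// ltW.
have e01 : 0 < eps <= 1 by rewrite e0.
have [] := HC eps sig e01 sig0.
  move=> Ah th ts dAh ts0 tsth h1 h2.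
  have H := growth_bound c0 mu0 b0 ab1 erefl C10 d0 p1 p2 sig0 cX cY dX dY GE X0 Y0' dAh ts0 tsth h1 h2.
  apply: (le_trans H); rewrite -/w -mulrA -invfM ler_pM2l// lef_pV2 ?posrE; first last.
  - by rewrite !mulr_gt0.
  - by rewrite !mulr_gt0.
  rewrite -mulrA ler_pM2l// mulrAC ler_pM2r// mulrC //.
have qE : 1 - (b + mu / 2) = (3 - n%:R - mu) / 2 by rewrite /b; field.
rewrite qE invf_div => H1 H2; split => h.
  by apply: H1; rewrite /b; move: h => ?; lra.
by apply: H2; rewrite /b h; field.
Qed.

End Lifespan.

(** If B < T, also when T is [+oo], there is room for sig = B + e and tau = B + 2 e below T. *)
Lemma ereal_le_of_inner_times {R : realType} (T : \bar R) (B : R) : 0 <= B ->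
  (forall sig tau, 0 < sig -> sig < tau -> (tau%:E < T)%E -> sig <= B) -> (T <= B%:E)%E.
Proof.
move=> B0 H; rewrite leNgt; apply/negP => BT.
have [e e0 eT] : exists2 e : R, 0 < e & ((B + 2 * e)%:E < T)%E.
  case: T BT {H} => [T| |] //; last by exists 1 => //; rewrite ltry.
  by rewrite lte_fin => BT; exists ((T - B) / 3); rewrite ?lte_fin; lra.
have : B + e <= B by apply: H eT; lra.
by rewrite gerDl leNgt e0.
Qed.

Theorem theorem2 (R : realType) (n : nat) (hn : n = 1%N \/ n = 2%N)
    (gamma mu A rhobar r : R)
    (hgamma : 1 < gamma) (hmu : 0 <= mu <= 3 - n%:R)
    (hA : 0 < A) (hrhobar : 0 < rhobar) (hr : 0 < r)
    (rho0 : 'rV[R]_n -> R) (u0 : 'rV[R]_n -> 'rV[R]_n)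
    (hrho0 : test_fun rho0) (hu0 : test_field u0)
    (srho0 : supp rho0 `<=` [set x | enorm x <= r])
    (su0 : supp u0 `<=` [set x | enorm x <= r])
    (irho0 : 0 < integralRn (fun x => rho0 x * phi x))
    (iu0 : 0 < integralRn (fun x => dotv (u0 x) (gradv (@phi R n) x))) :
  exists eps0 C : R, 0 < eps0 /\ 0 < C /\
    forall eps : R, 0 < eps <= eps0 ->
      ~ (exists rho u,
           euler_solution A gamma mu rhobar eps rho0 u0 +oo%E rho u) /\
      (mu < 3 - n%:R ->
         (lifespan A gamma mu rhobar eps rho0 u0
            <= (C * eps `^ (- (2 / (3 - n%:R - mu))))%:E)%E) /\
      (mu = 3 - n%:R ->
         (lifespan A gamma mu rhobar eps rho0 u0 <= (expR (C * eps^-1))%:E)%E).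
Proof.
have [phix [phixx [C0 [C00 tw]]]] : exists phix phixx (C0 : R),
    0 < C0 /\ test_weight (@phi R n) phix phixx C0.
  by case: hn => ->; [exact: test_weight1|exact: test_weight2].
have n1 : (0 < n)%N by case: hn => ->.
have /andP[mu0 mun] := hmu.
have [eps0 [C [e00 Cgt0 H]]] := euler_time_bound tw n1 C00 hgamma mu0 mun hA hrhobar
  hr hrho0 hu0 srho0 su0 irho0 iu0.
exists eps0, C; split => //; split => // eps he.
have lt_case T rho u : euler_solution A gamma mu rhobar eps rho0 u0 T rho u ->
    mu < 3 - n%:R -> (T <= (C * eps `^ (- (2 / (3 - n%:R - mu))))%:E)%E.
  move=> sol h; apply: ereal_le_of_inner_times; first by rewrite mulr_ge0 ?powR_ge0// ltW.
  by move=> sig tau s0 st tT; apply: (H eps T rho u sig tau he sol s0 st tT).1.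
have eq_case T rho u : euler_solution A gamma mu rhobar eps rho0 u0 T rho u ->
    mu = 3 - n%:R -> (T <= (expR (C * eps^-1))%:E)%E.
  move=> sol h; apply: ereal_le_of_inner_times; first exact: expR_ge0.
  by move=> sig tau s0 st tT; apply: (H eps T rho u sig tau he sol s0 st tT).2.
split.
  (* A global solution would make [+oo] at most a real number. *)
  case=> rho [u sol]; move: mun; rewrite le_eqVlt => /orP[/eqP h|h].
    by have := eq_case _ _ _ sol h.
  by have := lt_case _ _ _ sol h.
split=> h; apply: ge_ereal_sup => T [_ [rho [u sol]]].
  exact: lt_case sol h.
exact: eq_case sol h.
Qed.
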